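(* Let $\mathbb K$ be $\mathbb R$, $\mathbb C$ or the quaternions $\mathbb H$, let $\theta=\tfrac12\dim_{\mathbb R}\mathbb K$, and let $n\ge1$. Consider the map $\mathrm{Herm}_{\mathbb K}(n)\to\mathcal R_n$ sending a Hermitian matrix $T$ to the Rayleigh triangle $\mathcal L=(\lambda_{j\alpha})$ whose $j$-th row $\lambda_{j1}\le\dots\le\lambda_{jj}$ consists of the eigenvalues of the left upper $j\times j$ block $[T]_j$ of $T$, $j=1,\dots,n$. Then the image of the Lebesgue measure on $\mathrm{Herm}_{\mathbb K}(n)$ under this map is $C_n(\theta)\,\mathfrak r_\theta(\mathcal L)\,d\mathcal L$, where $$\mathfrak r_\theta(\mathcal L)=\frac{\prod_{2\le j\le n}\ \prod_{1\le\alpha\le j-1,\ 1\le p\le j}|\lambda_{(j-1)\alpha}-\lambda_{jp}|^{\theta-1}}{\prod_{2\le j\le n-1}\ \prod_{1\le\alpha<\beta\le j}(\lambda_{j\beta}-\lambda_{j\alpha})^{2\theta-2}}\cdot\prod_{1\le p<q\le n}(\lambda_{nq}-\lambda_{np}),\qquad C_n(\theta)=\frac{\pi^{n(n-1)\theta/2}}{\Gamma(\theta)^{n(n-1)/2}}.$$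
   Context: $\mathrm{Herm}_{\mathbb K}(n)$ is the space of $n\times n$ matrices $T=(t_{kl})$ over $\mathbb K$ with $t_{kl}=\overline{t_{lk}}$, equipped with the Lebesgue measure $\prod_{k>l}\{dt_{kl}\}\prod_k dt_{kk}$, where $\{dx\}$ is the standard Lebesgue measure on $\mathbb K$: $dx$ on $\mathbb R$; $du\,dv$ for $x=u+iv\in\mathbb C$; $du\,dv\,dw\,dz$ for $x=u+iv+jw+kz\in\mathbb H$. A Hermitian $j\times j$ matrix over $\mathbb K$ has $j$ real eigenvalues with multiplicity (for $\mathbb K=\mathbb H$: the entries of the real diagonal matrix to which it is conjugate by the quaternionic unitary group). A Rayleigh triangle of size $n$ is a collection of real numbers $\lambda_{jk}$, $1\le k\le j\le n$, with $\lambda_{(j+1)k}\le\lambda_{jk}\le\lambda_{(j+1)(k+1)}$ for all $1\le k\le j\le n-1$; $\mathcal R_n$ is the set of all of them and $d\mathcal L=\prod_{1\le\alpha\le j\le n}d\lambda_{j\alpha}$. *)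

(* Defs.v *)
From HB Require Import structures.
From mathcomp Require Import all_boot all_order all_algebra.
From mathcomp Require Import complex.
From mathcomp Require Import all_classical all_reals all_analysis.
From mathcomp Require Import ring zify.

Set Implicit Arguments.
Unset Strict Implicit.
Unset Printing Implicit Defensive.

Import Order.TTheory GRing.Theory Num.Theory.
Import numFieldNormedType.Exports.

Local Open Scope classical_set_scope.
Local Open Scope ring_scope.

(* Quat u v w z is u + i v + j w + k z, with i^2 = j^2 = k^2 = ijk = -1. *)
Record quaternion (R : Type) : Type := Quat { q0 : R; q1 : R; q2 : R; q3 : R }.

Section quaternion_choice.
Variable R : Type.
Definition prod_of_quat (x : quaternion R) := (q0 x, q1 x, q2 x, q3 x).
Definition quat_of_prod (x : R * R * R * R) :=
  let: (a, b, c, d) := x in Quat a b c d.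
Lemma prod_of_quatK : cancel prod_of_quat quat_of_prod.
Proof. by case. Qed.
End quaternion_choice.

HB.instance Definition _ (R : choiceType) :=
  Choice.copy (quaternion R) (can_type (@prod_of_quatK R)).

Section quaternion_ring.
Variable R : comNzRingType.
Implicit Types x y : quaternion R.

Definition quat_zero : quaternion R := Quat 0 0 0 0.
Definition quat_one : quaternion R := Quat 1 0 0 0.
Definition quat_opp x := Quat (- q0 x) (- q1 x) (- q2 x) (- q3 x).
Definition quat_add x y :=
  Quat (q0 x + q0 y) (q1 x + q1 y) (q2 x + q2 y) (q3 x + q3 y).
Definition quat_mul x y :=
  Quat (q0 x * q0 y - q1 x * q1 y - q2 x * q2 y - q3 x * q3 y)
       (q0 x * q1 y + q1 x * q0 y + q2 x * q3 y - q3 x * q2 y)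
       (q0 x * q2 y - q1 x * q3 y + q2 x * q0 y + q3 x * q1 y)
       (q0 x * q3 y + q1 x * q2 y - q2 x * q1 y + q3 x * q0 y).
Definition quat_conj x := Quat (q0 x) (- q1 x) (- q2 x) (- q3 x).

Fact quat_addA : associative quat_add.
Proof. by move=> [a b c d] [e f g h] [i j k l]; rewrite /quat_add /= !addrA. Qed.
Fact quat_addC : commutative quat_add.
Proof.
move=> [a b c d] [e f g h]; rewrite /quat_add /=.
by congr Quat; rewrite addrC.
Qed.
Fact quat_add0 : left_id quat_zero quat_add.
Proof. by case=> a b c d; rewrite /quat_add /= !add0r. Qed.
Fact quat_addN : left_inverse quat_zero quat_opp quat_add.
Proof. by case=> a b c d; rewrite /quat_add /quat_opp /= !addNr. Qed.

HB.instance Definition _ := GRing.isZmodule.Build (quaternion R)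
  quat_addA quat_addC quat_add0 quat_addN.

Fact quat_mulA : associative quat_mul.
Proof.
by move=> [a b c d] [e f g h] [i j k l]; rewrite /quat_mul /=; congr Quat; ring.
Qed.
Fact quat_mul1x : left_id quat_one quat_mul.
Proof. by case=> a b c d; rewrite /quat_mul /=; congr Quat; ring. Qed.
Fact quat_mulx1 : right_id quat_one quat_mul.
Proof. by case=> a b c d; rewrite /quat_mul /=; congr Quat; ring. Qed.
Fact quat_mulDl : left_distributive quat_mul +%R.
Proof.
by move=> [a b c d] [e f g h] [i j k l]; congr Quat; rewrite /=; ring.
Qed.
Fact quat_mulDr : right_distributive quat_mul +%R.
Proof.
by move=> [a b c d] [e f g h] [i j k l]; congr Quat; rewrite /=; ring.
Qed.
Fact quat_1neq0 : quat_one != 0.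
Proof. by apply/eqP => -[] /eqP; rewrite oner_eq0. Qed.

HB.instance Definition _ := GRing.Zmodule_isNzRing.Build (quaternion R)
  quat_mulA quat_mul1x quat_mulx1 quat_mulDl quat_mulDr quat_1neq0.

End quaternion_ring.

Inductive base_algebra := RealAlg | ComplexAlg | QuaternionAlg.

Section base_algebra.
Variables (R : realType) (K : base_algebra).

Definition base_ring : nzRingType :=
  match K with
  | RealAlg => R
  | ComplexAlg => R[i]
  | QuaternionAlg => quaternion R
  end.

Definition base_dim : nat :=
  match K with RealAlg => 1 | ComplexAlg => 2 | QuaternionAlg => 4 end.

Definition base_theta : R := base_dim%:R / 2.

Definition base_conj : base_ring -> base_ring :=
  match K return
    match K return nzRingType with
    | RealAlg => R | ComplexAlg => R[i] | QuaternionAlg => quaternion R end ->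
    match K return nzRingType with
    | RealAlg => R | ComplexAlg => R[i] | QuaternionAlg => quaternion R end
  with
  | RealAlg => id
  | ComplexAlg => @conjc R
  | QuaternionAlg => @quat_conj R
  end.

(* The element of K with real coordinates c 0, ..., c (base_dim - 1). *)
Definition base_of_coords (c : nat -> R) : base_ring :=
  match K return
    match K return nzRingType with
    | RealAlg => R | ComplexAlg => R[i] | QuaternionAlg => quaternion R end
  with
  | RealAlg => c 0
  | ComplexAlg => Complex (c 0) (c 1)
  | QuaternionAlg => Quat (c 0) (c 1) (c 2) (c 3)
  end.

Definition base_real (x : R) : base_ring :=
  base_of_coords (fun i => if i is 0 then x else 0).

End base_algebra.

Section hermitian.
Variables (R : realType) (K : base_algebra).

Definition adjoint_mx m n (A : 'M[base_ring R K]_(m, n)) :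
    'M[base_ring R K]_(n, m) :=
  map_mx (@base_conj R K) A^T.

Definition is_hermitian n (A : 'M[base_ring R K]_n) : bool :=
  adjoint_mx A == A.

Record herm n := Herm {
  herm_mx :> 'M[base_ring R K]_n;
  _ : is_hermitian herm_mx }.

Lemma hermP n (T : herm n) : is_hermitian T. Proof. by case: T. Qed.

HB.instance Definition _ n := [isSub for @herm_mx n].
HB.instance Definition _ n := [Choice of herm n by <:].

End hermitian.

(* Position of the first coordinate of row k (counted from 0) when the entries *)
(* on and below the diagonal are read row by row; row k consists of k elements *)
(* of K followed by one real number.                                           *)
Definition herm_offset (K : base_algebra) (k : nat) : nat :=
  (k + base_dim K * 'C(k, 2))%N.

Definition herm_dim (K : base_algebra) (n : nat) : nat := herm_offset K n.

Section hermitian_coordinates.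
Variables (R : realType) (K : base_algebra) (n : nat).
Local Notation d := (base_dim K).
Implicit Types x : (herm_dim K n).-tuple (measurableTypeR R).

Definition herm_coord x (i : nat) : R := nth (0 : R) x i.

Definition herm_lower x (k l : nat) : base_ring R K :=
  base_of_coords K (fun c => herm_coord x (herm_offset K k + d * l + c)).

Definition herm_diag x (k : nat) : base_ring R K :=
  base_real K (herm_coord x (herm_offset K k + d * k)).

Definition herm_mx_of_coords x : 'M[base_ring R K]_n :=
  \matrix_(k, l) if (l < k)%N then herm_lower x k l
                 else if (k < l)%N then base_conj (herm_lower x l k)
                 else herm_diag x k.

Lemma herm_mx_of_coords_hermitian x : is_hermitian (herm_mx_of_coords x).
Proof.
apply/eqP/matrixP => k l; rewrite !mxE.
have conjK (y : base_ring R K) : base_conj (base_conj y) = y.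
  rewrite /base_conj; move: y; rewrite /base_ring.
  by case: K => [//|[a b] /=|[a b c e]]; rewrite /quat_conj /= !opprK.
case: (ltngtP k l) => [//||kl]; first by rewrite conjK.
rewrite kl /herm_diag /base_conj /base_real /base_of_coords.
move: (herm_coord _ _) => r; case: K => //=; first by rewrite oppr0.
by rewrite /quat_conj /= !oppr0.
Qed.

Definition herm_of_coords x : herm R K n :=
  Herm (herm_mx_of_coords_hermitian x).

End hermitian_coordinates.

Lemma herm_offsetS K k :
  herm_offset K k.+1 = (herm_offset K k + base_dim K * k).+1.
Proof. by rewrite /herm_offset binS bin1 mulnDr; lia. Qed.

Lemma leq_herm_offset K : {homo herm_offset K : k l / (k <= l)%N}.
Proof.
by apply: (homo_leq leqnn leq_trans) => k; rewrite herm_offsetS; lia.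
Qed.

Lemma herm_offset_row K n i : (i < herm_offset K n)%N ->
  exists2 k, (k < n)%N & (herm_offset K k <= i < herm_offset K k.+1)%N.
Proof.
elim: n => [|n IHn]; first by rewrite /herm_offset muln0.
move=> iS; have [/IHn[k kn ki]|ni] := ltnP i (herm_offset K n).
  by exists k => //; exact: ltnW.
by exists n => //; rewrite ni.
Qed.

Section hermitian_coordinates_bijective.
Variables (R : realType) (K : base_algebra).
Local Notation d := (base_dim K).

Definition base_coords : base_ring R K -> seq R :=
  match K return
    match K return nzRingType with
    | RealAlg => R | ComplexAlg => R[i] | QuaternionAlg => quaternion R end ->
    seq R
  with
  | RealAlg => fun x => [:: x]
  | ComplexAlg => fun x => let: Complex a b := x in [:: a; b]
  | QuaternionAlg => fun x => [:: q0 x; q1 x; q2 x; q3 x]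
  end.

Lemma base_coordsK y : base_of_coords K (nth 0 (base_coords y)) = y.
Proof.
by rewrite /base_of_coords /base_coords; move: y; rewrite /base_ring;
  case: K => [//|[a b]|[]].
Qed.

Lemma base_of_coordsK f c :
  (c < d)%N -> nth 0 (base_coords (base_of_coords K f)) c = f c.
Proof.
rewrite /base_of_coords /base_coords /base_dim.
by case: K => /=; move: c => [|[|[|[|c]]]].
Qed.

Lemma base_of_coords_ext (f g : nat -> R) : (forall c, (c < d)%N -> f c = g c) ->
  base_of_coords K f = base_of_coords K g.
Proof.
by rewrite /base_of_coords /base_dim; case: K => fg; rewrite !fg.
Qed.

Lemma base_dim_gt0 : (0 < d)%N. Proof. by rewrite /base_dim; case: K. Qed.

Lemma base_real_coords y : base_conj y = y ->
  base_real K (nth 0 (base_coords y) 0) = y.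
Proof.
rewrite /base_real /base_of_coords /base_coords /base_conj.
move: y; rewrite /base_ring; case: K => [//|[a b]|[a b c e]] /=.
  by case=> /eqP; rewrite eqNr => /eqP ->.
rewrite /quat_conj /=; case=> /eqP + /eqP + /eqP.
by rewrite !eqNr => /eqP -> /eqP -> /eqP ->.
Qed.

Lemma herm_of_coords_inj n : injective (@herm_of_coords R K n).
Proof.
move=> x y /(congr1 val) /matrixP xy.
apply/eq_from_tnth => i; rewrite !(tnth_nth 0).
have [k kn /andP[ki ik]] := herm_offset_row (ltn_ord i).
pose k' := Ordinal kn.
set r := (i - herm_offset K k)%N.
have ri : val i = (herm_offset K k + r)%N by rewrite subnKC.
have : (r <= d * k)%N by rewrite leq_subLR -ltnS -herm_offsetS.
rewrite leq_eqVlt => /predU1P[rE|rk].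
  have := xy k' k'; rewrite !mxE ltnn /herm_diag /base_real.
  move/(congr1 (fun y => nth 0 (base_coords y) 0)).
  by rewrite !base_of_coordsK ?base_dim_gt0// /herm_coord /= -rE -ri.
have lk : (r %/ d < k)%N by rewrite ltn_divLR ?base_dim_gt0// mulnC.
have := xy k' (Ordinal (ltn_trans lk kn)); rewrite !mxE /= lk /herm_lower.
move/(congr1 (fun y => nth 0 (base_coords y) (r %% d))).
rewrite !base_of_coordsK ?ltn_mod ?base_dim_gt0// /herm_coord.
by rewrite -addnA [(d * _)%N]mulnC -divn_eq -ri.
Qed.

Lemma herm_of_coords_surj n (T : herm R K n) :
  exists x, herm_of_coords x = T.
Proof.
case: n T => [|n] T.
  exists [tuple of nseq _ 0]; apply/val_inj/matrixP => -[] //.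
pose row i := find (fun k => i < herm_offset K k.+1)%N (iota 0 n.+1).
have rowE k r : (k < n.+1)%N -> (r <= d * k)%N ->
    row (herm_offset K k + r)%N = k.
  move=> kn rk; rewrite /row; set p := fun _ => _.
  have pk : p k by rewrite /p herm_offsetS; lia.
  have hasp : has p (iota 0 n.+1).
    by apply/hasP; exists k => //; rewrite mem_iota.
  have fn : (find p (iota 0 n.+1) < n.+1)%N.
    by rewrite -[ltnRHS](size_iota 0) -has_find.
  have := nth_find 0%N hasp; rewrite nth_iota// add0n => pf.
  apply/eqP; rewrite eqn_leq; apply/andP; split.
    rewrite leqNgt; apply/negP => /(before_find 0%N).
    by rewrite nth_iota// add0n pk.
  rewrite leqNgt; apply/negP => fk.
  move: (leq_trans pf (leq_herm_offset K fk)).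
  by rewrite ltnNge leq_addr.
pose val i : R := let k := row i in let r := (i - herm_offset K k)%N in
  if (r < d * k)%N
  then nth 0 (base_coords (T (inord k) (inord (r %/ d)))) (r %% d)
  else nth 0 (base_coords (T (inord k) (inord k))) 0.
pose x : (herm_dim K n.+1).-tuple (measurableTypeR R) :=
  [tuple val i | i < herm_dim K n.+1].
have xE i : (i < herm_dim K n.+1)%N -> herm_coord x i = val i.
  by move=> ilt; rewrite /herm_coord -(tnth_nth 0 x (Ordinal ilt)) tnth_mktuple.
have bound k r : (k < n.+1)%N -> (r <= d * k)%N ->
    (herm_offset K k + r < herm_dim K n.+1)%N.
  by move=> /(leq_herm_offset K); rewrite herm_offsetS /herm_dim; lia.
have herm_conj k l : base_conj (T l k) = T k l.
  by have /eqP/matrixP/(_ k l) := hermP T; rewrite !mxE.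
have lowerE (k l : 'I_n.+1) : (l < k)%N -> herm_lower x k l = T k l.
  move=> lk; rewrite -[RHS]base_coordsK /herm_lower.
  have {}xE c : (c < d)%N ->
      herm_coord x (herm_offset K k + d * l + c) = nth 0 (base_coords (T k l)) c.
    move=> cd; have rk : (d * l + c < d * k)%N.
      rewrite (@leq_trans (d * l.+1))// ?leq_mul2l ?lk ?orbT//.
      by rewrite mulnS; lia.
    rewrite -addnA xE; last exact: bound (ltn_ord k) (ltnW rk).
    rewrite /val rowE ?(ltnW rk)// addKn rk !inord_val mulnC divnMDl ?base_dim_gt0//.
    by rewrite divn_small// addn0 modnMDl modn_small// inord_val.
  exact: base_of_coords_ext.
exists x; apply/val_inj/matrixP => k l; rewrite !mxE.
case: (ltngtP k l) => kl; rewrite ?lowerE//.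
rewrite -(val_inj kl) /herm_diag xE; last exact: bound.
by rewrite /val rowE// addKn ltnn !inord_val base_real_coords.
Qed.

Lemma herm_of_coords_bij n : bijective (@herm_of_coords R K n).
Proof.
have [g gK] : {g | cancel g (@herm_of_coords R K n)}.
  have /choice[g gK] := @herm_of_coords_surj n.
  by apply: cid; exists g.
by exists g => // x; apply: herm_of_coords_inj; rewrite gK.
Qed.

End hermitian_coordinates_bijective.

(* Lebesgue measure on n-tuples of reals, as the iterated product of the       *)
(* one-dimensional one.                                                        *)
Section lebesgue_tuple.
Variable R : realType.
Local Notation T := (measurableTypeR R).

Definition tuple_cons n (p : T * n.-tuple T) : n.+1.-tuple T :=
  [tuple of p.1 :: p.2].

Lemma measurable_tuple_cons n : measurable_fun setT (@tuple_cons n).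
Proof. exact: measurable_cons. Qed.

Section cons_measure.
Variables (n : nat) (mu : {sigma_finite_measure set (n.-tuple T) -> \bar R}).

Definition cons_measure : set (n.+1.-tuple T) -> \bar R :=
  pushforward (@lebesgue_measure R \x mu)%E (@tuple_cons n).

Let cons_measure0 : cons_measure set0 = 0%E.
Proof. by rewrite /cons_measure /pushforward preimage_set0 measure0. Qed.

Let cons_measure_ge0 A : (0 <= cons_measure A)%E.
Proof.
have mt := @measurable_tuple_cons n.
exact: (measure_ge0 (pushforward (@lebesgue_measure R \x mu)%E _)).
Qed.

Let cons_measure_sigma_additive : semi_sigma_additive cons_measure.
Proof.
have mt := @measurable_tuple_cons n.
exact: (@measure_semi_sigma_additive _ _ _
  (pushforward (@lebesgue_measure R \x mu)%E _)).
Qed.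

HB.instance Definition _ := isMeasure.Build _ _ _ cons_measure
  cons_measure0 cons_measure_ge0 cons_measure_sigma_additive.

Lemma cons_measure_sigma_finite : sigma_finite setT cons_measure.
Proof.
have /sigma_finiteP[F [TF ndF Foo]] := sigma_finiteT (@lebesgue_measure R).
have /sigma_finiteP[G [TG ndG Goo]] := sigma_finiteT mu.
pose uncons (t : n.+1.-tuple T) : T * n.-tuple T :=
  (thead t, [tuple of behead t]).
have mu_uncons : measurable_fun setT uncons.
  apply/measurable_fun_pair; last exact: measurable_behead.
  exact: measurable_tnth.
have consK : cancel (@tuple_cons n) uncons.
  by case=> a t; rewrite /uncons /tuple_cons /= theadE; congr pair; apply/val_inj.
exists (fun i => uncons @^-1` (F i `*` G i)).
  rewrite -preimage_bigcup -[LHS](preimage_setT uncons); congr (_ @^-1` _).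
  rewrite -setXTT TF TG predeqE => -[x y]; split.
    move=> [/= [k _ Fkx] [l _ Gly]]; exists (maxn k l) => //; split.
    - by move: x Fkx; exact/subsetPset/ndF/leq_maxl.
    - by move: y Gly; exact/subsetPset/ndG/leq_maxr.
  by move=> [k _ []/= ? ?]; split; exists k.
move=> k; have [mFk Fkoo] := Foo k; have [mGk Gkoo] := Goo k; split.
  by rewrite -[X in measurable X]setTI; apply: mu_uncons => //; exact: measurableX.
rewrite /cons_measure /pushforward -comp_preimage.
rewrite (_ : uncons \o _ = id); last by apply/funext => x /=; exact: consK.
by rewrite preimage_id product_measure1E// lte_mul_pinfty// ge0_fin_numE.
Qed.

HB.instance Definition _ := Measure_isSigmaFinite.Build _ _ _
  cons_measure cons_measure_sigma_finite.

End cons_measure.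

Fixpoint lebesgue_tuple n : {sigma_finite_measure set (n.-tuple T) -> \bar R} :=
  match n with
  | 0 => \d_([tuple] : 0.-tuple T)
  | n'.+1 => cons_measure (lebesgue_tuple n')
  end.

End lebesgue_tuple.

Definition herm_display : measure_display. Proof. by []. Qed.

Section hermitian_measure.
Variables (R : realType) (K : base_algebra) (n : nat).
Local Notation coords := ((herm_dim K n).-tuple (measurableTypeR R)).

HB.instance Definition _ :=
  isPointed.Build (herm R K n) (herm_of_coords [tuple of nseq _ 0]).

(* The sigma-algebra transported along the parametrization herm_of_coords,     *)
(* which is bijective by herm_of_coords_bij.                                   *)
Definition herm_measurable : set (set (herm R K n)) :=
  image_set_system setT (@herm_of_coords R K n) (@measurable _ coords).

Let herm_sigma_algebra : sigma_algebra setT herm_measurable.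
Proof. exact/sigma_algebra_image/sigma_algebra_measurable. Qed.

Let herm_measurable0 : herm_measurable set0.
Proof. by have [] := herm_sigma_algebra. Qed.

Let herm_measurableC A : herm_measurable A -> herm_measurable (~` A).
Proof. by have [_ + _] := herm_sigma_algebra; rewrite -setTD; apply. Qed.

Let herm_measurable_bigcup (F : (set (herm R K n))^nat) :
  (forall i, herm_measurable (F i)) -> herm_measurable (\bigcup_i F i).
Proof. by have [_ _ +] := herm_sigma_algebra; apply. Qed.

HB.instance Definition _ := @isMeasurable.Build herm_display (herm R K n)
  herm_measurable herm_measurable0 herm_measurableC herm_measurable_bigcup.

Lemma measurable_herm_of_coords : measurable_fun setT (@herm_of_coords R K n).
Proof. by move=> _ A mA; exact: mA. Qed.

Definition lebesgue_herm : set (herm R K n) -> \bar R :=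
  pushforward (lebesgue_tuple R (herm_dim K n)) (@herm_of_coords R K n).

Let lebesgue_herm0 : lebesgue_herm set0 = 0%E.
Proof. by rewrite /lebesgue_herm /pushforward preimage_set0 measure0. Qed.

Let lebesgue_herm_ge0 A : (0 <= lebesgue_herm A)%E.
Proof.
have mh := measurable_herm_of_coords.
exact: (measure_ge0 (pushforward (lebesgue_tuple R _) _)).
Qed.

Let lebesgue_herm_sigma_additive : semi_sigma_additive lebesgue_herm.
Proof.
have mh := measurable_herm_of_coords.
exact: (@measure_semi_sigma_additive _ _ _
  (pushforward (lebesgue_tuple R _) _)).
Qed.

HB.instance Definition _ := isMeasure.Build _ _ _ lebesgue_herm
  lebesgue_herm0 lebesgue_herm_ge0 lebesgue_herm_sigma_additive.

End hermitian_measure.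

Arguments lebesgue_herm : clear implicits.

Section eigenvalues.
Variables (R : realType) (K : base_algebra).

Definition is_unitary n (U : 'M[base_ring R K]_n) : Prop :=
  adjoint_mx U *m U = 1%:M /\ U *m adjoint_mx U = 1%:M.

End eigenvalues.

Definition is_spectrum (R : realType) (K : base_algebra) n
    (A : 'M[base_ring R K]_n) (s : n.-tuple R) : Prop :=
  match K return 'M[base_ring R K]_n -> Prop with
  | RealAlg => fun A : 'M[R]_n =>
      char_poly A = \prod_(x <- s) ('X - x%:P)
  | ComplexAlg => fun A : 'M[R[i]]_n =>
      char_poly A = \prod_(x <- s) ('X - ((x%:C)%C)%:P)
  | QuaternionAlg => fun A =>
      exists2 U : 'M[base_ring R QuaternionAlg]_n, is_unitary U &
        adjoint_mx U *m A *m U =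
          diag_mx (\row_i base_real QuaternionAlg (tnth s i))
  end A.

(* The eigenvalues with multiplicity of a Hermitian matrix, in nondecreasing   *)
(* order.                                                                      *)
Definition eigenvalues (R : realType) (K : base_algebra) n
    (A : 'M[base_ring R K]_n) : n.-tuple R :=
  xget [tuple of nseq n 0]
    [set s : n.-tuple R | sorted <=%R s /\ is_spectrum A s].

Definition left_upper_block (R : Type) n (A : 'M[R]_n) (j : 'I_n) : 'M[R]_j.+1 :=
  mxsub (widen_ord (ltn_ord j)) (widen_ord (ltn_ord j)) A.

(* A triangle (lambda_jk), 1 <= k <= j <= n, is stored row by row, so that row *)
(* j, of length j, starts at position 1 + ... + (j - 1) = 'C(j, 2).            *)
Section triangles.
Variables (R : realType) (n : nat).
Local Notation triangle := ('C(n.+1, 2).-tuple (measurableTypeR R)).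
Implicit Types L : triangle.

Definition lam L (j k : nat) : R := nth (0 : R) L ('C(j, 2) + k.-1).

Definition rayleigh_triangles : set triangle :=
  [set L | forall j k : nat, (1 <= k <= j)%N -> (j <= n.-1)%N ->
     lam L j.+1 k <= lam L j k <= lam L j.+1 k.+1].

(* Where two eigenvalues coincide (a Lebesgue-null set) a negative power or a   *)
(* quotient may be undefined; here 0 `^ x = 0 for x != 0 and 0^-1 = 0.          *)
Definition rayleigh_density (theta : R) L : R :=
  (\prod_(2 <= j < n.+1) \prod_(1 <= a < j) \prod_(1 <= p < j.+1)
     `|lam L j.-1 a - lam L j p| `^ (theta - 1)) /
  (\prod_(2 <= j < n) \prod_(1 <= b < j.+1) \prod_(1 <= a < b)
     (lam L j b - lam L j a) `^ (2 * theta - 2)) *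
  \prod_(1 <= q < n.+1) \prod_(1 <= p < q) (lam L n q - lam L n p).

End triangles.

Arguments rayleigh_triangles : clear implicits.

Section rayleigh_map.
Variables (R : realType) (K : base_algebra) (n : nat).

Definition rayleigh_seq (T : herm R K n) : seq R :=
  flatten [seq tval (eigenvalues (left_upper_block T j)) | j <- enum 'I_n].

Lemma size_rayleigh_seq T : size (rayleigh_seq T) == 'C(n.+1, 2).
Proof.
rewrite size_flatten /shape -map_comp sumnE big_map big_enum /=.
under eq_bigr do rewrite size_tuple.
by rewrite -bin2_sum big_nat_recl// add0n big_mkord.
Qed.

Definition rayleigh_map (T : herm R K n) :
    'C(n.+1, 2).-tuple (measurableTypeR R) :=
  Tuple (size_rayleigh_seq T).

Lemma lam_rayleigh_map T (j : 'I_n) (k : 'I_j.+1) :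
  lam (rayleigh_map T) j.+1 k.+1 =
  tnth (eigenvalues (left_upper_block T j)) k.
Proof.
pose ss := [seq tval (eigenvalues (left_upper_block T j)) | j <- enum 'I_n].
have nth_ss : nth [::] ss j = tval (eigenvalues (left_upper_block T j)).
  by rewrite (nth_map j) ?size_enum_ord// nth_ord_enum.
have shapeE : shape ss = iota 1 n.
  rewrite /shape -map_comp (eq_map (g := succn \o val)); last first.
    by move=> i /=; rewrite size_tuple.
  by rewrite map_comp val_enum_ord (iotaDl 1 0).
have posE : ('C(j.+1, 2) + k)%N = flatten_index (shape ss) j k.
  rewrite /flatten_index shapeE take_iota (minn_idPl (ltnW (ltn_ord j))).
  by rewrite sumnE (iotaDl 1 0) big_map -bin2_sum big_nat_recl// add0n
    /index_iota subn0.
have kj : (k < nth 0%N (shape ss) j)%N.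
  by rewrite shapeE nth_iota//; case: k {posE}.
rewrite /lam /= posE nth_flatten flatten_indexKl// flatten_indexKr// nth_ss.
by rewrite (tnth_nth 0).
Qed.

End rayleigh_map.

(* Euler's integral, meaningful for x > 0. *)
Definition Gamma (R : realType) (x : R) : R :=
  \int[@lebesgue_measure R]_(t in `]0, +oo[) (t `^ (x - 1) * expR (- t)).

Definition rayleigh_const (R : realType) (n : nat) (theta : R) : R :=
  pi `^ ((n * n.-1)%:R * theta / 2) / Gamma theta `^ ((n * n.-1)%:R / 2).

(* Main.v *)
Require Import Defs.
From HB Require Import structures.
From mathcomp Require Import all_boot all_order all_algebra.
From mathcomp Require Import perm complex.
From mathcomp Require Import all_classical all_reals all_analysis measurable_realfun.
From mathcomp Require Import ring lra zify.
Import Order.TTheory GRing.Theory Num.Theory.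
Import numFieldNormedType.Exports.
Local Open Scope classical_set_scope.
Local Open Scope ring_scope.

Set Implicit Arguments.
Unset Strict Implicit.
Unset Printing Implicit Defensive.

(* Rows are integrated out one at a time. Fix the upper left n x n block, with
   distinct eigenvalues lam; conjugating by a unitary matrix, which preserves
   Lebesgue measure, makes it diagonal. The eigenvalues of the bordered matrix
   then depend only on the last diagonal entry c and on the r_i = |b_i|^2, whose
   image measure is (pi^theta / Gamma theta)^n prod r_i^(theta - 1) dr; they are
   the zeros mu of the secular function x - c - sum_i r_i / (x - lam_i). The map
   mu |-> (c, r) is a bijection from the sequences interlacing lam onto
   {r > 0}, with Jacobian vand mu / vand lam, and r_i is a quotient of products
   of differences lam_i - mu_p and lam_i - lam_k. Its change of variables
   formula is proved by induction on the length of lam, removing the smallest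
   pole and the smallest zero, so that only one-dimensional substitutions are
   needed. *)

(** * Iterated Lebesgue integrals *)

(** Quaternions do not commute, so the arguments common to the three algebras avoid determinants and
    ranks over K: linear algebra rests on one elimination lemma, eigenvectors come from the
    underlying real operator, and unitary invariance of Lebesgue measure comes from comparison with
    a Gaussian. Eigenvalues have no formula; they are measurable because their power sums are real
    parts of traces of powers. Blocks with a multiple eigenvalue, which escape the reduction to
    strict interlacing, must be shown null, and this follows from the formula for the preceding
    rows, hence inside the induction over rows. Row j + 1 has j off-diagonal entries, each
    contributing pi^theta / Gamma theta, which adds up to the exponent n (n - 1) / 2. The Jacobians
    vand mu / vand lam telescope to the Vandermonde product of the last row. The product of the r_i
    has (vand lam)^2 as denominator; raised to theta - 1 it gives the exponent 2 theta - 2, which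
    occurs only for rows that serve as inner block of a later one. *)

Section measurable_sequences.
Context (R : realType) d (X : measurableType d).
Local Notation T := (measurableTypeR R).
Implicit Types (n : nat) (G : X -> seq R).

(** A measurable map into n-tuples, kept untyped; beyond n the default 0 of [nth] makes the second
    clause trivial. *)
Definition measurable_seq n G :=
  (forall x, size (G x) = n) /\
  (forall i, measurable_fun setT (fun x => nth 0 (G x) i : T)).

Lemma measurable_nth n i : measurable_fun setT (fun t : n.-tuple T => nth 0 t i : T).
Proof.
have [lin|nin] := ltnP i n; last first.
  rewrite (_ : (fun _ => _) = cst 0); first exact: measurable_cst.
  by apply/funext => t; rewrite nth_default// size_tuple.
rewrite (_ : (fun _ => _) = (@tnth _ T)^~ (Ordinal lin)); first exact: measurable_tnth.
by apply/funext => t; rewrite (tnth_nth 0).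
Qed.

Definition tuple_of_seq n (s : seq R) : n.-tuple T := [tuple nth 0 s i | i < n].

Lemma tuple_of_seqE n (s : seq R) : size s = n -> tuple_of_seq n s = s :> seq R.
Proof.
move=> sn; apply: (@eq_from_nth _ 0); first by rewrite size_tuple.
move=> i; rewrite size_tuple => lin.
by rewrite -(tnth_nth 0 (tuple_of_seq n s) (Ordinal lin)) tnth_mktuple.
Qed.

Lemma measurable_tuple_of_seq n G : measurable_seq n G ->
  measurable_fun setT (fun x => tuple_of_seq n (G x)).
Proof.
move=> [_ mG]; apply/measurable_fun_tnthP => i.
rewrite (_ : _ \o _ = (fun x => nth 0 (G x) i))//.
by apply/funext => x /=; rewrite tnth_mktuple.
Qed.

Lemma measurable_comp_seq n G d' (Y : measurableType d') (F : seq R -> Y) :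
  measurable_fun setT (fun t : n.-tuple T => F t) -> measurable_seq n G ->
  measurable_fun setT (fun x => F (G x)).
Proof.
move=> mF mG; rewrite (_ : (fun _ => _) =
    (fun t : n.-tuple T => F t) \o (fun x => tuple_of_seq n (G x))).
  by apply: measurableT_comp => //; exact: measurable_tuple_of_seq.
by apply/funext => x /=; rewrite tuple_of_seqE//; exact: mG.1.
Qed.

Lemma measurable_seq_cons n (f : X -> T) G :
  measurable_fun setT f -> measurable_seq n G ->
  measurable_seq n.+1 (fun x => f x :: G x).
Proof.
move=> mf [sG mG]; split=> [x|[|i]]; [by rewrite /= sG|exact: mf|exact: mG].
Qed.

Lemma measurable_seq_cat m n G G' :
  measurable_seq m G -> measurable_seq n G' ->
  measurable_seq (m + n) (fun x => G x ++ G' x).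
Proof.
move=> [sG mG] [sG' mG']; split=> [x|i]; first by rewrite size_cat sG sG'.
have [im|mi] := ltnP i m.
  by apply: eq_measurable_fun (mG i) => x _; rewrite nth_cat sG im.
by apply: eq_measurable_fun (mG' (i - m)%N) => x _; rewrite nth_cat sG ltnNge mi.
Qed.

Lemma measurable_seq_cst (s : seq R) : measurable_seq (size s) (fun=> s).
Proof. by split. Qed.

Lemma measurable_seq_mkseq n (f : X -> nat -> R) :
  (forall i, measurable_fun setT (fun x => f x i : T)) ->
  measurable_seq n (fun x => mkseq (f x) n).
Proof.
move=> mf; split=> [x|i]; first by rewrite size_mkseq.
have [lin|nin] := ltnP i n.
  by apply: eq_measurable_fun (mf i) => x _; rewrite nth_mkseq.
apply: eq_measurable_fun (@measurable_cst _ _ _ _ _ (0 : T)) => x _.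
by rewrite nth_default// size_mkseq.
Qed.

End measurable_sequences.

Section measurable_sequences2.
Context (R : realType) d (X : measurableType d) d' (Y : measurableType d').
Local Notation T := (measurableTypeR R).

Lemma measurable_seq_tval n (f : X -> n.-tuple T) : measurable_fun setT f ->
  measurable_seq n (fun x => f x : seq R).
Proof.
move=> mf; split=> [x|i]; first by rewrite size_tuple.
exact: (measurableT_comp (measurable_nth (R := R) (n := n) i) mf).
Qed.

Lemma measurable_seq_comp n (G : Y -> seq R) (f : X -> Y) :
  measurable_fun setT f -> measurable_seq n G ->
  measurable_seq n (fun x => G (f x)).
Proof. by move=> mf [sG mG]; split=> // i; exact: (measurableT_comp (mG i) mf). Qed.

End measurable_sequences2.

Section tuple_integral.
Context (R : realType).
Local Notation T := (measurableTypeR R).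
Local Notation leb := (@lebesgue_measure R).
Implicit Types (n : nat) (F : seq R -> \bar R).
Local Open Scope ereal_scope.

(* Working with functions of the underlying sequences avoids all casts between *)
(* tuples of provably equal lengths.                                            *)
Definition tint n F : \bar R := \int[lebesgue_tuple R n]_t F (tval t).

Definition tmeasurable n F := measurable_fun setT (fun t : n.-tuple T => F t).

Lemma eq_tint n F F' : (forall s, size s = n -> F s = F' s) -> tint n F = tint n F'.
Proof. by move=> FF'; apply: eq_integral => t _; rewrite FF'// size_tuple. Qed.

Lemma tint_ge0 n F : (forall s, 0 <= F s) -> 0 <= tint n F.
Proof. by move=> F0; exact: integral_ge0. Qed.

Lemma tintZ n F (k : \bar R) : tmeasurable n F -> (forall s, 0 <= F s) -> 0 <= k ->
  tint n (fun s => k * F s) = k * tint n F.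
Proof. by move=> mF F0 k0; apply: ge0_integralZl. Qed.

Lemma measurable_tint n d (X : measurableType d) (F : X -> seq R -> \bar R) :
  (forall x s, 0 <= F x s) ->
  measurable_fun setT (fun p : X * n.-tuple T => F p.1 p.2) ->
  measurable_fun setT (fun x => tint n (F x)).
Proof.
move=> F0 mF.
exact: (@measurable_fun_fubini_tonelli_F _ _ _ _ _ (lebesgue_tuple R n)
  (fun p : X * n.-tuple T => F p.1 p.2)).
Qed.

Lemma tint_exchange n d (X : measurableType d)
    (mu : {sigma_finite_measure set X -> \bar R}) (F : X -> seq R -> \bar R) :
  (forall x s, 0 <= F x s) ->
  measurable_fun setT (fun p : X * n.-tuple T => F p.1 p.2) ->
  \int[mu]_x tint n (F x) = tint n (fun s => \int[mu]_x F x s).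
Proof.
move=> F0 mF; exact: (@fubini_tonelli _ _ _ _ _ mu (lebesgue_tuple R n)
  (fun p : X * n.-tuple T => F p.1 p.2)).
Qed.

Lemma tint_tint_exchange m n (F : seq R -> seq R -> \bar R) :
  (forall s t, 0 <= F s t) ->
  measurable_fun setT (fun p : m.-tuple T * n.-tuple T => F p.1 p.2) ->
  tint m (fun s => tint n (F s)) = tint n (fun t => tint m (F ^~ t)).
Proof.
move=> F0 mF.
exact: (@tint_exchange _ _ _ (lebesgue_tuple R m) (fun s : m.-tuple T => F s)).
Qed.

Lemma tint0 F : tint 0 F = F [::].
Proof.
rewrite /tint (eq_integral (cst (F [::]))); last by move=> t _; rewrite tuple0.
by rewrite integral_cst//= diracT mule1.
Qed.

Lemma tmeasurableS n F : tmeasurable n.+1 F ->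
  measurable_fun setT (fun p : T * n.-tuple T => F (p.1 :: p.2)).
Proof.
move=> mF; apply: measurable_comp_seq mF _.
by apply: measurable_seq_cons => //; exact: measurable_seq_tval.
Qed.

Lemma tintS n F : tmeasurable n.+1 F -> (forall s, 0 <= F s) ->
  tint n.+1 F = \int[leb]_x tint n (fun s => F (x :: s)).
Proof.
move=> mF F0; rewrite /tint /=.
have mt := @measurable_tuple_cons R n.
rewrite (ge0_integral_pushforward mt)//; rewrite preimage_setT.
exact: (@fubini_tonelli1 _ _ _ _ _ leb (lebesgue_tuple R n)
  (fun p : T * n.-tuple T => F (p.1 :: p.2)) (tmeasurableS mF)).
Qed.

Lemma tmeasurable_section n d (X : measurableType d) (F : X -> seq R -> \bar R) x :
  measurable_fun setT (fun p : X * n.-tuple T => F p.1 p.2) -> tmeasurable n (F x).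
Proof. by move=> mF; exact: (measurableT_comp mF (pair1_measurable x)). Qed.

Lemma tmeasurable_cat m n F : tmeasurable (m + n) F ->
  measurable_fun setT (fun p : m.-tuple T * n.-tuple T => F (p.1 ++ p.2)).
Proof.
by move=> mF; apply: measurable_comp_seq mF _; apply: measurable_seq_cat;
  exact: measurable_seq_tval.
Qed.

Lemma tint_cat m n F : tmeasurable (m + n) F -> (forall s, 0 <= F s) ->
  tint (m + n) F = tint m (fun s => tint n (fun t => F (s ++ t))).
Proof.
elim: m F => [|m IH] F mF F0; first by rewrite tint0.
rewrite [LHS](tintS mF)// [RHS]tintS//; first last.
- by move=> s; exact: tint_ge0.
- rewrite /tmeasurable.
  apply: (@measurable_tint _ _ _ (fun (s : m.+1.-tuple T) t => F (s ++ t)))%SEQ => //.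
  exact: tmeasurable_cat.
apply: eq_integral => x _; rewrite IH//.
by apply: (tmeasurable_section (F := fun x s => F (x :: s))); exact: tmeasurableS.
Qed.

End tuple_integral.

(** * Substitution in one variable *)

Section one_dimensional.
Context (R : realType).
Local Notation T := (measurableTypeR R).
Local Notation leb := (@lebesgue_measure R).

Lemma measurable_inv d (X : measurableType d) (f : X -> T) :
  measurable_fun setT f -> measurable_fun setT (fun x => (f x)^-1 : T).
Proof.
(* Inversion is reduced to [powR] at the nonnegative number f^2; where f = 0 both sides are 0, since
   0^-1 = 0. *)
move=> mf; apply: (eq_measurable_fun (fun x => f x * (f x ^+ 2) `^ (-1) : T)).
  move=> x _; have [->|fx0] := eqVneq (f x) 0; first by rewrite mul0r invr0.
  by rewrite powR_inv1 ?sqr_ge0// expr2 invfM mulrA divff// mul1r.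
apply: measurable_funM => //.
by apply: (measurableT_comp (measurable_powR (-1))); exact: measurable_funX.
Qed.

Local Open Scope ereal_scope.

(** The pushforward of Lebesgue measure under x |-> k x + a, scaled by |k|, has the right value on
    half-open intervals, hence is Lebesgue measure. *)
Lemma integral_affine (k a : R) (f : T -> \bar R) : k != 0%R ->
  measurable_fun setT f -> (forall x, 0 <= f x) ->
  \int[leb]_x f x = `|k|%R%:E * \int[leb]_x f (k * x + a)%R.
Proof.
move=> k0 mf f0.
have mphi : measurable_fun setT (fun x : T => (k * x + a)%R : T).
  by apply: measurable_funD => //; exact: measurable_funM.
have k0' : (0 <= `|k|)%R by [].
rewrite -[X in _ * X](ge0_integral_pushforward mphi _ _ (D := setT))//.
rewrite -(ge0_integral_mscale _ measurableT (NngNum k0'))//.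
apply: eq_measure_integral => A mA _.
apply: lebesgue_measure_unique => // _ [[c d]] _ <-.
change (leb `]c, d]%classic =
  `|k|%R%:E * leb ((fun x : T => (k * x + a)%R : T) @^-1` `]c, d]%classic)).
have [kp|kn|kE] := ltgtP 0%R k; last by rewrite kE eqxx in k0.
- rewrite (_ : _ @^-1` _ = `](c - a) / k, (d - a) / k]%classic)%R; last first.
    apply/seteqP; split=> x /=; rewrite !in_itv/= ltr_pdivrMr// ler_pdivlMr//;
      by rewrite ltrBlDr lerBrDr ![(x * k)%R]mulrC.
  rewrite !lebesgue_measure_itv/= !lte_fin ltr_pM2r ?invr_gt0// ltrD2r gtr0_norm//.
  case: ifP => cd; last by rewrite mule0.
  by rewrite -!EFinD -EFinM; congr EFin; field; rewrite gt_eqF.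
- rewrite (_ : _ @^-1` _ = `[(d - a) / k, (c - a) / k[%classic)%R; last first.
    apply/seteqP; split=> x /=; rewrite !in_itv/= ltr_ndivlMr// ler_ndivrMr//;
      by rewrite ltrBlDr lerBrDr ![(x * k)%R]mulrC andbC.
  rewrite !lebesgue_measure_itv/= !lte_fin ltr_nM2r ?invr_lt0// ltrD2r ltr0_norm//.
  case: ifP => cd; last by rewrite mule0.
  by rewrite -!EFinD -EFinM; congr EFin; field; rewrite lt_eqF.
Qed.

(** Nothing is known of [m] near 0 or on the negative side, where it may be infinite. Uniqueness is
    therefore applied to the restrictions to ]1/(n+1), n+1], where both measures are finite, and
    continuity from below concludes. *)
Lemma eq_measure_gt0 (m : {measure set T -> \bar R}) :
  (forall a b : R, (0 < a)%R -> (a < b)%R -> m `]a, b]%classic = (b - a)%:E) ->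
  forall A : set T, measurable A -> A `<=` [set x | (0 < x)%R] -> m A = leb A.
Proof.
move=> mE A mA A0.
pose F n : set T := `](n.+1%:R^-1)%R, n.+1%:R%R]%classic.
have mF n : measurable (F n) by exact: measurable_itv.
have F0 n : (0 < n.+1%:R^-1 :> R)%R by rewrite invr_gt0.
have AF : A = \bigcup_n (A `&` F n).
  rewrite -setI_bigcupr; apply/esym/setIidPl => x /A0 /=.
  move=> x0.
  pose n := (Num.truncn x + Num.truncn x^-1)%N.
  have xn : (x <= n.+1%:R)%R.
    apply/ltW/(lt_le_trans (truncnS_gt x)).
    by rewrite ler_nat ltnS leq_addr.
  have nx : (x^-1 < n.+1%:R)%R.
    apply/(lt_le_trans (truncnS_gt x^-1)).
    by rewrite ler_nat ltnS leq_addl.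
  by exists n => //; rewrite /F/= in_itv/= xn andbT invf_plt ?posrE.
have ndF : nondecreasing_seq (fun n => A `&` F n).
  move=> i j ij; apply/subsetPset; apply: setIS; apply: subset_itv.
    by rewrite bnd_simp lef_pV2 ?posrE// ler_nat ltnS.
  by rewrite bnd_simp ler_nat ltnS.
have mAF n : measurable (A `&` F n) by exact: measurableI.
have mU : measurable (\bigcup_n (A `&` F n)) by exact: bigcup_measurable.
have cm := nondecreasing_cvg_mu (mu := m) mAF mU ndF.
have cl := nondecreasing_cvg_mu (mu := leb) mAF mU ndF.
rewrite AF -(cvg_lim _ cm)// -(cvg_lim _ cl)//; congr (limn _).
apply/funext => n /=.
apply: (@measure_unique _ R T (@ocitv R) (fun k => `](- k%:R)%R, k%:R%R]%classic)
  _ _ _ _ (mrestr m (mF n)) (mrestr leb (mF n))) => //.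
- exact: ocitvI.
- by move=> k; exact: is_ocitv.
- rewrite -subTset => x _ /=.
  exists (Num.truncn `|x|%R).+1 => //=; rewrite in_itv/=.
  have := truncnS_gt `|x|%R; rewrite ltr_norml => /andP[-> /ltW ->].
  by [].
- move=> _ [[c d]] _ <-.
  change (m (`]c, d]%classic `&` F n) = leb (`]c, d]%classic `&` F n)); rewrite /F.
  set a := (n.+1%:R^-1)%R; set b := (n.+1%:R)%R.
  rewrite (_ : _ `&` _ = `]Num.max c a, Num.min d b]%classic); last first.
    apply/seteqP; split=> x /=; rewrite !in_itv/= gt_max le_min.
      by move=> [/andP[-> ->] /andP[-> ->]].
    by move=> /andP[/andP[-> ->] /andP[-> ->]].
  have [lt|ge] := ltP (Num.max c a) (Num.min d b).
    by rewrite mE// ?lt_max ?F0 ?orbT// lebesgue_measure_itv/= lte_fin lt.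
  by rewrite set_itv_ge ?measure0// bnd_simp -leNgt.
- move=> k; change (m (`](- k%:R)%R, k%:R%R]%classic `&` F n) < +oo).
  rewrite (@le_lt_trans _ _ (m (F n)))//; last first.
    have [lt|ge] := ltP n.+1%:R^-1%R (n.+1%:R : R); first by rewrite mE// ltry.
    by rewrite /F set_itv_ge ?measure0// bnd_simp -leNgt.
  by apply: le_measure; rewrite ?inE//; exact: measurableI.
Qed.

Lemma integral_pos_support d (X : measurableType d) (mu : {measure set X -> \bar R})
    (D : set X) (g : X -> \bar R) : (forall r, ~ D r -> g r = 0) ->
  \int[mu]_(r in D) g r = \int[mu]_r g r.
Proof.
move=> g0; rewrite integral_mkcond; apply: eq_integral => r _.
by rewrite patchE; case: ifPn => // /negP; rewrite inE => /g0.
Qed.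

(** The image of [mu] may put any mass on r <= 0, hence the condition that [g] vanishes there. *)
Lemma integral_gt0_transfer d (X : measurableType d)
    (mu : {measure set X -> \bar R}) (phi : X -> T) :
  measurable_fun setT phi ->
  (forall a b : R, (0 < a)%R -> (a < b)%R ->
     mu (phi @^-1` `]a, b]%classic) = (b - a)%:E) ->
  forall g : T -> \bar R, measurable_fun setT g -> (forall r, 0 <= g r) ->
    (forall r, (r <= 0)%R -> g r = 0) ->
    \int[mu]_x g (phi x) = \int[leb]_r g r.
Proof.
move=> mphi muE g mg g0 gneg.
have mD : measurable [set r : T | (0 < r)%R].
  rewrite (_ : [set _ | _] = `]0%R, +oo[%classic) ?measurable_itv//.
  by apply/seteqP; split=> x /=; rewrite in_itv/= andbT.
have gD r : ~ [set r : T | (0 < r)%R] r -> g r = 0.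
  by move=> /= /negP; rewrite -leNgt => /gneg.
rewrite -[LHS](@integral_pos_support _ _ _ (phi @^-1` [set r : T | (0 < r)%R])); last first.
  by move=> x; exact: gD.
rewrite -[RHS](integral_pos_support _ gD).
rewrite -(ge0_integral_pushforward mphi mu)//; last exact: measurable_funTS.
apply: eq_measure_integral => A mA AD.
by apply: eq_measure_gt0 => // a b a0 ab; exact: muE.
Qed.

(* The density w is realised by the Lebesgue measure of its subgraph, so that  *)
(* both sides become integrals against measures on the half-line that agree    *)
(* on intervals.                                                                *)
Lemma integral_subst_gt0 (D : T -> bool) (psi w : T -> T) :
  measurable_fun setT D -> measurable_fun setT psi -> measurable_fun setT w ->
  (forall x, D x -> (0 <= w x)%R) ->
  (forall a b : R, (0 < a)%R -> (a < b)%R ->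
     \int[leb]_x (if D x && (psi x \in `]a, b]) then (w x)%:E else 0) = (b - a)%:E) ->
  forall g : T -> \bar R, measurable_fun setT g -> (forall r, 0 <= g r) ->
  (forall x, D x -> (0 < psi x)%R) ->
  \int[leb]_x (if D x then g (psi x) * (w x)%:E else 0) =
  \int[leb]_r (if (0 < r)%R then g r else 0).
Proof.
move=> mD mpsi mw w0 psiE g mg g0 psi0.
(* Off the subgraph the value -1 is a dummy: it lies on the half-line where the transferred
   integrand vanishes. *)
pose phi (p : T * T) : T := if [&& D p.1, (0 < p.2)%R & (p.2 <= w p.1)%R]
  then psi p.1 else (-1 : R)%R.
have mb : measurable_fun setT
    (fun p : T * T => [&& D p.1, (0 < p.2)%R & (p.2 <= w p.1)%R]).
  apply: measurable_and; first exact: (measurableT_comp mD).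
  apply: measurable_and; first exact: measurable_fun_ltr.
  by apply: measurable_fun_ler => //; exact: (measurableT_comp mw).
have mphi : measurable_fun setT phi.
  apply: measurable_fun_ifT => //; first exact: (measurableT_comp mpsi).
have layer (c : \bar R) x : 0 <= c -> D x ->
    \int[leb]_y (if (0 < y)%R && (y <= w x)%R then c else 0) = c * (w x)%:E.
  move=> c0 Dx.
  transitivity (\int[leb]_(y in `]0%R, w x]%classic) cst c y).
    rewrite [RHS]integral_mkcond; apply: eq_integral => y _.
    by rewrite patchE mem_setE in_itv.
  rewrite integral_cst//= lebesgue_measure_itv/= lte_fin.
  case: ltP => w0'; first by rewrite sube0.
  by have -> : w x = 0%R by apply/le_anti; rewrite w0' w0.
have mg' : measurable_fun setT (fun r : T => if (0 < r)%R then g r else 0).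
  by apply: measurable_fun_ifT => //; exact: measurable_fun_ltr.
have gpos r : 0 <= (if (0 < r)%R then g r else 0) by case: ifP.
rewrite -[RHS](@integral_gt0_transfer _ _ (leb \x leb) phi)//; first last.
- by move=> r /=; rewrite leNgt => /negbTE ->.
- move=> a b a0 ab.
  have mI : measurable (phi @^-1` `]a, b]%classic).
    by rewrite -[X in measurable X]setTI; exact: mphi.
  rewrite -(psiE _ _ a0 ab) -[LHS]mul1e -[LHS](integral_cst _ mI).
  rewrite integral_mkcond.
  rewrite (@fubini_tonelli1 _ _ _ _ _ leb leb)//; first last.
  - by move=> p; rewrite patchE; case: ifP.
  - by apply/(measurable_restrictT _ mI).
  apply: eq_integral => x _; rewrite /fubini_F.
  rewrite (eq_integral (fun y : T => if (0 < y)%R && (y <= w x)%R then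
     (if D x && (psi x \in `]a, b]) then 1 else 0) else 0)); last first.
    move=> y _; rewrite patchE.
    rewrite (_ : (_ \in _ @^-1` _) = (phi (x, y) \in `]a, b])); last first.
      by apply/idP/idP; rewrite inE.
    have N1 : (a < (-1 : R))%R = false.
      by apply/negbTE; rewrite -leNgt (le_trans _ (ltW a0))// oppr_le0.
    rewrite /phi /= !in_itv/=; case: (D x) => /=.
      case: ((0 < y)%R); case: ((y <= w x)%R) => /=; rewrite ?N1 //.
    by rewrite N1; case: ifP.
  case: ifPn => [/andP[Dx _]|_]; first by rewrite layer// mul1e.
  by rewrite integral0_eq// => y _; case: ifP.
- rewrite (@fubini_tonelli1 _ _ _ _ _ leb leb (fun p => if (0 < phi p)%R then g (phi p) else 0))//; last first.
    exact: (measurableT_comp mg').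
  apply: eq_integral => x _; rewrite /fubini_F /phi /=.
  case: ifPn => Dx.
    rewrite -layer//; apply: eq_integral => y _ /=.
    by case: ifP => /= yw; rewrite ?psi0// oppr_gt0 ltNge ler01.
  by rewrite integral0_eq// => y _ /=; rewrite oppr_gt0 ltNge ler01.
Qed.

End one_dimensional.

Section monotone_substitution.
Context (R : realType).
Local Notation T := (measurableTypeR R).
Local Notation leb := (@lebesgue_measure R).

Lemma integral_derive (F w : R -> R) (u v : R) : u < v ->
  (forall x, u <= x <= v -> is_derive x 1 F (w x)) ->
  (forall x, u <= x <= v -> {for x, continuous w}) ->
  (\int[leb]_(x in `[u, v]) (w x)%:E = (F v - F u)%:E)%E.
Proof.
move=> uv dF cw; have le := ltW uv.
have cF x : u <= x <= v -> {for x, continuous F}.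
  move=> xuv; apply: differentiable_continuous; apply/derivable1_diffP.
  by have := dF x xuv => ?; exact: ex_derive.
rewrite (@continuous_FTC2 _ w F)//.
- by apply: continuous_in_subspaceT => x; rewrite inE/= in_itv/=; exact: cw.
- split.
  + move=> x; rewrite in_itv/= => /andP[ux xv].
    have ? : is_derive x 1 F (w x) by apply: dF; rewrite !ltW.
    exact: ex_derive.
  + by apply: cvg_at_right_filter; apply: cF; rewrite lexx.
  + by apply: cvg_at_left_filter; apply: cF; rewrite lexx le.
- move=> x; rewrite in_itv/= derive1E => /andP[ux xv].
  have ? : is_derive x 1 F (w x) by apply: dF; rewrite !ltW.
  exact: derive_val.
Qed.

(** By [integral_subst_gt0] only the mass of the preimage of ]a, b] matters. Monotonicity makes it
    an interval between the preimages of a and b, and the fundamental theorem of calculus gives b -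
    a. The flag [e] marks a decreasing [psi], so that [w] is the absolute value of the
    derivative. *)
Lemma integral_subst_mono (D : T -> bool) (psi w : R -> R) (e : bool) :
  measurable_fun setT D ->
  measurable_fun setT (psi : T -> T) -> measurable_fun setT (w : T -> T) ->
  (forall x y z, D x -> D y -> x <= z <= y -> D z) ->
  (forall x, D x -> is_derive x 1 psi ((-1) ^+ e * w x)) ->
  (forall x, D x -> {for x, continuous w}) ->
  (forall x, D x -> 0 <= w x) ->
  (forall x y, D x -> D y -> x < y -> if e then psi y < psi x else psi x < psi y) ->
  (forall x, D x -> 0 < psi x) ->
  (forall a, 0 < a -> exists2 x, D x & psi x = a) ->
  forall g : T -> \bar R, measurable_fun setT g -> (forall r, 0 <= g r)%E ->
  (\int[leb]_x (if D x then g (psi x) * (w x)%:E else 0) =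
   \int[leb]_r (if (0 < r)%R then g r else 0))%E.
Proof.
move=> mD mpsi mw Dconv dpsi cw w0 mono psi0 surj g mg g0.
apply: integral_subst_gt0 => // a b a0 ab.
have [xa Dxa psia] := surj a a0.
have [xb Dxb psib] := surj b (lt_trans a0 ab).
pose u := if e then xb else xa; pose v := if e then xa else xb.
have mono' x y : D x -> D y -> (x < y) = if e then psi y < psi x else psi x < psi y.
  move=> Dx Dy; apply/idP/idP; first exact: mono.
  have [//|yx|->] := ltgtP x y; last by rewrite if_same ltxx.
  by have := mono _ _ Dy Dx yx; case: (e) => /lt_trans h /h; rewrite ltxx.
have uv : u < v.
  by rewrite /u /v; move: mono'; case: (e) => mono'; rewrite mono'// psia psib.
have Du : D u by rewrite /u; case: ifP.
have Dv : D v by rewrite /v; case: ifP.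
have DI x : u <= x <= v -> D x by exact: Dconv.
have inE' x : (D x && (psi x \in `]a, b]) =
    (if e then x \in `[u, v[ else x \in `]u, v])).
  rewrite !in_itv/=; case Dx : (D x) => /=; last first.
    apply/esym/negbTE; case: (e); apply/negP => /andP[h1 h2].
      by move: Dx; rewrite DI// h1 ltW.
    by move: Dx; rewrite DI// h2 ltW.
  have -> : (a < psi x) = if e then x < xa else xa < x.
    by rewrite -psia; move: mono'; case: (e) => m; [rewrite (m x xa)|rewrite (m xa x)].
  have -> : (psi x <= b) = if e then xb <= x else x <= xb.
    rewrite -psib; move: mono'; case: (e) => m; rewrite !leNgt.
      by rewrite (m x xb).
    by rewrite (m xb x).
  by rewrite /u /v; case: (e); rewrite // andbC.
(* The preimage is [u, v[ when [psi] decreases and ]u, v] when it increases; [BSide e] covers both,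
   and endpoints do not affect the integral. *)
transitivity (\int[leb]_(x in [set` Interval (BSide e u) (BSide e v)]) (w x)%:E)%E.
  rewrite [RHS]integral_mkcond; apply: eq_integral => x _.
  by rewrite patchE mem_setE inE'; case: (e).
have mwI : measurable_fun `]u, v[ (EFin \o (w : T -> T)).
  by apply/measurable_EFinP; exact: measurable_funTS.
rewrite integral_itv_bndoo// -(@integral_itv_bndoo _ _ _ _ true false)//.
have dF x : u <= x <= v -> is_derive x 1 (fun x => (-1) ^+ e * psi x) (w x).
  move=> /DI Dx.
  have -> : w x = (-1) ^+ e *: ((-1) ^+ e * w x).
    by rewrite /GRing.scale /= mulrA -expr2 sqrr_sign mul1r.
  by have := dpsi _ Dx => dx; apply: is_deriveZ.
rewrite (integral_derive uv dF); last by move=> x /DI; exact: cw.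
rewrite /u /v; case: (e); rewrite psia psib ?expr1 ?expr0 ?mul1r//.
by rewrite !mulN1r opprK addrC.
Qed.

End monotone_substitution.

(** * Invariance under isometries *)

Section affine_maps.
Context (R : realType).
Local Notation T := (measurableTypeR R).
Local Notation leb := (@lebesgue_measure R).
Local Open Scope ereal_scope.

Definition affine_seq (k a : nat -> R) n (s : seq R) : seq R :=
  mkseq (fun i => k i * nth 0 s i + a i)%R n.

Lemma mkseq_cons A (f : nat -> A) n : mkseq f n.+1 = f 0%N :: mkseq (f \o S) n.
Proof. by rewrite /mkseq /= -[1%N]addn0 iotaDl -map_comp. Qed.

Lemma affine_seq_cons k a n x s :
  affine_seq k a n.+1 (x :: s) = (k 0%N * x + a 0%N)%R :: affine_seq (k \o S) (a \o S) n s.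
Proof. by rewrite /affine_seq mkseq_cons. Qed.

Lemma measurable_affine_seq d (X : measurableType d) n m (k a : X -> nat -> R) G :
  (forall i, measurable_fun setT (fun x => k x i : T)) ->
  (forall i, measurable_fun setT (fun x => a x i : T)) ->
  measurable_seq m G -> measurable_seq n (fun x => affine_seq (k x) (a x) n (G x)).
Proof.
move=> mk ma [_ mG]; apply: measurable_seq_mkseq => i.
exact: (measurable_funD (measurable_funM (mk i) (mG i)) (ma i)).
Qed.

Lemma tmeasurable_affine k a n (F : seq R -> \bar R) : tmeasurable n F ->
  tmeasurable n (fun s => F (affine_seq k a n s)).
Proof.
move=> mF; apply: measurable_comp_seq mF _.
by apply: measurable_affine_seq => [i|i|]; [| |exact: measurable_seq_tval].
Qed.

Lemma measurable_tint_cons n (F : seq R -> \bar R) : tmeasurable n.+1 F ->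
  (forall s, 0 <= F s) ->
  measurable_fun setT (fun x : T => tint n (fun s => F (x :: s))).
Proof.
by move=> mF F0; apply: measurable_tint => //; exact: tmeasurableS.
Qed.

Lemma tint_affine k a n (F : seq R -> \bar R) :
  (forall i, (i < n)%N -> k i != 0%R) -> tmeasurable n F -> (forall s, 0 <= F s) ->
  tint n F = (\prod_(i < n) `|k i|)%R%:E * tint n (fun s => F (affine_seq k a n s)).
Proof.
elim: n k a F => [|n IH] k a F k0 mF F0; first by rewrite !tint0 big_ord0 mul1e.
rewrite (tintS mF F0) (tintS (tmeasurable_affine _ _ mF))// .
rewrite (integral_affine (a 0%N) (k0 0%N isT))//; first last.
- by move=> x; exact: tint_ge0.
- exact: (measurable_tint_cons mF F0).
rewrite big_ord_recl EFinM -muleA; congr (_ * _).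
rewrite -ge0_integralZl//; last 3 first.
- exact: (measurable_tint_cons (tmeasurable_affine k a mF)).
- by move=> x _; exact: tint_ge0.
- by rewrite lee_fin prodr_ge0.
apply: eq_integral => x _.
rewrite (IH (k \o S) (a \o S))//; first last.
- apply: (tmeasurable_section (F := fun x s => F (x :: s))); exact: tmeasurableS.
- by move=> i lin; exact: k0.
by congr (_ * _); apply: eq_tint => s _; rewrite affine_seq_cons.
Qed.

Lemma tint_translate a n (F : seq R -> \bar R) :
  tmeasurable n F -> (forall s, 0 <= F s) ->
  tint n F = tint n (fun s => F (mkseq (fun i => nth 0 s i + a i)%R n)).
Proof.
move=> mF F0; rewrite (@tint_affine (fun=> 1%R) a)//.
rewrite big1 ?mul1e; last by move=> *; rewrite normr1.
by apply: eq_tint => s _; congr F; apply: eq_mkseq => i; rewrite mul1r.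
Qed.

Lemma tint_reflect a n (F : seq R -> \bar R) :
  tmeasurable n F -> (forall s, 0 <= F s) ->
  tint n F = tint n (fun s => F (mkseq (fun i => a i - nth 0 s i)%R n)).
Proof.
move=> mF F0; rewrite (@tint_affine (fun=> -1)%R a)//.
rewrite big1 ?mul1e; last by move=> *; rewrite normrN normr1.
by apply: eq_tint => s _; congr F; apply: eq_mkseq => i; rewrite mulN1r addrC.
Qed.

Lemma measurable_all n (b : R -> bool) :
  measurable_fun setT (b : T -> bool) ->
  measurable_fun setT (fun t : n.-tuple T => all b t).
Proof.
move=> mb; elim: n => [|n IH].
  apply: (eq_measurable_fun (cst true)); last exact: measurable_cst.
  by move=> t _; rewrite tuple0.
apply: (eq_measurable_fun (fun t : n.+1.-tuple T =>
  b (thead t) && all b [tuple of behead t])).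
  by move=> t _; case/tupleP: t => x t; rewrite theadE.
apply: measurable_and; first exact: (measurableT_comp mb (measurable_tnth ord0)).
exact: (measurableT_comp IH (@measurable_behead _ _ _)).
Qed.

Definition sumsq (s : seq R) : R := (\sum_(x <- s) x ^+ 2)%R.

Lemma sumsq_ge0 s : (0 <= sumsq s)%R.
Proof. by rewrite /sumsq sumr_ge0// => x _; exact: sqr_ge0. Qed.

Lemma sumsq_cons x s : sumsq (x :: s) = (x ^+ 2 + sumsq s)%R.
Proof. by rewrite /sumsq big_cons. Qed.

Lemma measurable_sumsq d (X : measurableType d) n (G : X -> seq R) :
  measurable_seq n G -> measurable_fun setT (fun x => sumsq (G x) : T).
Proof.
move=> [sG mG].
apply: (eq_measurable_fun (fun x => \sum_(0 <= i < n) (nth 0 (G x) i) ^+ 2 : T)%R).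
  by move=> x _; rewrite [RHS](big_nth 0%R) sG.
by apply: measurable_sum => i; apply: measurable_funX; exact: mG.
Qed.

Lemma tmeasurable_EFin_expR_sumsq n :
  tmeasurable n (fun s => (expR (- sumsq s))%:E).
Proof.
apply/measurable_EFinP; apply: measurableT_comp => //.
by apply: measurableT_comp => //; apply: measurable_sumsq; exact: measurable_seq_tval.
Qed.

Lemma tint_gauss n :
  tint n (fun s => (expR (- sumsq s))%:E) = ((Num.sqrt pi : R) ^+ n)%R%:E.
Proof.
elim: n => [|n IH]; first by rewrite tint0 /sumsq big_nil oppr0 expR0.
rewrite (tintS (@tmeasurable_EFin_expR_sumsq n.+1)); last by move=> s; rewrite lee_fin expR_ge0.
rewrite exprSr EFinM -integralT_gauss -ge0_integralZl//; first last.
- by move=> x _; rewrite lee_fin gauss_fun_ge0.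
- apply/measurable_EFinP; exact: measurable_gauss_fun.
apply: eq_integral => x _; rewrite muleC -IH -tintZ; first last.
- by rewrite lee_fin gauss_fun_ge0.
- by move=> s; rewrite lee_fin expR_ge0.
- exact: tmeasurable_EFin_expR_sumsq.
apply: eq_tint => s _; rewrite sumsq_cons opprD expRD /gauss_fun.
by rewrite EFinM.
Qed.

(* Both sides are translation invariant functionals of F, and they agree on    *)
(* the Gaussian.                                                                *)
Lemma tint_isometry n (L M : seq R -> seq R) (F : seq R -> \bar R) :
  measurable_seq n (fun t : n.-tuple T => L t) ->
  (forall s, size s = n -> size (M s) = n) ->
  (forall s t, size s = n -> size t = n ->
     L (mkseq (fun i => nth 0 s i + nth 0 (M t) i)%R n) =
     mkseq (fun i => nth 0 (L s) i - nth 0 t i)%R n) ->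
  (forall s, size s = n -> sumsq (L s) = sumsq s) ->
  tmeasurable n F -> (forall s, 0 <= F s) ->
  tint n (fun s => F (L s)) = tint n F.
Proof.
move=> mL sM LM sqL mF F0.
have sL s : size s = n -> size (L s) = n.
  by move=> sn; have := mL.1 (tuple_of_seq n s); rewrite tuple_of_seqE.
pose g s : \bar R := (expR (- sumsq s))%:E.
have g0 s : 0 <= g s by rewrite lee_fin expR_ge0.
have mg : tmeasurable n g by exact: tmeasurable_EFin_expR_sumsq.
have Ig : tint n g = ((Num.sqrt pi : R) ^+ n)%R%:E by exact: tint_gauss.
have mFL : tmeasurable n (fun s => F (L s)) by exact: measurable_comp_seq mF mL.
(* The Gaussian integral is finite and positive, so it can be cancelled even when the integral of
   [F] is infinite. *)
suff : tint n g * tint n (fun s => F (L s)) = tint n g * tint n F.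
  have pi0 : (0 < (Num.sqrt pi : R) ^+ n)%R by rewrite exprn_gt0// sqrtr_gt0 pi_gt0.
  rewrite Ig => /(congr1 (fun x => ((Num.sqrt pi : R) ^+ n)^-1%R%:E * x)).
  by rewrite !muleA -EFinM mulVf ?gt_eqF// !mul1e.
have mL1 (S : measurableType _) (f : S -> n.-tuple T) : measurable_fun setT f ->
    measurable_seq n (fun x => L (f x)) by move=> mf; exact: measurable_seq_comp mf mL.
have mLp : measurable_seq n (fun p : n.-tuple T * n.-tuple T => L p.1) by exact: mL1.
have mpm : measurable_seq n (fun p : n.-tuple T * n.-tuple T =>
    mkseq (fun i => nth 0 p.2 i + nth 0 (L p.1) i)%R n).
  apply: measurable_seq_mkseq => i; apply: measurable_funD; last exact: mLp.2.
  by apply: (measurableT_comp (measurable_nth (R := R) (n := n) i)).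
have mpm' : measurable_seq n (fun p : n.-tuple T * n.-tuple T =>
    mkseq (fun i => nth 0 (L p.1) i - nth 0 p.2 i)%R n).
  apply: measurable_seq_mkseq => i; apply: measurable_funB; first exact: mLp.2.
  by apply: (measurableT_comp (measurable_nth (R := R) (n := n) i)).
(* The Gaussian is translated by [L x]. Then x is translated by [M y]; since L (x + M y) = L x - y,
   the shift moves from the Gaussian to the argument of [F]. Finally the reflection y |-> L x - y
   separates the two factors. *)
transitivity (tint n (fun y => tint n (fun x =>
   F (L x) * g (mkseq (fun i => nth 0 y i + nth 0 (L x) i)%R n)))).
  rewrite -(@tint_tint_exchange _ _ _ (fun x y =>
   F (L x) * g (mkseq (fun i => nth 0 y i + nth 0 (L x) i)%R n)))//; first last.
  - apply: emeasurable_funM; first exact: measurable_comp_seq mF mLp.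
    exact: measurable_comp_seq mg mpm.
  - by move=> *; rewrite mule_ge0.
  rewrite -tintZ//; last by exact: tint_ge0.
  apply: eq_tint => x sx; rewrite muleC (tint_translate (nth 0%R (L x)) mg)//.
  rewrite -tintZ//.
  by apply: measurable_comp_seq mg _; apply: measurable_seq_mkseq => i;
    apply: measurable_funD => //; exact: measurable_nth.
transitivity (tint n (fun y => tint n (fun x =>
   F (mkseq (fun i => nth 0 (L x) i - nth 0 y i)%R n) * g (L x)))).
  apply: eq_tint => y sy.
  have mLy : measurable_seq n (fun x : n.-tuple T =>
     mkseq (fun i => nth 0 y i + nth 0 (L x) i)%R n).
    by apply: measurable_seq_mkseq => i; apply: measurable_funD => //; exact: mL.2.
  rewrite (tint_translate (nth 0%R (M y))); first last.
  - by move=> *; rewrite mule_ge0.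
  - by apply: emeasurable_funM; [exact: measurable_comp_seq mF mL|
      exact: measurable_comp_seq mg mLy].
  apply: eq_tint => x sx; rewrite LM//; congr (_ * g _).
  apply: (@eq_from_nth _ 0%R); rewrite size_mkseq ?sL// => i lin.
  by rewrite !nth_mkseq// addrC subrK.
rewrite -(@tint_tint_exchange _ _ _ (fun x y =>
  F (mkseq (fun i => nth 0 (L x) i - nth 0 y i)%R n) * g (L x)))//; first last.
- apply: emeasurable_funM; first exact: measurable_comp_seq mF mpm'.
  exact: measurable_comp_seq mg mLp.
- by move=> *; rewrite mule_ge0.
rewrite muleC -tintZ//; last by exact: tint_ge0.
apply: eq_tint => x sx; rewrite muleC (tint_reflect (nth 0%R (L x)) mF)//.
under eq_tint do rewrite muleC.
rewrite tintZ//.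
  by rewrite /g sqL// muleC.
by apply: measurable_comp_seq mF _; apply: measurable_seq_mkseq => i;
    apply: measurable_funB => //; exact: measurable_nth.
Qed.

End affine_maps.

(** * Polar coordinates *)

Section null_sets.
Context (R : realType).
Local Notation T := (measurableTypeR R).
Local Notation leb := (@lebesgue_measure R).
Local Open Scope ereal_scope.

Lemma integral_null_point (a : R) (f : T -> \bar R) :
  \int[leb]_x (if x == a then f x else 0) = 0.
Proof.
rewrite -[RHS](integral_set1 f a) [RHS]integral_mkcond; apply: eq_integral => x _.
rewrite patchE (_ : (x \in [set a]) = (x == a)); last first.
  by apply/idP/eqP => [/set_mem//|->]; exact: mem_set.
by case: (x == a).
Qed.

Lemma measurable_tint_consb n (b : seq R -> bool) (F : seq R -> \bar R) :
  measurable_fun setT (fun t : n.-tuple T => b t) -> tmeasurable n F ->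
  tmeasurable n (fun s => if b s then F s else 0).
Proof. by move=> mb mF; apply: measurable_fun_ifT. Qed.

(** As [c] ignores coordinate [i], the exceptional set is a graph over the other coordinates, and by
    Tonelli the integral over coordinate [i] is one over a single point. [F] may take the value +oo,
    so the lemma can also assert that the graph is null. *)
Lemma tint_null_coord n i (c : seq R -> R) (F : seq R -> \bar R) : (i < n)%N ->
  measurable_fun setT (fun t : n.-tuple T => c t : T) ->
  (forall s x, size s = n -> c (set_nth 0%R s i x) = c s) ->
  tmeasurable n F -> (forall s, 0 <= F s) ->
  tint n (fun s => if nth 0%R s i == c s then F s else 0) = 0.
Proof.
elim: i n c F => [|i IH] [//|n] c F lin mc cE mF F0.
  have mG : tmeasurable n.+1 (fun s => if nth 0%R s 0 == c s then F s else 0).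
    apply: measurable_tint_consb => //; apply: measurable_fun_eqr => //.
    exact: measurable_nth.
  have G0 s : 0 <= (if nth 0%R s 0 == c s then F s else 0) by case: ifP.
  rewrite (tintS mG G0); etransitivity.
    exact: (@tint_exchange _ _ _ _ leb _ (fun (x : T) s => G0 (x :: s)) (tmeasurableS mG)).
  rewrite -[RHS](_ : tint n (cst 0) = 0); last exact: integral0.
  apply: eq_tint => s sn; rewrite -[RHS](integral_null_point (c (0%R :: s)) (fun x => F (x :: s))).
  by apply: eq_integral => x _ /=; rewrite -(cE (x :: s) 0%R)//= sn.
have mG : tmeasurable n.+1 (fun s => if nth 0%R s i.+1 == c s then F s else 0).
  apply: measurable_tint_consb => //; apply: measurable_fun_eqr => //.
  exact: measurable_nth.
rewrite tintS//; last by move=> s; case: ifP.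
rewrite integral0_eq// => x _; apply: (IH n (fun s => c (x :: s)) (fun s => F (x :: s))) => //.
- apply: (measurable_comp_seq mc (G := fun t : n.-tuple T => x :: t)).
  by apply: measurable_seq_cons => //; exact: measurable_seq_tval.
- by move=> s y sn; rewrite -(cE (x :: s) y)//= sn.
- exact: (@tmeasurable_section R n _ T (fun (x : T) s => F (x :: s)) x (tmeasurableS mF)).
Qed.

End null_sets.

Section polar_coordinates.
Context (R : realType).
Local Notation T := (measurableTypeR R).
Local Notation leb := (@lebesgue_measure R).
Local Open Scope ereal_scope.

Lemma tmeasurable_cube k :
  tmeasurable k (fun s => if all (fun x : R => 0 <= x <= 1)%R s then 1 else 0 : \bar R).
Proof.
have m01 : measurable_fun setT (fun x : T => (0 <= x <= 1)%R).
  by apply: measurable_and; apply: measurable_fun_ler.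
by apply: measurable_fun_ifT; [exact: measurable_all|exact: measurable_cst|exact: measurable_cst].
Qed.

Lemma tint_cube n :
  tint n (fun s => if all (fun x : R => 0 <= x <= 1)%R s then 1 else 0) = 1 :> \bar R.
Proof.
have mc := tmeasurable_cube.
elim: n => [|n IH]; first by rewrite tint0.
rewrite tintS//; last by move=> s; case: ifP.
transitivity (\int[leb]_(x in `[0%R, 1%R]%classic) cst (1 : \bar R) x).
  rewrite [RHS]integral_mkcond; apply: eq_integral => x _.
  rewrite patchE mem_setE in_itv/=; case: ifP => x01; first by rewrite -[RHS]IH; apply: eq_tint.
  by rewrite [LHS]integral0_eq.
by rewrite integral_cst//= lebesgue_measure_itv/= lte_fin ltr01 sube0 mul1e.
Qed.

Lemma sumsq_affine (k : R) n s : size s = n ->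
  sumsq (affine_seq (fun=> k) (fun=> 0%R) n s) = (k ^+ 2 * sumsq s)%R.
Proof.
move=> sn; rewrite /sumsq big_map [in RHS](big_nth 0%R) sn mulr_sumr /index_iota subn0.
by apply: eq_bigr => i _; rewrite addr0 exprMn.
Qed.

Lemma powR_rootK (x t : R) : (0 < t)%R -> (0 <= x)%R -> ((x `^ t) `^ t^-1 = x)%R.
Proof. by move=> t0 x0; rewrite -powRrM divff ?gt_eqF// powRr1. Qed.

Lemma root_powRK (x t : R) : (0 < t)%R -> (0 <= x)%R -> ((x `^ t^-1) `^ t = x)%R.
Proof. by move=> t0 x0; rewrite -powRrM mulVf ?gt_eqF// powRr1. Qed.

Lemma powR_le_root (x y t : R) : (0 < t)%R -> (0 <= x)%R -> (0 <= y)%R ->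
  (x `^ t <= y)%R = (x <= y `^ t^-1)%R.
Proof.
move=> t0 x0 y0; have ti : (0 < t^-1)%R by rewrite invr_gt0.
apply/idP/idP => h.
  by rewrite -(powR_rootK t0 x0) ge0_ler_powR ?nnegrE ?powR_ge0// ltW.
by rewrite -(root_powRK t0 y0) ge0_ler_powR ?nnegrE ?powR_ge0// ltW.
Qed.

Variable d : nat.
Hypothesis d0 : (0 < d)%N.
Let theta : R := (d%:R / 2)%R.
Let theta0 : (0 < theta)%R. Proof. by rewrite divr_gt0// ltr0n. Qed.

Let V (t : R) := tint d (fun s : seq R => if (sumsq s <= t)%R then 1 else 0 : \bar R).

Let mV (t : R) : tmeasurable d (fun s : seq R => if (sumsq s <= t)%R then 1 else 0 : \bar R).
Proof.
apply: measurable_fun_ifT => //; apply: measurable_fun_ler => //.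
by apply: measurable_sumsq; exact: measurable_seq_tval.
Qed.

Let V0 (t : R) s : 0 <= (if (sumsq s <= t)%R then 1 else 0) :> \bar R.
Proof. by case: ifP. Qed.

Let V_scale (t : R) : (0 < t)%R -> V t = (t `^ theta)%:E * V 1.
Proof.
move=> t0; rewrite /V (@tint_affine _ (fun=> Num.sqrt t) (fun=> 0%R))//; last first.
  by move=> i _; rewrite gt_eqF// sqrtr_gt0.
rewrite prodr_const card_ord ger0_norm ?sqrtr_ge0//.
rewrite /theta mulrC powRrM powR12_sqrt ?ltW// powR_mulrn ?sqrtr_ge0//; congr (_ * _).
apply: eq_tint => s sd; rewrite sumsq_affine// sqr_sqrtr ?(ltW t0)//.
by rewrite -{2}[t]mulr1 ler_pM2l.
Qed.

Let V1_fin : V 1 < +oo.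
Proof.
(* On the unit ball 1 <= exp (1 - |s|^2), so the Gaussian integral bounds the volume. *)
apply: (@le_lt_trans _ _ ((expR 1)%:E * tint d (fun s => (expR (- sumsq s))%:E))).
  rewrite -tintZ; first last.
  - by rewrite lee_fin expR_ge0.
  - by move=> s; rewrite lee_fin expR_ge0.
  - exact: tmeasurable_EFin_expR_sumsq.
  apply: ge0_le_integral => //.
  - exact: mV.
  - by apply: measurable_funeM; exact: tmeasurable_EFin_expR_sumsq.
  - move=> s _; rewrite -EFinM -expRD; case: ifP => h; last by rewrite lee_fin expR_ge0.
    by rewrite lee_fin -{1}expR0 ler_expR subr_ge0.
by rewrite tint_gauss -EFinM ltry.
Qed.

Let V1_gt0 : 0 < V 1.
Proof.
have dR : (0 < d%:R :> R)%R by rewrite ltr0n.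
(* The ball |s|^2 <= d contains the unit cube; [V_scale] carries the bound over to the unit ball. *)
have : 1 <= V d%:R.
  rewrite -(tint_cube d); apply: ge0_le_integral => //.
  - by move=> s _; case: ifP.
  - exact: tmeasurable_cube.
  - exact: mV.
  - move=> s _; case: ifP => h; last by case: ifP.
    suff : (sumsq s <= (size s)%:R)%R by rewrite size_tuple => ->.
    rewrite -sum1_size natr_sum /sumsq big_seq [leRHS]big_seq; apply: ler_sum => x xs.
    by move/allP : h => /(_ x xs) /andP[x0 x1]; rewrite expr_le1.
rewrite V_scale// => h; rewrite lt0e; apply/andP; split; last exact: tint_ge0.
by apply/eqP => V10; move: h; rewrite V10 mule0 leNgt lte01.
Qed.

Let kappa := fine (V 1).
Let kappaE : V 1 = kappa%:E.
Proof. by rewrite fineK// ge0_fin_numE// ltW. Qed.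
Let kappa0 : (0 < kappa)%R.
Proof. by rewrite -lte_fin -kappaE. Qed.

Let mphi : measurable_fun setT
  (fun t : d.-tuple T => kappa * (sumsq t) `^ theta : T)%R.
Proof.
apply: measurable_funM => //; apply: (measurableT_comp (measurable_powR theta)).
by apply: measurable_sumsq; exact: measurable_seq_tval.
Qed.

(** [kappa * (sumsq s) ^ theta] is the volume of the centred ball whose boundary passes through s,
    so its sublevel set at t > 0 has measure exactly t. *)
Let measure_phi (a b : R) : (0 < a)%R -> (a < b)%R ->
  lebesgue_tuple R d ((fun t : d.-tuple T => kappa * (sumsq t) `^ theta : T)%R @^-1`
    `]a, b]%classic) = (b - a)%:E.
Proof.
set phi := (fun t : d.-tuple T => _ : T) => a0 ab.
have mB t : measurable (phi @^-1` `]-oo, t]%classic).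
  by rewrite -[X in measurable X]setTI; apply: mphi.
have muB t : (0 < t)%R -> lebesgue_tuple R d (phi @^-1` `]-oo, t]%classic) = t%:E.
  move=> t0; have tk : (0 <= t / kappa)%R by rewrite divr_ge0// ltW.
  rewrite -[LHS]mul1e -[LHS](integral_cst _ (mB t)) [LHS]integral_mkcond.
  transitivity (V ((t / kappa) `^ theta^-1)%R).
    apply: eq_integral => s _; rewrite patchE -powR_le_root// ?sumsq_ge0//.
    rewrite (_ : (_ \in _) = (phi s <= t)%R); last first.
      by apply/idP/idP; rewrite inE/= in_itv.
    by rewrite /phi ler_pdivlMr// mulrC.
  rewrite V_scale ?powR_gt0 ?divr_gt0// root_powRK// kappaE -EFinM.
  by rewrite divfK// gt_eqF.
rewrite (_ : phi @^-1` _ = phi @^-1` `]-oo, b]%classic `\` phi @^-1` `]-oo, a]%classic); last first.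
  apply/seteqP; split=> s /=; rewrite !in_itv/=.
    by move=> /andP[asb ->]; split => //; apply/negP; rewrite -ltNge.
  by move=> [-> /negP]; rewrite -ltNge => ->.
have hb := muB b (lt_trans a0 ab); have ha := muB a a0.
rewrite measureD//; last by apply: (le_lt_trans (_ : _ <= b%:E)); rewrite ?ltry// -hb.
rewrite (_ : phi @^-1` `]-oo, b]%classic `&` _ = phi @^-1` `]-oo, a]%classic).
  by rewrite EFinB -hb -ha.
apply/setIidPr => s /=; rewrite !in_itv/= => /le_trans; apply; exact: ltW.
Qed.

Let tint_sumsq_kappa (h : T -> \bar R) : measurable_fun setT h -> (forall r, 0 <= h r) ->
  tint d (fun s => h (sumsq s)) =
  (kappa * theta)%:E * \int[leb]_r (if (0 < r)%R then h r * (r `^ (theta - 1))%:E else 0).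
Proof.
move=> mh h0.
have ms : measurable_fun setT (fun t : d.-tuple T => sumsq t : T).
  by apply: measurable_sumsq; exact: measurable_seq_tval.
have mhs : tmeasurable d (fun s => h (sumsq s)) by exact: (measurableT_comp mh).
have ml0 : measurable_fun setT (fun r : T => (0 < r)%R) by exact: measurable_fun_ltr.
pose g0 (u : T) := h ((u / kappa) `^ theta^-1)%R.
have mg0 : measurable_fun setT g0.
  apply: (measurableT_comp mh); apply: (measurableT_comp (measurable_powR _)).
  exact: measurable_funM.
pose g (u : T) := if (0 < u)%R then g0 u else 0.
have mg : measurable_fun setT g by exact: measurable_fun_ifT.
have gE s : g (kappa * (sumsq s) `^ theta)%R = if (0 < sumsq s)%R then h (sumsq s) else 0.
  rewrite /g pmulr_rgt0//; case: ifPn => [s0|].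
    have {}s0 : (0 < sumsq s)%R by apply: gt0_powR s0 => //; exact: sumsq_ge0.
    by rewrite s0 /g0 mulrAC divff ?mul1r ?gt_eqF// powR_rootK ?ltW.
  by case: ifPn => // s0; rewrite powR_gt0.
transitivity (tint d (fun s => g (kappa * (sumsq s) `^ theta)%R)).
  under [RHS]eq_tint do rewrite gE.
  (* The transferred function drops the origin, where [sumsq] vanishes. This part is kept inside the
     hyperplane where the first coordinate is 0, which is null. *)
  have Hs s : h (sumsq s) = (if nth 0%R s 0 == 0%R then
     if (0 < sumsq s)%R then 0 else h (sumsq s) else 0) +
    (if (0 < sumsq s)%R then h (sumsq s) else 0).
    case: (ltP 0%R (sumsq s)) => [s0|s0]; first by rewrite if_same add0e.
    rewrite adde0; case: s s0 => [|x s]; first by rewrite eqxx.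
    rewrite sumsq_cons => s0; have : (x ^+ 2 + sumsq s == 0)%R.
      by rewrite eq_le s0 addr_ge0 ?sqr_ge0 ?sumsq_ge0.
    by rewrite paddr_eq0 ?sqr_ge0 ?sumsq_ge0//= sqrf_eq0 => /andP[-> _].
  have mF : tmeasurable d (fun s => if (0 < sumsq s)%R then 0 else h (sumsq s)).
    by apply: measurable_fun_ifT => //; exact: (measurableT_comp ml0 ms).
  under eq_tint do rewrite Hs.
  rewrite /tint ge0_integralD//; first last.
  - by apply: measurable_fun_ifT => //; exact: (measurableT_comp ml0 ms).
  - by move=> s _; case: ifP.
  - apply: measurable_fun_ifT => //; apply: measurable_fun_eqr => //; exact: measurable_nth.
  - by move=> s _; case: ifP => // _; case: ifP.
  rewrite [X in X + _](_ : _ = 0) ?add0e//.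
  apply: (@tint_null_coord R d 0 (fun=> 0%R)
    (fun s => if (0 < sumsq s)%R then 0 else h (sumsq s))) => //.
  by move=> s; case: ifP.
rewrite /tint (@integral_gt0_transfer _ _ _ (lebesgue_tuple R d) _ mphi measure_phi g)//; first last.
- by move=> r r0; rewrite /g ltNge r0.
- by move=> r; rewrite /g /g0; case: ifP.
pose psi (r : R) := (kappa * r `^ theta)%R.
pose w (r : R) := (kappa * theta * r `^ (theta - 1))%R.
have dpsi (x : T) : (0 < x)%R -> is_derive (x : R) (1 : R)%R psi ((-1) ^+ false * w x)%R.
  move=> x0; rewrite expr0 mul1r /w -mulrA.
  by have := is_derive1_powR theta x0 => ?; apply: is_deriveZ.
have cw (x : T) : (0 < x)%R -> {for x : R, continuous w}.
  move=> x0; have cp : {for x : R, continuous (@powR R ^~ (theta - 1)%R)}.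
    apply: differentiable_continuous; apply/derivable1_diffP.
    by have := is_derive1_powR (theta - 1) x0 => ?; exact: ex_derive.
  by apply: cvgM; [exact: cvg_cst|exact: cp].
have mpsi : measurable_fun setT (psi : T -> T).
  by apply: measurable_funM => //; exact: measurable_powR.
have mw : measurable_fun setT (w : T -> T).
  by apply: measurable_funM => //; exact: measurable_powR.
transitivity (\int[leb]_r (if (0 < r)%R then g0 (psi r) * (w r)%:E else 0)).
  apply/esym; apply: (integral_subst_mono ml0 mpsi mw _ dpsi cw) => //.
  - by move=> x y z x0 y0 /andP[xz _]; exact: lt_le_trans xz.
  - by move=> x x0; rewrite !mulr_ge0 ?powR_ge0// ltW.
  - by move=> x y x0 y0 xy; rewrite ltr_pM2l// gt0_ltr_powR// nnegrE ltW.
  - by move=> x x0; rewrite mulr_gt0// powR_gt0.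
  - move=> a a0; exists ((a / kappa) `^ theta^-1)%R; first by rewrite powR_gt0// divr_gt0.
    by rewrite /psi root_powRK ?divr_ge0 ?ltW// mulrC divfK// gt_eqF.
  - by move=> r; exact: h0.
rewrite -ge0_integralZl//; first last.
- by rewrite lee_fin mulr_ge0 ?ltW.
- by move=> r _; case: ifP => // _; rewrite mule_ge0// lee_fin powR_ge0.
- apply: measurable_fun_ifT => //; apply: emeasurable_funM => //.
  by apply/measurable_EFinP; exact: measurable_powR.
apply: eq_integral => r _; case: ifPn => r0; last by rewrite mule0.
rewrite /g0 /psi mulrAC divff ?mul1r ?gt_eqF// powR_rootK ?ltW//.
by rewrite /w EFinM muleCA.
Qed.

(** Testing on h = exp (- r) identifies the constant: the left side is a Gaussian integral, equal to
    pi^theta, and the right side is [kappa * theta] times Euler's integral. *)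
Lemma tint_sumsq (h : T -> \bar R) : measurable_fun setT h -> (forall r, 0 <= h r) ->
  tint d (fun s => h (sumsq s)) = (pi `^ theta / Gamma theta)%:E *
    \int[leb]_r (if (0 < r)%R then h r * (r `^ (theta - 1))%:E else 0).
Proof.
move=> mh h0; rewrite tint_sumsq_kappa//; congr (_%:E * _).
have kt : (0 < kappa * theta)%R by rewrite mulr_gt0.
have pt : (0 < (pi : R) `^ theta)%R by rewrite powR_gt0// pi_gt0.
pose G := \int[leb]_r (if (0 < r)%R then (expR (- r))%:E * (r `^ (theta - 1))%:E else 0).
have kG : (kappa * theta)%:E * G = (pi `^ theta)%:E.
  rewrite -(@tint_sumsq_kappa (fun r => (expR (- r))%:E)).
  - by rewrite tint_gauss /theta mulrC powRrM powR12_sqrt ?pi_ge0// powR_mulrn ?sqrtr_ge0.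
  - by apply/measurable_EFinP; apply: measurableT_comp => //.
  - by move=> r; rewrite lee_fin expR_ge0.
have GE : G = (pi `^ theta / (kappa * theta))%:E.
  rewrite mulrC EFinM -kG muleA -EFinM mulVf ?gt_eqF// mul1e//.
have -> : Gamma theta = (pi `^ theta / (kappa * theta))%R.
  rewrite -[RHS]/(fine _%:E) -GE /Gamma /Rintegral; congr fine.
  rewrite [LHS]integral_mkcond; apply: eq_integral => r _.
  by rewrite patchE mem_setE in_itv/= andbT muleC; case: ifP.
by rewrite invf_div [RHS]mulrC divfK ?gt_eqF.
Qed.

End polar_coordinates.

Section block_polar.
Context (R : realType).
Local Notation T := (measurableTypeR R).
Local Notation leb := (@lebesgue_measure R).
Variable d : nat.
Hypothesis d0 : (0 < d)%N.
Let theta : R := (d%:R / 2)%R.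

Definition sqnorms n (s : seq R) : seq R :=
  mkseq (fun j => \sum_(c < d) nth 0 s (d * j + c) ^+ 2) n.

Lemma sqnorms_cat n s t : size s = d -> sqnorms n.+1 (s ++ t) = sumsq s :: sqnorms n t.
Proof.
move=> sd; rewrite /sqnorms mkseq_cons; congr cons.
  rewrite /sumsq (big_nth 0) sd big_mkord; apply: eq_bigr => c _.
  by rewrite muln0 add0n nth_cat sd ltn_ord.
apply: eq_mkseq => j /=; apply: eq_bigr => c _; rewrite nth_cat sd.
by rewrite ltnNge mulnS -addnA leq_addr addKn.
Qed.

Lemma measurable_sqnorms e (X : measurableType e) m n (G : X -> seq R) :
  measurable_seq m G -> measurable_seq n (fun x => sqnorms n (G x)).
Proof.
move=> [_ mG]; apply: measurable_seq_mkseq => j.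
by apply: measurable_sum => c; apply: measurable_funX; exact: mG.
Qed.

Local Open Scope ereal_scope.

Let C : R := (pi `^ theta / Gamma theta)%R.

Lemma Gamma_ge0 (x : R) : (0 <= Gamma x)%R.
Proof.
apply: Rintegral_ge0 => t _.
by rewrite mulr_ge0 ?powR_ge0 ?expR_ge0.
Qed.

Let C0 : (0 <= C)%R. Proof. by rewrite divr_ge0 ?powR_ge0 ?Gamma_ge0. Qed.

Definition radial_weight (r : seq R) : R := (\prod_(x <- r) x `^ (theta - 1))%R.

Lemma radial_weight_ge0 r : (0 <= radial_weight r)%R.
Proof. by rewrite /radial_weight prodr_ge0// => x _; exact: powR_ge0. Qed.

Lemma measurable_radial_weight e (X : measurableType e) n (G : X -> seq R) :
  measurable_seq n G -> measurable_fun setT (fun x => radial_weight (G x) : T).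
Proof.
move=> [sG mG].
apply: (eq_measurable_fun (fun x => \prod_(0 <= i < n) (nth 0 (G x) i) `^ (theta - 1) : T)%R).
  by move=> x _; rewrite [RHS](big_nth 0%R) sG.
apply: measurable_prod => i _.
exact: (measurableT_comp (measurable_powR _) (mG i)).
Qed.

Definition positive_seq (r : seq R) := all (fun x => 0 < x)%R r.

Lemma measurable_positive_seq e (X : measurableType e) n (G : X -> seq R) :
  measurable_seq n G -> measurable_fun setT (fun x => positive_seq (G x)).
Proof.
move=> mG; apply: (measurable_comp_seq _ mG).
by apply: measurable_all; exact: measurable_fun_ltr.
Qed.

Lemma tmeasurable_radial n (h : seq R -> \bar R) : tmeasurable n h ->
  tmeasurable n (fun r => if positive_seq r then h r * (radial_weight r)%:E else 0).
Proof.
move=> mh; apply: measurable_fun_ifT => //.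
  by apply: measurable_positive_seq; exact: measurable_seq_tval.
apply: emeasurable_funM => //; apply/measurable_EFinP.
by apply: measurable_radial_weight; exact: measurable_seq_tval.
Qed.

Lemma tint_sqnorms n (h : seq R -> \bar R) : tmeasurable n h -> (forall r, 0 <= h r) ->
  tint (d * n) (fun s => h (sqnorms n s)) =
  (C ^+ n)%:E * tint n (fun r => if positive_seq r then h r * (radial_weight r)%:E else 0).
Proof.
elim: n h => [|n IH] h mh h0.
  by rewrite muln0 !tint0 /radial_weight big_nil mule1 mul1e /sqnorms.
pose H x := tint n (fun r => if positive_seq r then h (x :: r) * (radial_weight r)%:E else 0).
have mhx : measurable_fun setT (fun p : T * n.-tuple T => h (p.1 :: p.2)) by exact: tmeasurableS.
have rw0 x r : 0 <= (if positive_seq r then h (x :: r) * (radial_weight r)%:E else 0).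
  by case: ifP => // _; rewrite mule_ge0// lee_fin radial_weight_ge0.
have mH : measurable_fun setT (H : T -> \bar R).
  apply: measurable_tint => //; apply: measurable_fun_ifT => //.
    by apply: measurable_positive_seq; exact: measurable_seq_tval.
  apply: emeasurable_funM => //; apply/measurable_EFinP.
  by apply: measurable_radial_weight; exact: measurable_seq_tval.
have H0 x : 0 <= H x by exact: tint_ge0.
have mhs : tmeasurable (d + d * n) (fun s => h (sqnorms n.+1 s)).
  apply: (measurable_comp_seq mh); apply: measurable_sqnorms.
  exact: measurable_seq_tval.
rewrite mulnS tint_cat//.
transitivity (tint d (fun s => (C ^+ n)%:E * H (sumsq s))).
  apply: eq_tint => s sd; rewrite /H -(IH (fun r => h (sumsq s :: r)))//; last first.
    exact: (@tmeasurable_section R n _ T (fun (x : T) r => h (x :: r)) (sumsq s) mhx).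
  by apply: eq_tint => t _; rewrite sqnorms_cat.
rewrite tintZ//; first last.
- by rewrite lee_fin exprn_ge0.
- by apply: (measurableT_comp mH); apply: measurable_sumsq; exact: measurable_seq_tval.
rewrite (tint_sumsq d0 mH H0) exprSr (EFinM (C ^+ n)%R) -[RHS]muleA; congr (_ * _); congr (_ * _).
rewrite tintS; first last.
- move=> r; case: ifP => // _; rewrite mule_ge0// lee_fin radial_weight_ge0//.
- exact: tmeasurable_radial.
apply: eq_integral => x _; case: ifPn => x0; last first.
  by rewrite [RHS]integral0_eq// => t _ /=; rewrite (negbTE x0).
rewrite muleC -tintZ//; last by rewrite lee_fin powR_ge0.
  apply: eq_tint => r _; rewrite /= x0; case: ifP => _; last by rewrite mule0.
  by rewrite /radial_weight big_cons EFinM muleCA.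
apply: (@tmeasurable_radial n (fun r => h (x :: r))).
exact: (@tmeasurable_section R n _ T (fun (x : T) r => h (x :: r)) x mhx).
Qed.

End block_polar.

(** * Interlacing sequences and the secular function *)

Section interlacing.
Context (R : realType).
Implicit Types (lam mu cr : seq R) (l m x : R).

Fixpoint interlace lam mu : bool :=
  match lam, mu with
  | [::], [:: _] => true
  | l :: lam', m :: mu' => [&& m < l, l < head 0 mu' & interlace lam' mu']
  | _, _ => false
  end.

(* For cr = c :: r, the function x - c - sum_i r_i / (x - lam_i), whose zeros  *)
(* are the eigenvalues of the bordered diagonal matrix                         *)
(* [diag lam, b; b^*, c] with |b_i|^2 = r_i.                                   *)
Definition secular lam cr x : R :=
  x - nth 0 cr 0 - \sum_(i < size lam) nth 0 cr i.+1 / (x - nth 0 lam i).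

(* The pair c :: r for which the secular function has the zeros mu:            *)
(* multiplying by (x - m) / (x - l) adds the zero m and the pole l.            *)
Fixpoint border lam mu : seq R :=
  match lam, mu with
  | l :: lam', m :: mu' => let cr := border lam' mu' in
    [:: nth 0 cr 0 + m - l, (m - l) * secular lam' cr l &
        mkseq (fun i => nth 0 cr i.+1 * (nth 0 lam' i - m) / (nth 0 lam' i - l))
          (size lam')]
  | _, _ => [:: head 0 mu]
  end.

Fixpoint vand (s : seq R) : R :=
  if s is x :: s' then (\prod_(y <- s') (y - x)) * vand s' else 1.

Definition border_jac lam mu : R := vand mu / vand lam.

Lemma size_border lam mu : size mu = (size lam).+1 -> size (border lam mu) = (size lam).+1.
Proof. by elim: lam mu => [|l lam IH] [|m mu] //=; rewrite size_mkseq. Qed.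

Lemma size_interlace lam mu : interlace lam mu -> size mu = (size lam).+1.
Proof.
by elim: lam mu => [|l lam IH] [|m mu] //=; [case: mu|move=> /and3P[_ _ /IH ->]].
Qed.

Lemma interlace_head lam mu : interlace lam mu -> exists m mu', mu = m :: mu'.
Proof. by move=> /size_interlace; case: mu => // m mu _; exists m, mu. Qed.

Lemma secular_cons l lam c r0 r x :
  secular (l :: lam) [:: c, r0 & r] x = secular lam (c :: r) x - r0 / (x - l).
Proof.
rewrite /secular /= big_ord_recl /= opprD addrA addrAC; congr (_ - _).
Qed.

Lemma secular_shift l m lam cr x : l != x -> {in lam, forall a, a != l /\ a != x} ->
  secular (l :: lam) [:: nth 0 cr 0 + m - l, (m - l) * secular lam cr l &
    mkseq (fun i => nth 0 cr i.+1 * (nth 0 lam i - m) / (nth 0 lam i - l)) (size lam)] x =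
  secular lam cr x * (x - m) / (x - l).
Proof.
move=> lx lamP; have xl0 : x - l != 0 by rewrite subr_eq0 eq_sym.
rewrite secular_cons; apply: (mulIf xl0); rewrite divfK// mulrBl divfK// /secular /=.
rewrite !mulrBl mulrBr.
set A := \sum_(i < size lam) _; set B := \sum_(i < size lam) _.
set C := \sum_(i < size lam) _.
(* Termwise this is the partial fraction expansion of (x - m) / ((x - l) (x - a)), multiplied by x -
   l. *)
have -> : A * (x - l) = (m - l) * B + C * (x - m).
  rewrite !mulr_suml mulr_sumr -big_split; apply: eq_bigr => i _ /=.
  have [al ax] := lamP _ (mem_nth 0 (ltn_ord i)).
  rewrite nth_mkseq//.
  by field; rewrite !subr_eq0 -![x == _]eq_sym -![l == _]eq_sym al ax.
by ring.
Qed.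

Lemma interlace_gt lam m mu : interlace lam (m :: mu) -> all (fun x => m < x) mu.
Proof.
elim: lam m mu => [|l lam IH] m mu /=; first by case: mu.
move=> /and3P[ml lm im]; have [m' [mu' E]] := interlace_head im; subst mu.
rewrite /= (lt_trans ml lm)/=; apply/allP => x xmu.
by have /allP/(_ x xmu) := IH _ _ im; exact/lt_trans/(lt_trans ml).
Qed.

Lemma interlace_sorted lam mu : interlace lam mu -> sorted <%R mu.
Proof.
elim: lam mu => [|l lam IH] [|m mu] //=; first by case: mu.
move=> /and3P[ml lm im]; have [m' [mu' E]] := interlace_head im; subst mu.
by rewrite /= (lt_trans ml lm)/=; exact: IH im.
Qed.

Lemma path_lt_all l lam : path <%R l lam -> all (fun a => l < a) lam.
Proof. by rewrite lt_path_sortedE => /andP[]. Qed.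

Lemma secular_border lam mu x : interlace lam mu -> sorted <%R lam -> x \notin lam ->
  secular lam (border lam mu) x = \prod_(m <- mu) (x - m) / \prod_(l <- lam) (x - l).
Proof.
elim: lam mu x => [|l lam IH] [|m mu] x //=.
  case: mu => // _ _ _; rewrite /secular /= big_ord0 subr0.
  by rewrite big_seq1 big_nil divr1.
move=> /and3P[ml lm im] pl; rewrite inE negb_or => /andP[xl xlam].
have := path_lt_all pl => /allP ltl.
rewrite secular_shift; last 2 first.
- by rewrite eq_sym.
- move=> a alam; split; first by rewrite gt_eqF// ltl.
  by apply: contraNneq xlam => <-.
rewrite IH//; last exact: path_sorted pl.
by rewrite !big_cons invfM; ring.
Qed.

(** Pairing each pole with the next zero to its right gives a quotient of two negative numbers. *)
Lemma interlace_ratio_gt0 lam m mu l : interlace lam (m :: mu) ->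
  all (fun a => l < a) lam ->
  0 < \prod_(p <- mu) (l - p) / \prod_(a <- lam) (l - a).
Proof.
elim: lam m mu => [|a lam IH] m mu /=.
  by case: mu => // _ _; rewrite !big_nil divr1.
move=> /and3P[ma am im] /andP[la lall]; have [m' [mu' E]] := interlace_head im; subst mu.
rewrite !big_cons invfM mulrACA mulr_gt0 ?IH//; last exact: IH im lall.
by rewrite -mulrNN mulr_gt0// ?oppr_gt0 ?invr_lt0 ?subr_lt0// (lt_trans la).
Qed.

(** Turns the interlacing condition between [l] and [mu] into a condition on the coefficients
    [border lam mu], so that in [tint_border] it can be absorbed into the integrand of the induction
    hypothesis. *)
Lemma secular_border_lt0 lam mu l : interlace lam mu -> path <%R l lam ->
  (secular lam (border lam mu) l < 0) = (l < head 0 mu).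
Proof.
move=> im pl; have ltl := path_lt_all pl.
rewrite secular_border//; last 2 first.
- exact: path_sorted pl.
- by apply/negP => /(allP ltl); rewrite ltxx.
have [m [mu' E]] := interlace_head im; subst mu.
rewrite big_cons -mulrA pmulr_llt0 ?subr_lt0//.
exact: interlace_ratio_gt0 im ltl.
Qed.

(** There is one more zero than poles, so reversing all differences in the product formula for the
    secular function leaves a single minus sign. *)
Lemma prod_sub_border lam mu m : interlace lam mu -> path <%R m lam ->
  \prod_(p <- mu) (p - m) =
  - secular lam (border lam mu) m * \prod_(a <- lam) (a - m).
Proof.
move=> im pl; have ltl := path_lt_all pl.
have mlam : m \notin lam by apply/negP => /(allP ltl); rewrite ltxx.
rewrite secular_border//; last exact: path_sorted pl.
have neg s : \prod_(p <- s) (p - m) = (-1) ^+ size s * \prod_(p <- s) (m - p).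
  elim: s => [|p s IH]; first by rewrite !big_nil mulr1.
  by rewrite !big_cons IH /= exprS; ring.
rewrite !neg (size_interlace im) exprS.
have nz : \prod_(l <- lam) (m - l) != 0.
  rewrite prodf_seq_neq0; apply/allP => a alam /=.
  by rewrite subr_eq0; apply: contraNneq mlam => ->.
have -> : - (\prod_(m0 <- mu) (m - m0) / \prod_(l <- lam) (m - l)) *
   ((-1) ^+ size lam * \prod_(p <- lam) (m - p)) =
  - (-1) ^+ size lam * (\prod_(m0 <- mu) (m - m0)) *
  (\prod_(l <- lam) (m - l) / \prod_(l <- lam) (m - l)) by ring.
by rewrite divff//; ring.
Qed.

Lemma vand_gt0 s : sorted <%R s -> 0 < vand s.
Proof.
elim: s => [//|x s IH] /= ps; rewrite mulr_gt0 ?IH ?(path_sorted ps)//.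
rewrite big_seq prodr_gt0// => y ys.
by rewrite subr_gt0 (allP (path_lt_all ps)).
Qed.

Lemma border_jac_ge0 lam mu : interlace lam mu -> sorted <%R lam -> 0 <= border_jac lam mu.
Proof.
move=> im sl; rewrite divr_ge0// ltW// vand_gt0//.
exact: interlace_sorted im.
Qed.

(** Adding [m] and [l] multiplies [vand mu] by prod_p (p - m) and [vand lam] by prod_a (a - l). The
    former is a value of the secular function, so the new factor depends on [mu] only through
    [border lam mu], as the induction in [tint_border] requires. *)
Lemma border_jac_cons l lam m mu : interlace lam mu -> path <%R l lam -> m < l ->
  border_jac (l :: lam) (m :: mu) =
  - secular lam (border lam mu) m * (\prod_(a <- lam) ((a - m) / (a - l)))
  * border_jac lam mu.
Proof.
move=> im pl ml; rewrite /border_jac /= (@prod_sub_border lam)//; last first.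
  case: lam pl {im} => //= a lam /andP[la ->]; by rewrite (lt_trans ml la).
by rewrite invfM prodf_div; ring.
Qed.

(** Up to sign, the residue at the pole a_i is prod_p (a_i - p) / prod_(k != i) (a_i - a_k); in the
    product over i every pair of poles occurs twice, whence the square. The proof follows the
    recursion of [border]. *)
Lemma prod_border lam mu : interlace lam mu -> sorted <%R lam ->
  \prod_(r <- behead (border lam mu)) r =
  \prod_(a <- lam) \prod_(p <- mu) `|a - p| / (vand lam) ^+ 2.
Proof.
elim: lam mu => [|l lam IH] [|m mu] //= .
  by case: mu => // _ _; rewrite !big_nil expr1n divr1.
move=> /and3P[ml lm im] pl; have ltl := path_lt_all pl.
rewrite !big_cons /=.
have -> : \prod_(j <- mkseq (fun i => nth 0 (border lam mu) i.+1 * (nth 0 lam i - m) /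
    (nth 0 lam i - l)) (size lam)) j =
  (\prod_(r <- behead (border lam mu)) r) * \prod_(a <- lam) (a - m) /
  \prod_(a <- lam) (a - l).
  rewrite big_map -mulrA -prodf_div [X in _ = X * _](big_nth 0) [X in _ = _ * X](big_nth 0).
  rewrite size_behead (size_border (size_interlace im)) /= /index_iota subn0 -big_split.
  by apply: eq_bigr => i _ /=; rewrite nth_behead mulrA.
rewrite IH ?(path_sorted pl)//.
have -> : \prod_(a <- lam) \prod_(p <- m :: mu) `|a - p| =
    \prod_(a <- lam) (a - m) * \prod_(a <- lam) \prod_(p <- mu) `|a - p|.
  rewrite -big_split /= !big_seq; apply: eq_bigr => a alam; rewrite big_cons gtr0_norm//.
  by rewrite subr_gt0 (lt_trans ml)// (allP ltl).
have -> : \prod_(p <- mu) `|l - p| = - secular lam (border lam mu) l * \prod_(a <- lam) (a - l).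
  rewrite -prod_sub_border// !big_seq; apply: eq_bigr => p pmu; rewrite distrC gtr0_norm//.
  have [m' [mu' E]] := interlace_head im; subst mu; rewrite subr_gt0.
  move: pmu lm; rewrite inE => /predU1P[->//|pmu] lm.
  exact: lt_trans lm (allP (interlace_gt im) p pmu).
rewrite gtr0_norm ?subr_gt0//.
have A0 : \prod_(a <- lam) (a - l) != 0.
  by rewrite gt_eqF// big_seq prodr_gt0// => a /(allP ltl); rewrite subr_gt0.
have V0 : vand lam != 0 by rewrite gt_eqF// vand_gt0// (path_sorted pl).
by field; rewrite V0 A0.
Qed.

Lemma border_pos lam mu : interlace lam mu -> sorted <%R lam ->
  positive_seq (behead (border lam mu)).
Proof.
elim: lam mu => [|l lam IH] [|m mu] //=.
move=> /and3P[ml lm im] pl; have ltl := path_lt_all pl.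
rewrite -mulrNN mulr_gt0 ?oppr_gt0 ?secular_border_lt0 ?subr_lt0//=.
have /(all_nthP 0) pos := IH _ im (path_sorted pl).
apply/(all_nthP 0) => i; rewrite size_mkseq => il; rewrite nth_mkseq//.
have ltal : l < nth 0 lam i by apply: (allP ltl); exact: mem_nth.
rewrite divr_gt0 ?subr_gt0// mulr_gt0 ?subr_gt0 ?(lt_trans ml)//.
rewrite -nth_behead pos// size_behead (size_border (size_interlace im)).
by [].
Qed.

End interlacing.

(** * Derivative and monotonicity of the secular function *)

Section secular_analysis.
Context (R : realType).
Local Notation T := (measurableTypeR R).
Local Notation leb := (@lebesgue_measure R).
Implicit Types (lam r : seq R) (c x l m : R).

Definition dsecular lam r x : R :=
  1 + \sum_(i < size lam) nth 0 r i / (x - nth 0 lam i) ^+ 2.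

Lemma secular_consl a lam c r x :
  secular (a :: lam) (c :: r) x = secular lam (c :: behead r) x - nth 0 r 0 / (x - a).
Proof.
rewrite -secular_cons /secular /=; congr (_ - _); apply: eq_bigr => -[[|i] ilt] _ //=.
by rewrite nth_behead.
Qed.

Lemma dsecular_cons a lam r x :
  dsecular (a :: lam) r x = dsecular lam (behead r) x + nth 0 r 0 / (x - a) ^+ 2.
Proof.
rewrite /dsecular /= big_ord_recl /= addrCA addrC; congr (_ + _ + _).
by apply: eq_bigr => i _; rewrite nth_behead.
Qed.

Lemma is_derive_secular lam c r x : x \notin lam ->
  is_derive x 1 (secular lam (c :: r)) (dsecular lam r x).
Proof.
elim: lam r => [|a lam IH] r.
  move=> _; rewrite (_ : secular _ _ = fun y => y - c); last first.
    by apply/funext => y; rewrite /secular big_ord0 subr0.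
  by apply: is_derive_eq; rewrite /dsecular big_ord0 subr0 addr0.
rewrite inE negb_or => /andP[xa xlam]; have dIH := IH (behead r) xlam.
rewrite (_ : secular _ _ = secular lam (c :: behead r) -
   (nth 0 r 0 *: (fun y => (y - a)^-1))); last first.
  by apply/funext => y; rewrite secular_consl.
have xa0 : x - a != 0 by rewrite subr_eq0.
have dV : is_derive x 1 (fun y : R => (y - a)^-1) (- (x - a) ^- 2 *: (1 - 0)).
  exact: is_deriveV.
apply: is_derive_eq.
by rewrite dsecular_cons subr0 /GRing.scale /= mulr1 mulrN opprK.
Qed.

Lemma continuous_dsecular lam r x : x \notin lam ->
  {for x, continuous (dsecular lam r)}.
Proof.
elim: lam r => [|a lam IH] r.
  move=> _; rewrite (_ : dsecular _ _ = cst 1); first exact: cvg_cst.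
  by apply/funext => y; rewrite /dsecular big_ord0 addr0.
rewrite inE negb_or => /andP[xa xlam]; have dIH := IH (behead r) xlam.
rewrite (_ : dsecular (a :: lam) r = fun y => dsecular lam (behead r) y +
   nth 0 r 0 * ((y - a) * (y - a))^-1); last first.
  by apply/funext => y; rewrite dsecular_cons expr2.
have cx : y - a @[y --> x] --> x - a by apply: cvgB; [exact: cvg_id|exact: cvg_cst].
apply: cvgD; first exact: dIH.
apply: cvgM; first exact: cvg_cst.
by apply: cvgV; [rewrite mulf_neq0// subr_eq0|exact: cvgM].
Qed.

Lemma measurable_secular d (X : measurableType d) lam n (G : X -> seq R) (f : X -> T) :
  measurable_seq n G -> measurable_fun setT f ->
  measurable_fun setT (fun p => secular lam (G p) (f p) : T).
Proof.
move=> [_ mG] mf; apply: measurable_funB.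
  by apply: measurable_funB => //; exact: mG.
apply: measurable_sum => i; apply: measurable_funM; first exact: mG.
by apply: measurable_inv; apply: measurable_funB.
Qed.

Lemma measurable_dsecular d (X : measurableType d) lam n (G : X -> seq R) (f : X -> T) :
  measurable_seq n G -> measurable_fun setT f ->
  measurable_fun setT (fun p => dsecular lam (G p) (f p) : T).
Proof.
move=> [_ mG] mf; apply: measurable_funD => //.
apply: measurable_sum => i; apply: measurable_funM; first exact: mG.
by apply: measurable_inv; apply: measurable_funX; apply: measurable_funB.
Qed.

Lemma dsecular_gt0 lam r x : positive_seq r -> size r = size lam -> 0 < dsecular lam r x.
Proof.
move=> /(all_nthP 0) pos sr; rewrite ltr_pwDl// sumr_ge0// => i _.
by rewrite divr_ge0 ?sqr_ge0// ltW// pos// sr.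
Qed.

Lemma dsecular_ge0 lam r x : positive_seq r -> 0 <= dsecular lam r x.
Proof.
move=> /(all_nthP 0) pos; rewrite addr_ge0// sumr_ge0// => i _.
rewrite divr_ge0 ?sqr_ge0//; have [ir|ri] := ltnP i (size r); first exact/ltW/pos.
by rewrite nth_default.
Qed.

Lemma ltr_secular lam c r x y : positive_seq r -> size r = size lam ->
  x < y -> all (fun a => y < a) lam -> secular lam (c :: r) x < secular lam (c :: r) y.
Proof.
move=> /(all_nthP 0) pos sr xy /(all_nthP 0) ylam.
rewrite ltr_leD ?ltrD2r// lerN2 ler_sum// => i _ /=.
have ya := ylam _ (ltn_ord i).
rewrite ler_wpM2l ?(ltW (pos _ _)) ?sr//.
by rewrite ler_nV2 ?unfold_in /= ?subr_lt0 ?ya ?(lt_trans xy)// ?unitfE ?lerD2r ?(ltW xy)//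
  ?subr_eq0 ?lt_eqF ?(lt_trans xy).
Qed.

Variables (l c : R) (lam r : seq R).
Hypotheses (pl : path <%R l lam) (pos : positive_seq r) (sr : size r = size lam).

Let sec := secular lam (c :: r).
Let psi m := (m - l) * sec m.
(** Minus the derivative of m |-> (m - l) * secular lam (c :: r) m, that is, the density of the
    substitution below. *)
Definition secular_weight m := (l - m) * dsecular lam r m - secular lam (c :: r) m.

Let ltl a : a \in lam -> l < a.
Proof. by move=> alam; apply: (allP (path_lt_all pl)). Qed.

Let notin m : m <= l -> m \notin lam.
Proof. by move=> ml; apply/negP => /ltl; rewrite ltNge ml. Qed.

Let dpsi m : m <= l -> is_derive m 1 psi (- secular_weight m).
Proof.
move=> ml; have ds := @is_derive_secular lam c r m (notin ml).
have -> : psi = (fun y => y - l) * sec by [].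
apply: is_derive_eq.
rewrite /secular_weight /GRing.scale /= /sec subr0; ring.
Qed.

(** With c and the residues at [lam] fixed, [m] is a zero of the secular function enlarged by the
    pole [l] exactly when the residue at [l] is (m - l) * secular lam (c :: r) m. This expression
    decreases from +oo to 0 on the admissible m, which exchanges the smallest zero for that
    residue. *)
Lemma secular_subst (g : T -> \bar R) :
  measurable_fun setT g -> (forall x, 0 <= g x)%E ->
  (\int[leb]_m (if (m < l)%R && (secular lam (c :: r) m < 0)%R
     then g ((m - l) * secular lam (c :: r) m)%R * (secular_weight m)%:E else 0) =
  \int[leb]_x (if (0 < x)%R then g x else 0))%E.
Proof.
have incr x y : x < y -> y < l -> sec x < sec y.
  move=> xy yl; apply: ltr_secular => //; apply/allP => a /ltl la.
  exact: lt_trans la.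
have mcr : measurable_seq (size lam).+1 (fun _ : T => c :: r).
  by split => //= _; rewrite sr.
have mr : measurable_seq (size lam) (fun _ : T => r).
  by split.
have msec : measurable_fun setT (sec : T -> T) by exact: (measurable_secular _ mcr).
have dpsi' (x : T) : (x < l) && (sec x < 0) ->
    is_derive (x : R) 1 psi ((-1) ^+ true * secular_weight x).
  by move=> /andP[xl _]; rewrite expr1 mulN1r; apply: dpsi; exact: ltW.
have cw (x : T) : (x < l) && (sec x < 0) -> {for (x : R), continuous secular_weight}.
  move=> /andP[/ltW/notin xl _]; apply: cvgB.
    apply: cvgM; last exact: continuous_dsecular.
    by apply: cvgB; [exact: cvg_cst|exact: cvg_id].
  have ? := @is_derive_secular lam c r x xl.
  apply: differentiable_continuous; apply/derivable1_diffP.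
  exact: ex_derive.
apply: (integral_subst_mono _ _ _ _ dpsi' cw) => //.
- by apply: measurable_and; apply: measurable_fun_ltr.
- by apply: measurable_funM => //; exact: measurable_funB.
- apply: measurable_funB => //; apply: measurable_funM; first exact: measurable_funB.
  exact: (measurable_dsecular _ mr).
- move=> x y z /andP[xl sx] /andP[yl sy] /andP[xz zy].
  rewrite (le_lt_trans zy yl)/= (le_lt_trans _ sy)//.
  by move: zy; rewrite le_eqVlt => /predU1P[->//|zy]; rewrite ltW ?incr.
- move=> x /andP[xl sx]; rewrite /secular_weight addr_ge0 ?oppr_ge0 ?(ltW sx)//.
  by rewrite mulr_ge0 ?subr_ge0 ?(ltW xl)// ltW// dsecular_gt0.
- move=> x y /andP[xl sx] /andP[yl sy] xy; rewrite /psi -mulrNN -[ltRHS]mulrNN.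
  rewrite ltr_pM ?oppr_ge0 ?ltrN2 ?ltrD2r ?incr// ?(ltW sy)//.
  by rewrite subr_le0 ltW.
- by move=> x /andP[xl sx]; rewrite /psi (nmulr_lgt0 _ sx) subr_lt0.
(* [S] bounds the sum of - r_i / (m - lam_i) for m <= l. At [m0] therefore l - m0 >= 1 and sec m0 <=
   - a, so psi m0 >= a, while psi l = 0; the intermediate value theorem applies between them. *)
move=> a a0; pose S := \sum_(i < size lam) nth 0 r i / (nth 0 lam i - l).
pose m0 := Num.min (l - 1) (c - S - a).
have m0l : m0 <= l - 1 by rewrite /m0 ge_min lexx.
have m0l' : m0 < l by rewrite (le_lt_trans m0l)// ltrBlDr ltrDl.
have sm0 : sec m0 <= - a.
  have m0c : m0 <= c - S - a by rewrite /m0 ge_min lexx orbT.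
  have : - \sum_(i < size lam) nth 0 r i / (m0 - nth 0 lam i) <= S.
    rewrite -sumrN ler_sum// => i _.
    have la := ltl (mem_nth 0 (ltn_ord i)).
    have ri : 0 <= nth 0 r i by rewrite ltW// (all_nthP 0 pos)// sr.
    rewrite -mulrN -invrN opprB ler_wpM2l// lef_pV2 ?posrE ?subr_gt0//.
      by rewrite lerD2l lerN2 ltW.
    exact: lt_trans la.
  by rewrite /sec /secular /= => ?; lra.
have am0 : a <= psi m0.
  rewrite /psi -mulrNN; apply: (@le_trans _ _ (1 * a)); first by rewrite mul1r.
  by rewrite ler_pM ?ler01 ?(ltW a0)//; [lra|rewrite lerNr].
have psil : psi l = 0 by rewrite /psi subrr mul0r.
have [||z] := @IVT R psi m0 l a (ltW m0l').
- apply: derivable_within_continuous => z; rewrite in_itv/= => /andP[_ zl].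
  by have ? := dpsi zl; exact: ex_derive.
- by rewrite psil ge_min (ltW a0) orbT/= le_max am0.
rewrite in_itv/= => /andP[_ zl] pz; exists z => //.
have {}zl : z < l.
  by rewrite lt_neqAle zl andbT; apply/eqP => zE; move: a0; rewrite -pz zE psil ltxx.
rewrite zl/=; move: a0; rewrite -pz /psi.
by rewrite nmulr_rgt0// subr_lt0.
Qed.

End secular_analysis.

(** * From borders to interlacing spectra *)

Section measurable_border.
Context (R : realType) d (X : measurableType d).
Local Notation T := (measurableTypeR R).
Implicit Types (lam : seq R) (G : X -> seq R).

Lemma measurable_seq_behead n G : measurable_seq n.+1 G ->
  measurable_seq n (fun x => behead (G x)).
Proof.
move=> [sG mG]; split=> [x|i]; first by rewrite size_behead sG.
by apply: eq_measurable_fun (mG i.+1) => x _; rewrite nth_behead.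
Qed.

Lemma head_behead n G x : measurable_seq n.+1 G ->
  G x = nth 0 (G x) 0 :: behead (G x).
Proof. by move=> [/(_ x)]; case: (G x). Qed.

Lemma measurable_interlace lam G : measurable_seq (size lam).+1 G ->
  measurable_fun setT (fun x => interlace lam (G x)).
Proof.
elim: lam G => [|l lam IH] G mG.
  apply: (eq_measurable_fun (cst true)); last exact: measurable_cst.
  by move=> x _; have := mG.1 x; case: (G x) => [//|? []].
have mb := measurable_seq_behead mG.
apply: (eq_measurable_fun (fun x => [&& nth 0 (G x) 0 < l, l < nth 0 (behead (G x)) 0 &
  interlace lam (behead (G x))])).
  by move=> x _; rewrite [in RHS](head_behead x mG)/= nth0.
apply: measurable_and; first by apply: measurable_fun_ltr => //; exact: mG.2.
apply: measurable_and; last exact: IH.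
by apply: measurable_fun_ltr => //; exact: mb.2.
Qed.

Lemma measurable_border lam G : measurable_seq (size lam).+1 G ->
  measurable_seq (size lam).+1 (fun x => border lam (G x)).
Proof.
elim: lam G => [|l lam IH] G mG.
  split=> [x|[|i]]; first by [].
    by apply: eq_measurable_fun (mG.2 0) => x _ /=; rewrite nth0.
  by apply: eq_measurable_fun (@measurable_cst _ _ _ _ _ (0 : T)) => x _ /=; rewrite nth_nil.
have mb := measurable_seq_behead mG; have mIH := IH _ mb.
have mm := mG.2 0.
have H : measurable_seq (size lam).+2 (fun x => let cr := border lam (behead (G x)) in
    let m := nth 0 (G x) 0 in
    [:: nth 0 cr 0 + m - l, (m - l) * secular lam cr l &
        mkseq (fun i => nth 0 cr i.+1 * (nth 0 lam i - m) / (nth 0 lam i - l))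
          (size lam)]).
  apply: measurable_seq_cons.
    by apply: measurable_funB => //; apply: measurable_funD => //; exact: mIH.2.
  apply: measurable_seq_cons.
    apply: measurable_funM; first exact: measurable_funB.
    exact: (measurable_secular lam mIH).
  apply: measurable_seq_mkseq => i; apply: measurable_funM => //.
  by apply: measurable_funM; [exact: mIH.2|exact: measurable_funB].
split=> [x|i]; first by rewrite size_border ?mG.1.
by apply: eq_measurable_fun (H.2 i) => x _; rewrite [in RHS](head_behead x mG).
Qed.

Lemma measurable_vand n G : measurable_seq n G ->
  measurable_fun setT (fun x => vand (G x) : T).
Proof.
elim: n G => [|n IH] G mG.
  apply: eq_measurable_fun (@measurable_cst _ _ _ _ _ (1 : T)) => x _.
  by rewrite (size0nil (mG.1 x)).
have mb := measurable_seq_behead mG.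
apply: (eq_measurable_fun (fun x => \prod_(0 <= i < n)
   (nth 0 (behead (G x)) i - nth 0 (G x) 0) * vand (behead (G x)) : T)).
  by move=> x _; rewrite [in RHS](head_behead x mG)/= [X in _ = X * _](big_nth 0) mb.1.
apply: measurable_funM; last exact: IH.
by apply: measurable_prod => i _; apply: measurable_funB; [exact: mb.2|exact: mG.2].
Qed.

Lemma measurable_border_jac lam n G : measurable_seq n G ->
  measurable_fun setT (fun x => border_jac lam (G x) : T).
Proof. by move=> mG; apply: measurable_funM => //; exact: measurable_vand mG. Qed.

End measurable_border.

Section border_substitution.
Context (R : realType).
Local Notation T := (measurableTypeR R).
Local Notation leb := (@lebesgue_measure R).
Local Open Scope ereal_scope.

(** Makes the residue at the smallest pole, stored just after the corner c, the innermost variable,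
    ready for [secular_subst]. *)
Lemma tint_insert n (F : seq R -> \bar R) : tmeasurable n.+2 F -> (forall s, 0 <= F s) ->
  tint n.+2 F = tint n.+1 (fun s => \int[leb]_x F [:: nth 0%R s 0, x & behead s]).
Proof.
move=> mF F0.
have mF3 : measurable_fun setT (fun p : n.+1.-tuple T * T =>
    F [:: nth 0%R p.1 0, p.2 & behead p.1]).
  apply: (measurable_comp_seq mF).
  have m1 := measurable_seq_tval (@measurable_fst _ _ (n.+1.-tuple T) T).
  apply: measurable_seq_cons; first exact: m1.2.
  by apply: measurable_seq_cons => //; exact: measurable_seq_behead.
rewrite (tintS mF F0) [RHS]tintS; first last.
- by move=> s; exact: integral_ge0.
- by have := @measurable_fun_fubini_tonelli_F _ _ _ _ _ leb
    (fun p : n.+1.-tuple T * T => F [:: nth 0%R p.1 0, p.2 & behead p.1]); apply.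
apply: eq_integral => c _ /=.
rewrite -(@tint_exchange _ n _ _ leb (fun (x : T) s => F [:: c, x & s]))//; last first.
  by apply: (measurable_comp_seq mF); apply: measurable_seq_cons => //;
    apply: measurable_seq_cons => //; exact: measurable_seq_tval.
rewrite tintS//.
exact: (@tmeasurable_section R n.+1 _ T (fun (x : T) s => F (x :: s)) c (tmeasurableS mF)).
Qed.

(** For a fixed smallest zero m, the induction hypothesis replaces the other zeros by the
    coefficients of the smaller problem, and a diagonal affine map turns these into c and the
    residues at [lam] of the larger one. Tonelli then puts m innermost, where [secular_subst]
    produces the residue at [l]. *)
Lemma tint_border lam (g : seq R -> \bar R) : sorted <%R lam ->
  tmeasurable (size lam).+1 g -> (forall s, 0 <= g s) ->
  tint (size lam).+1 (fun mu => if interlace lam mu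
    then g (border lam mu) * (border_jac lam mu)%:E else 0) =
  tint (size lam).+1 (fun cr => if positive_seq (behead cr) then g cr else 0).
Proof.
elim: lam g => [|l lam IH] g sl mg g0.
  apply: eq_tint => -[|m []]//= _; by rewrite /border_jac /= big_nil mulr1 divr1 mule1.
have ltl := path_lt_all sl; have sl' := path_sorted sl.
set n := size lam.
pose w (m : R) (cr : seq R) : R :=
  secular_weight l (nth 0%R cr 0) lam (behead cr) m.
pose H (m : T) (cr : seq R) : \bar R :=
  if [&& m < l, positive_seq (behead cr) & secular lam cr m < 0]%R
  then g [:: nth 0%R cr 0, ((m - l) * secular lam cr m)%R & behead cr] * (w m cr)%:E
  else 0.
have H0 m cr : 0 <= H m cr.
  rewrite /H; case: ifP => // /and3P[ml pr sn]; rewrite mule_ge0// lee_fin.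
  rewrite /w /secular_weight addr_ge0//; last first.
    rewrite oppr_ge0 ltW//; move: sn; rewrite /secular /=.
    by under eq_bigr do rewrite -nth_behead.
  by rewrite mulr_ge0 ?subr_ge0 ?(ltW ml)// dsecular_ge0.
have mH : measurable_fun setT (fun p : T * n.+1.-tuple T => H p.1 p.2).
  have m2 := measurable_seq_tval (@measurable_snd _ _ T (n.+1.-tuple T)).
  have mb := measurable_seq_behead m2.
  have ms := measurable_secular lam m2 (@measurable_fst _ _ T (n.+1.-tuple T)).
  have ms' := measurable_secular lam (measurable_seq_cons (m2.2 0%N) mb)
    (@measurable_fst _ _ T (n.+1.-tuple T)).
  have md := measurable_dsecular lam mb (@measurable_fst _ _ T (n.+1.-tuple T)).
  have ml : measurable_fun setT (fun p : T * n.+1.-tuple T => p.1 - l : T)%R.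
    exact: measurable_funB.
  have ml' : measurable_fun setT (fun p : T * n.+1.-tuple T => l - p.1 : T)%R.
    exact: measurable_funB.
  apply: measurable_fun_ifT => //.
    apply: measurable_and; first exact: measurable_fun_ltr.
    apply: measurable_and; first exact: measurable_positive_seq mb.
    exact: measurable_fun_ltr.
  apply: emeasurable_funM.
    apply: (measurable_comp_seq mg); apply: measurable_seq_cons; first exact: m2.2.
    by apply: measurable_seq_cons => //; exact: measurable_funM.
  apply/measurable_EFinP; apply: measurable_funB; last exact: ms'.
  exact: measurable_funM.
have main m : tint n.+1 (fun mu => if interlace (l :: lam) (m :: mu)
    then g (border (l :: lam) (m :: mu)) * (border_jac (l :: lam) (m :: mu))%:E else 0) =
  tint n.+1 (H m).
  case: (ltP m l) => ml; last first.
    rewrite [LHS]integral0_eq; last by move=> mu _ /=; rewrite ltNge ml.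
    by rewrite [RHS]integral0_eq// => cr _ /=; rewrite /H ltNge ml.
  have plm : path <%R m lam.
    by case: (lam) sl => //= a s /andP[la ->]; rewrite (lt_trans ml la).
  pose P := (\prod_(a <- lam) ((a - m) / (a - l)))%R.
  have P0 : (0 < P)%R.
    rewrite /P big_seq prodr_gt0// => a /(allP ltl) la.
    by rewrite divr_gt0 ?subr_gt0// (lt_trans ml).
  (* The integrand in terms of the coefficients of the smaller problem: the test stands for l < head
     0 mu, and the last factor is the one supplied by [border_jac_cons]. *)
  pose gm cr := if (secular lam cr l < 0)%R then
    g [:: nth 0 cr 0 + m - l, (m - l) * secular lam cr l &
        mkseq (fun i => nth 0 cr i.+1 * (nth 0 lam i - m) / (nth 0 lam i - l))
          (size lam)]%R * (`|secular lam cr m| * P)%R%:E else 0.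
  have gm0 cr : 0 <= gm cr.
    by rewrite /gm; case: ifP => // _; rewrite mule_ge0// lee_fin mulr_ge0// ltW.
  have mgm : tmeasurable n.+1 gm.
    have m2 := measurable_seq_tval (@measurable_id _ (n.+1.-tuple T) setT).
    have ms x : measurable_fun setT (fun cr : n.+1.-tuple T => secular lam cr x : T).
      exact: (measurable_secular lam m2).
    apply: measurable_fun_ifT => //; first by apply: measurable_fun_ltr => //; exact: ms.
    apply: emeasurable_funM.
      apply: (measurable_comp_seq mg); apply: measurable_seq_cons.
        by apply: measurable_funB => //; apply: measurable_funD => //; exact: m2.2.
      apply: measurable_seq_cons; first by apply: measurable_funM => //; exact: ms.
      apply: measurable_seq_mkseq => i; apply: measurable_funM => //.
      by apply: measurable_funM => //; exact: m2.2.
    apply/measurable_EFinP; apply: measurable_funM => //.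
    by apply: (measurableT_comp (@normr_measurable _ setT)); exact: ms.
  transitivity (tint n.+1 (fun mu => if interlace lam mu
      then gm (border lam mu) * (border_jac lam mu)%:E else 0)).
    apply: eq_tint => mu smu /=; rewrite ml /=; case im: (interlace lam mu); last by rewrite andbF.
    rewrite andbT /gm secular_border_lt0//; case: ifP => lm; last by rewrite mul0e.
    rewrite border_jac_cons// -muleA -EFinM ltr0_norm//.
    by rewrite secular_border_lt0// (lt_trans ml).
  rewrite IH//.
  (* Inverse of the affine map in [border], which sends c to c + m - l and r_i to r_i (lam_i - m) /
     (lam_i - l). *)
  pose k i : R := if i is i'.+1 then ((nth 0 lam i' - l) / (nth 0 lam i' - m))%R else 1%R.
  pose a i : R := if i is i'.+1 then 0%R else (l - m)%R.
  have nthl i : (i < n)%N -> (l < nth 0 lam i)%R.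
    by move=> lin; apply: (allP ltl); exact: mem_nth.
  have k0 i : (i < n.+1)%N -> (0 < k i)%R.
    case: i => [//|i] /nthl li.
    by rewrite /k divr_gt0 ?subr_gt0// (lt_trans ml).
  have mF : tmeasurable n.+1 (fun cr => if positive_seq (behead cr) then gm cr else 0).
    apply: measurable_fun_ifT => //; apply: (measurable_positive_seq (n := n)).
    by apply: measurable_seq_behead; exact: measurable_seq_tval.
  rewrite (@tint_affine _ k a)//; first last.
  - by move=> cr; case: ifP.
  - by move=> i /k0 ki; rewrite gt_eqF.
  rewrite -tintZ; first last.
  - by rewrite lee_fin prodr_ge0.
  - by move=> cr; case: ifP.
  - exact: tmeasurable_affine mF.
  apply: eq_tint => -[|c r] // [sr].
  rewrite affine_seq_cons /= mul1r.
  set r' := affine_seq _ _ _ _.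
  have r'E i : (i < n)%N -> nth 0%R r' i =
      (nth 0 r i * ((nth 0 lam i - l) / (nth 0 lam i - m)))%R.
    by move=> lin; rewrite nth_mkseq//= addr0 mulrC.
  have sr' : size r' = n by rewrite size_mkseq.
  have -> : positive_seq r' = positive_seq r.
    apply/(all_nthP 0%R)/(all_nthP 0%R) => pr i; rewrite ?sr ?sr' => lin.
      have := pr i; rewrite sr' r'E// pmulr_lgt0; first exact.
      exact: (k0 i.+1).
    by rewrite r'E// mulr_gt0 ?pr ?sr//; exact: (k0 i.+1).
  rewrite /H ml /=; case: ifP => pr; last by rewrite mule0.
  have nz i : (i < n)%N -> (nth 0 lam i - l != 0)%R /\ (nth 0 lam i - m != 0)%R.
    by move=> /nthl li; rewrite !gt_eqF ?subr_gt0// (lt_trans ml).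
  (* In the new coefficients the sign condition at [l] becomes one at [m], and the Jacobian factor
     at [m] becomes [secular_weight]. *)
  have secl : secular lam (c + (l - m) :: r')%R l = secular lam (c :: r) m.
    rewrite /secular /=.
    have -> : (\sum_(i < size lam) nth 0 r' i / (l - nth 0 lam i) =
               \sum_(i < size lam) nth 0 r i / (m - nth 0 lam i))%R.
      apply: eq_bigr => i _; rewrite r'E//; have [z1 z2] := nz i (ltn_ord i).
      by field; rewrite -opprB oppr_eq0 z2 -opprB oppr_eq0 z1.
    by ring.
  have secm : (- secular lam (c + (l - m) :: r') m = secular_weight l c lam r m)%R.
    rewrite /secular_weight /dsecular /secular /= mulrDr mulr_sumr.
    have -> : (\sum_(i < size lam) nth 0 r' i / (m - nth 0 lam i) =
      \sum_(i < size lam) (l - m) * (nth 0 r i / (m - nth 0 lam i) ^+ 2) +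
      \sum_(i < size lam) nth 0 r i / (m - nth 0 lam i))%R.
      rewrite -big_split; apply: eq_bigr => i _ /=; rewrite r'E//.
      have [z1 z2] := nz i (ltn_ord i).
      by field; rewrite -opprB oppr_eq0 z2.
    by ring.
  rewrite /gm secl; case: ifP => sn; last by rewrite mule0.
  rewrite muleCA -EFinM; congr (g _ * _%:E).
    congr [:: _, _ & _]; first by rewrite /=; ring.
    apply: (@eq_from_nth _ 0%R); rewrite size_mkseq ?sr// => i lin.
    rewrite nth_mkseq//= r'E//; have [z1 z2] := nz i lin.
    by field; rewrite z2 z1.
  have w0 : (0 <= secular_weight l c lam r m)%R.
    rewrite /secular_weight addr_ge0 ?oppr_ge0 ?(ltW sn)//.
    by rewrite mulr_ge0 ?subr_ge0 ?(ltW ml)// dsecular_ge0.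
  rewrite ler0_norm ?secm; last by rewrite -oppr_ge0 secm.
  (* The determinant of the affine map cancels [P]. *)
  rewrite mulrCA [X in (_ * X)%R](_ : _ = 1%R) ?mulr1//.
  rewrite big_ord_recl normr1 mul1r /P (big_nth 0%R) big_mkord -big_split big1//= => i _.
  rewrite ger0_norm; last exact: ltW (k0 i.+1 (ltn_ord i)).
  rewrite /k /=; have [z1 z2] := nz i (ltn_ord i).
  by field; rewrite z1 z2.
rewrite [LHS]tintS; first last.
- move=> mu; case: ifP => // im; rewrite mule_ge0// lee_fin.
  by rewrite border_jac_ge0.
- have m2 := measurable_seq_tval (@measurable_id _ (n.+2.-tuple T) setT).
  apply: measurable_fun_ifT => //; first exact: (@measurable_interlace _ _ _ (l :: lam) _ m2).
  apply: emeasurable_funM.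
    apply: (measurable_comp_seq mg); exact: (@measurable_border _ _ _ (l :: lam) _ m2).
  by apply/measurable_EFinP; exact: measurable_border_jac m2.
under eq_integral do rewrite main.
rewrite (@tint_exchange _ _ _ _ leb H)//.
rewrite tint_insert; first last.
- by move=> s; case: ifP.
- apply: measurable_fun_ifT => //; apply: (measurable_positive_seq (n := n.+1)).
  by apply: measurable_seq_behead; exact: measurable_seq_tval.
apply: eq_tint => -[|c r]//= [sr].
case pr : (positive_seq r); last first.
  rewrite [LHS]integral0_eq; last by move=> m _; rewrite /H /= pr andbF.
  by rewrite [RHS]integral0_eq// => x _; rewrite andbF.
under [RHS]eq_integral do rewrite andbT.
have mgx : measurable_fun setT (fun x : T => g [:: c, x & r]).
  apply: (measurable_comp_seq mg); apply: measurable_seq_cons => //.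
  by apply: measurable_seq_cons => //; split => //= _.
rewrite -[RHS](@secular_subst _ l c lam r sl pr sr (fun x => g [:: c, x & r]))//.
by apply: eq_integral => m _; rewrite /H /= pr.
Qed.

End border_substitution.

(** * Hermitian matrices over the base algebra *)

Section base_algebra_theory.
Context (R : realType) (K : base_algebra).
Local Notation KR := (base_ring R K).
Implicit Types (x y z : KR) (r s : R).

Definition base_re x : R := nth 0 (base_coords x) 0.
Definition base_nsq x : R := \sum_(c <- base_coords x) c ^+ 2.

Lemma base_conjD x y : base_conj (x + y) = base_conj x + base_conj y.
Proof.
rewrite /base_conj; move: x y; rewrite /base_ring.
case: K => [//|[a b] [a' b']|[a b c e] [a' b' c' e']].
  by apply/eqP; rewrite eq_complex /= eqxx opprD eqxx.
by rewrite /quat_conj /= !opprD.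
Qed.

Lemma base_conjM x y : base_conj (x * y) = base_conj y * base_conj x.
Proof.
rewrite /base_conj; move: x y; rewrite /base_ring.
case: K => [x y|[a b] [a' b']|[a b c e] [a' b' c' e']]; first by rewrite mulrC.
  by apply/eqP; rewrite eq_complex /=; apply/andP; split; apply/eqP; ring.
by congr Quat; rewrite /=; ring.
Qed.

Lemma base_conjK x : base_conj (base_conj x) = x.
Proof.
rewrite /base_conj; move: x; rewrite /base_ring.
by case: K => [//|[a b] /=|[a b c e]]; rewrite /quat_conj /= !opprK.
Qed.

Lemma base_conj_real r : base_conj (base_real K r) = base_real K r.
Proof.
rewrite /base_real /base_conj /base_of_coords.
by case: K; rewrite //= /quat_conj /= !oppr0.
Qed.

Lemma base_realD r s : base_real K (r + s) = base_real K r + base_real K s.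
Proof.
rewrite /base_real /base_of_coords /base_ring; case: K => //=.
  by apply/eqP; rewrite eq_complex /= addr0 !eqxx.
by rewrite /GRing.add /= /quat_add /= !addr0.
Qed.

Lemma base_realM r s : base_real K (r * s) = base_real K r * base_real K s.
Proof.
rewrite /base_real /base_of_coords /base_ring; case: K => //=.
  by apply/eqP; rewrite eq_complex /= !(mulr0, mul0r, subr0, addr0) !eqxx.
by congr Quat; rewrite /=; ring.
Qed.

Lemma base_real0 : base_real K 0 = 0 :> KR.
Proof. by rewrite /base_real /base_of_coords /base_ring; case: K. Qed.

Lemma base_real1 : base_real K 1 = 1 :> KR.
Proof. by rewrite /base_real /base_of_coords /base_ring; case: K. Qed.

Lemma base_realC r x : base_real K r * x = x * base_real K r.
Proof.
move: x; rewrite /base_real /base_of_coords /base_ring.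
case: K => [x|x|[a b c e]] /=; [by rewrite mulrC|by rewrite mulrC|].
by congr Quat; rewrite /=; ring.
Qed.

Lemma base_re_real r : base_re (base_real K r) = r.
Proof. by rewrite /base_re /base_real base_of_coordsK// base_dim_gt0. Qed.

Lemma base_reD x y : base_re (x + y) = base_re x + base_re y.
Proof.
move: x y; rewrite /base_re /base_coords /base_ring.
by case: K => [//|[a b] [a' b']|[a b c e] [a' b' c' e']].
Qed.

Lemma base_re_realM r x : base_re (base_real K r * x) = r * base_re x.
Proof.
move: x; rewrite /base_re /base_coords /base_real /base_of_coords /base_ring.
by case: K => [//|[a b]|[a b c e]]; rewrite /= !mul0r ?subr0.
Qed.

Lemma base_reC x y : base_re (x * y) = base_re (y * x).
Proof.
move: x y; rewrite /base_re /base_coords /base_ring.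
case: K => [x y|[a b] [a' b']|[a b c e] [a' b' c' e']] /=; first by rewrite mulrC.
  by ring.
by ring.
Qed.

Lemma base_re_conj x : base_re (base_conj x) = base_re x.
Proof.
move: x; rewrite /base_re /base_coords /base_conj /base_ring.
by case: K => [//|[a b]|[]].
Qed.

Lemma base_conj_mul x : base_conj x * x = base_real K (base_nsq x).
Proof.
move: x; rewrite /base_nsq /base_coords /base_conj /base_real /base_of_coords /base_ring.
case: K => [x|[a b]|[a b c e]]; rewrite ?big_cons big_nil ?addr0 /=.
- by rewrite expr2.
- by apply/eqP; rewrite eq_complex /=; apply/andP; split; apply/eqP; ring.
- by congr Quat; rewrite /=; ring.
Qed.

Lemma base_nsq_conj x : base_nsq (base_conj x) = base_nsq x.
Proof.
move: x; rewrite /base_nsq /base_coords /base_conj /base_ring.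
by case: K => [//|[a b]|[a b c e]]; rewrite ?big_cons big_nil ?sqrrN.
Qed.

Lemma base_mul_conj x : x * base_conj x = base_real K (base_nsq x).
Proof. by rewrite -base_nsq_conj -base_conj_mul base_conjK. Qed.

Lemma base_nsq_ge0 x : 0 <= base_nsq x.
Proof. by rewrite /base_nsq sumr_ge0// => c _; exact: sqr_ge0. Qed.

Lemma base_nsq_eq0 x : base_nsq x = 0 -> x = 0.
Proof.
move: x; rewrite /base_nsq /base_coords /base_ring.
case: K => [x|[a b]|[a b c e]]; rewrite ?big_cons big_nil ?addr0 /=.
- by move/eqP; rewrite sqrf_eq0 => /eqP.
- by move/eqP; rewrite paddr_eq0 ?sqr_ge0// !sqrf_eq0 => /andP[/eqP-> /eqP->].
- move/eqP; rewrite !paddr_eq0 ?addr_ge0 ?sqr_ge0// !sqrf_eq0.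
  by move=> /and4P[/eqP-> /eqP-> /eqP-> /eqP->].
Qed.

Lemma base_nsq_gt0 x : x != 0 -> 0 < base_nsq x.
Proof.
move=> x0; rewrite lt_neqAle base_nsq_ge0 andbT eq_sym.
by apply: contraNneq x0 => /base_nsq_eq0 ->.
Qed.

Lemma base_realN r : base_real K (- r) = - base_real K r.
Proof. by apply/eqP; rewrite -addr_eq0 -base_realD addNr base_real0. Qed.

Lemma base_real_inj : injective (base_real K : R -> KR).
Proof. by move=> r s /(congr1 base_re); rewrite !base_re_real. Qed.

Lemma base_conj0 : base_conj 0 = 0 :> KR.
Proof. by rewrite -base_real0 base_conj_real. Qed.

Lemma base_conj1 : base_conj 1 = 1 :> KR.
Proof. by rewrite -base_real1 base_conj_real. Qed.

Lemma base_re0 : base_re 0 = 0.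
Proof. by rewrite -base_real0 base_re_real. Qed.

Lemma base_nsq_re x : base_nsq x = base_re (base_conj x * x).
Proof. by rewrite base_conj_mul base_re_real. Qed.

Lemma base_nsqM x y : base_nsq (x * y) = base_nsq x * base_nsq y.
Proof.
apply: base_real_inj; rewrite -base_conj_mul base_conjM base_realM.
rewrite -mulrA [base_conj x * _]mulrA base_conj_mul base_realC mulrA base_conj_mul.
by rewrite base_realC.
Qed.

Lemma base_nsq_real r : base_nsq (base_real K r) = r ^+ 2.
Proof.
by apply: base_real_inj; rewrite -base_conj_mul base_conj_real -base_realM expr2.
Qed.

Lemma base_nsq0 : base_nsq (0 : KR) = 0.
Proof. by rewrite -base_real0 base_nsq_real expr0n. Qed.

Definition base_inv x : KR := base_conj x * base_real K (base_nsq x)^-1.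

Lemma base_mulV x : x != 0 -> x * base_inv x = 1.
Proof.
move=> x0; rewrite mulrA base_mul_conj -base_realM mulfV ?base_real1//.
by rewrite gt_eqF// base_nsq_gt0.
Qed.

Lemma base_conj_sum I (t : seq I) (P : pred I) (F : I -> KR) :
  base_conj (\sum_(i <- t | P i) F i) = \sum_(i <- t | P i) base_conj (F i).
Proof. exact: (big_morph _ base_conjD base_conj0). Qed.

Lemma base_re_sum I (t : seq I) (P : pred I) (F : I -> KR) :
  base_re (\sum_(i <- t | P i) F i) = \sum_(i <- t | P i) base_re (F i).
Proof. exact: (big_morph _ base_reD base_re0). Qed.

Lemma base_real_sum I (t : seq I) (P : pred I) (F : I -> R) :
  base_real K (\sum_(i <- t | P i) F i) = \sum_(i <- t | P i) base_real K (F i).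
Proof. exact: (big_morph _ base_realD base_real0). Qed.

End base_algebra_theory.

Section adjoint_theory.
Context (R : realType) (K : base_algebra).
Local Notation KR := (base_ring R K).

Lemma adjoint_mxE m n (A : 'M[KR]_(m, n)) i j : adjoint_mx A i j = base_conj (A j i).
Proof. by rewrite !mxE. Qed.

Lemma adjoint_mxK m n (A : 'M[KR]_(m, n)) : adjoint_mx (adjoint_mx A) = A.
Proof. by apply/matrixP => i j; rewrite !adjoint_mxE base_conjK. Qed.

Lemma adjoint_mxM m n p (A : 'M[KR]_(m, n)) (B : 'M[KR]_(n, p)) :
  adjoint_mx (A *m B) = adjoint_mx B *m adjoint_mx A.
Proof.
apply/matrixP => i j; rewrite !mxE base_conj_sum.
by apply: eq_bigr => k _; rewrite !mxE base_conjM.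
Qed.

Lemma adjoint_mx1 n : adjoint_mx 1%:M = 1%:M :> 'M[KR]_n.
Proof.
apply/matrixP => i j; rewrite !mxE eq_sym.
by case: eqP; rewrite ?base_conj1 ?base_conj0.
Qed.

Definition real_diag n (s : 'I_n -> R) : 'M[KR]_n := diag_mx (\row_i base_real K (s i)).

Lemma real_diagE n (s : 'I_n -> R) i j :
  real_diag s i j = if i == j then base_real K (s i) else 0.
Proof.
by rewrite !mxE; case: eqVneq => [->|]; rewrite ?mulr1n ?mulr0n.
Qed.

Lemma adjoint_real_diag n (s : 'I_n -> R) : adjoint_mx (real_diag s) = real_diag s.
Proof.
apply/matrixP => i j; rewrite adjoint_mxE !real_diagE eq_sym.
by case: eqVneq => [->|_]; rewrite ?base_conj_real ?base_conj0.
Qed.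

Definition vec_nsq n (x : 'cV[KR]_n) : R := \sum_i base_nsq (x i 0).

Lemma vec_nsqE n (x : 'cV[KR]_n) : (adjoint_mx x *m x) 0 0 = base_real K (vec_nsq x).
Proof.
rewrite !mxE /vec_nsq base_real_sum; apply: eq_bigr => i _.
by rewrite !mxE base_conj_mul.
Qed.

Lemma vec_nsq_ge0 n (x : 'cV[KR]_n) : 0 <= vec_nsq x.
Proof. by rewrite /vec_nsq sumr_ge0// => i _; exact: base_nsq_ge0. Qed.

Lemma vec_nsq_eq0 n (x : 'cV[KR]_n) : vec_nsq x = 0 -> x = 0.
Proof.
move=> /eqP; rewrite psumr_eq0; last by move=> i _; exact: base_nsq_ge0.
move=> /allP x0; apply/colP => i; rewrite mxE; apply: base_nsq_eq0; apply/eqP.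
by apply: (x0 i); rewrite mem_index_enum.
Qed.

End adjoint_theory.

(** * Linear systems and orthonormal families over K *)

Section linear_systems.
Context (R : realType) (K : base_algebra).
Local Notation KR := (base_ring R K).

(** Elimination with one pivot, written with the inverse between the two factors because K need not
    commute. All dimension counts below come from this lemma. *)
Lemma underdetermined m n (A : 'M[KR]_(m, n)) : (m < n)%N ->
  exists2 x : 'cV[KR]_n, x != 0 & A *m x = 0.
Proof.
elim: m n A => [|m IH] n A mn.
  case: n A mn => // n A _; exists (const_mx 1).
    by apply/eqP => /colP/(_ 0)/eqP; rewrite !mxE oner_eq0.
  by apply/matrixP => -[].
case: n A mn => // n A mn.
have [A0|] := boolP [forall j, A 0 j == 0].
  pose B : 'M[KR]_(m, n.+1) := \matrix_(i, j) A (lift 0 i) j.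
  have [x x0 Bx] := IH _ B (ltnW mn); exists x => //.
  apply/colP => i; rewrite !mxE; case: (unliftP 0 i) => [k|] ->.
    move/colP: Bx => /(_ k); rewrite !mxE => Bx; rewrite -[RHS]Bx.
    by apply: eq_bigr => j _; rewrite mxE.
  by rewrite big1// => j _; rewrite (eqP (forallP A0 j)) mul0r.
rewrite negb_forall => /existsP[j Aj].
have AV := base_mulV Aj; set v := base_inv (A 0 j) in AV.
pose B : 'M[KR]_(m, n) := \matrix_(i, k)
  (A (lift 0 i) (lift j k) - A (lift 0 i) j * v * A 0 (lift j k)).
have [y y0 By] := IH _ B mn.
pose t := \sum_k A 0 (lift j k) * y k 0.
pose x : 'cV[KR]_n.+1 := \col_i if unlift j i is Some k then y k 0 else - (v * t).
have xj : x j 0 = - (v * t) by rewrite mxE unlift_none.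
have xl k : x (lift j k) 0 = y k 0 by rewrite mxE liftK.
exists x.
  apply: contraNneq y0 => x0; apply/eqP/colP => k.
  by rewrite -xl x0 !mxE.
apply/colP => i; rewrite !mxE (bigD1_ord j)//= xj.
under eq_bigr do rewrite xl.
case: (unliftP 0 i) => [k|] ->; last by rewrite mulrN mulrA AV mul1r addNr.
move/colP: By => /(_ k); rewrite !mxE => By.
rewrite -[RHS]By.
under [RHS]eq_bigr do rewrite mxE mulrBl.
rewrite sumrB addrC; congr (_ + _).
by rewrite mulrN mulrA /t mulr_sumr; congr (- _); apply: eq_bigr => l _; rewrite mulrA.
Qed.

Definition orthonormal_cols m n (X : 'M[KR]_(m, n)) := adjoint_mx X *m X = 1%:M.

Lemma orthonormal_mulmx m n (X : 'M[KR]_(m, n)) p (x : 'M[KR]_(n, p)) :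
  orthonormal_cols X -> adjoint_mx X *m (X *m x) = x.
Proof. by move=> oX; rewrite mulmxA oX mul1mx. Qed.

Lemma orthonormal_leq m n (X : 'M[KR]_(m, n)) : orthonormal_cols X -> (n <= m)%N.
Proof.
move=> oX; rewrite leqNgt; apply/negP => /(underdetermined X)[x x0 Xx].
by move: x0; rewrite -(orthonormal_mulmx x oX) Xx mulmx0 eqxx.
Qed.

Lemma mx_eq0_mulP m n (P : 'M[KR]_(m, n)) :
  (forall y : 'cV[KR]_n, P *m y = 0) -> P = 0.
Proof.
move=> P0; apply/matrixP => i j; have /colP/(_ i) := P0 (delta_mx j 0).
rewrite !mxE (bigD1 j)//= big1 ?addr0; last first.
  by move=> k kj; rewrite mxE (negbTE kj) mulr0.
by rewrite mxE !eqxx mulr1.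
Qed.

Definition real_scale m n (r : R) (x : 'M[KR]_(m, n)) : 'M[KR]_(m, n) :=
  map_mx ( *%R (base_real K r)) x.

Lemma mulmx_real_scale m n p (A : 'M[KR]_(m, n)) r (x : 'M[KR]_(n, p)) :
  A *m real_scale r x = real_scale r (A *m x).
Proof.
apply/matrixP => i j; rewrite !mxE mulr_sumr; apply: eq_bigr => k _.
by rewrite mxE !mulrA base_realC.
Qed.

Lemma real_scaleA m n r s (x : 'M[KR]_(m, n)) :
  real_scale r (real_scale s x) = real_scale (r * s) x.
Proof. by apply/matrixP => i j; rewrite !mxE mulrA -base_realM. Qed.

Lemma vec_nsq_real_scale n r (x : 'cV[KR]_n) :
  vec_nsq (real_scale r x) = r ^+ 2 * vec_nsq x.
Proof.
rewrite /vec_nsq mulr_sumr; by apply: eq_bigr => i _; rewrite mxE base_nsqM base_nsq_real.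
Qed.

Lemma normalize n (x : 'cV[KR]_n) : x != 0 ->
  exists2 r : R, r != 0 & adjoint_mx (real_scale r x) *m real_scale r x = 1%:M.
Proof.
move=> x0; have n0 : 0 < vec_nsq x.
  rewrite lt_neqAle vec_nsq_ge0 andbT eq_sym.
  by apply: contraNneq x0 => /vec_nsq_eq0 ->.
exists (Num.sqrt (vec_nsq x))^-1; first by rewrite invr_eq0 gt_eqF// sqrtr_gt0.
apply/matrixP => i j; rewrite !ord1 vec_nsqE vec_nsq_real_scale !mxE eqxx.
by rewrite exprVn sqr_sqrtr ?(ltW n0)// mulVf ?gt_eqF// base_real1.
Qed.

Lemma orthonormal_row_mx m n (X : 'M[KR]_(m, n)) (z : 'cV[KR]_m) :
  orthonormal_cols X -> orthonormal_cols z -> adjoint_mx X *m z = 0 -> orthonormal_cols (row_mx X z).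
Proof.
move=> oX oz Xz; have zX : adjoint_mx z *m X = 0.
  rewrite -[LHS]adjoint_mxK adjoint_mxM adjoint_mxK Xz.
  by apply/matrixP => i j; rewrite !mxE base_conj0.
rewrite /orthonormal_cols (_ : adjoint_mx (row_mx X z) = col_mx (adjoint_mx X) (adjoint_mx z)).
  by rewrite mul_col_row oX oz Xz zX -scalar_mx_block.
by rewrite /adjoint_mx tr_row_mx map_col_mx.
Qed.

(** A nonzero vector in the range of 1 - X X^* is orthogonal to the columns of X; normalized, it
    would extend them to n + 1 orthonormal columns of length n. *)
Lemma orthonormal_square n (X : 'M[KR]_n) : orthonormal_cols X -> X *m adjoint_mx X = 1%:M.
Proof.
move=> oX; apply/eqP; rewrite -subr_eq0; apply/eqP/mx_eq0_mulP => y.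
apply/eqP; apply: contraT => z0; set z := _ *m y in z0.
have Xz : adjoint_mx X *m z = 0.
  by rewrite /z mulmxA mulmxBr mulmx1 mulmxA oX mul1mx subrr mul0mx.
have [r r0 oz] := normalize z0.
have : orthonormal_cols (row_mx X (real_scale r z)).
  apply: orthonormal_row_mx => //; rewrite mulmx_real_scale Xz.
  by apply/matrixP => i j; rewrite !mxE mulr0.
by move/orthonormal_leq; rewrite addn1 ltnn.
Qed.

Lemma orthonormal_complement m n (X : 'M[KR]_(m, n)) : orthonormal_cols X ->
  exists Y : 'M[KR]_(m, m - n),
    [/\ orthonormal_cols Y, adjoint_mx X *m Y = 0 &
        X *m adjoint_mx X + Y *m adjoint_mx Y = 1%:M].
Proof.
move=> oX; have nm := orthonormal_leq oX.
have EX k (Y : 'M[KR]_(m, k)) :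
    adjoint_mx (row_mx X Y) = col_mx (adjoint_mx X) (adjoint_mx Y).
  by rewrite /adjoint_mx tr_row_mx map_col_mx.
have oXY k (Y : 'M[KR]_(m, k)) : orthonormal_cols Y -> adjoint_mx X *m Y = 0 ->
    orthonormal_cols (row_mx X Y).
  move=> oY XY; have YX : adjoint_mx Y *m X = 0.
    rewrite -[LHS]adjoint_mxK adjoint_mxM adjoint_mxK XY.
    by apply/matrixP => i j; rewrite !mxE base_conj0.
  by rewrite /orthonormal_cols EX mul_col_row oX oY XY YX -scalar_mx_block.
suff H k : (k <= m - n)%N -> exists Y : 'M[KR]_(m, k),
    orthonormal_cols Y /\ adjoint_mx X *m Y = 0.
  have [Y [oY XY]] := H _ (leqnn _); exists Y; split => //.
  have := oXY _ _ oY XY; rewrite -mul_row_col -EX.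
  move: (row_mx X Y); rewrite (subnKC nm) => Z; exact: orthonormal_square.
elim: k => [|k IH] km.
  exists 0; split; first by apply/matrixP => -[].
  by apply/matrixP => i [].
have [Y [oY XY]] := IH (ltnW km).
have [|z z0 Zz] := @underdetermined _ m (adjoint_mx (row_mx X Y)).
  by rewrite -ltn_subRL.
have [r r0 oz] := normalize z0.
move: Zz; rewrite EX mul_col_mx => /eqP; rewrite col_mx_eq0 => /andP[/eqP Xz /eqP Yz].
have s0 p : real_scale r (0 : 'M[KR]_(p, 1)) = 0.
  by apply/matrixP => i j; rewrite !mxE mulr0.
have o1 : orthonormal_cols (row_mx Y (real_scale r z)).
  by apply: orthonormal_row_mx => //; rewrite mulmx_real_scale Yz s0.
have o2 : adjoint_mx X *m row_mx Y (real_scale r z) = 0.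
  by rewrite mul_mx_row XY mulmx_real_scale Xz s0 row_mx0.
by move: o1 o2; move: (row_mx _ _); rewrite addn1 => Z o1 o2; exists Z.
Qed.

End linear_systems.

(** * The spectral theorem *)

Section spectral_theorem.
Context (R : realType) (K : base_algebra).
Local Notation KR := (base_ring R K).
Local Notation d := (base_dim K).

Lemma base_of_coordsD (a : R) (f g : nat -> R) :
  base_of_coords K (fun c => a * f c + g c) =
  base_real K a * base_of_coords K f + base_of_coords K g.
Proof.
rewrite /base_real /base_of_coords /base_ring; case: K => //=.
  by apply/eqP; rewrite eq_complex /= !mul0r subr0 addr0 !eqxx.
by congr Quat; rewrite /=; ring.
Qed.

(** Realification: A acts real-linearly on R^(n d), and its eigenvectors are sought there, since
    over the quaternions there is no characteristic polynomial. *)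
Definition of_real_vec n (u : 'rV[R]_(n * d)) : 'cV[KR]_n :=
  \col_k base_of_coords K
    (fun c => if insub c is Some j then vec_mx u k (j : 'I_d) else 0).

Definition to_real_vec n (x : 'cV[KR]_n) : 'rV[R]_(n * d) :=
  mxvec (\matrix_(k, c) nth 0 (base_coords (x k 0)) (c : 'I_d)).

Lemma to_real_vecK n : cancel (@to_real_vec n) (@of_real_vec n).
Proof.
move=> x; apply/colP => k; rewrite mxE mxvecK -[RHS]base_coordsK.
by apply: base_of_coords_ext => c cd; rewrite insubT mxE.
Qed.

Lemma of_real_vecK n : cancel (@of_real_vec n) (@to_real_vec n).
Proof.
move=> u; rewrite -[RHS]vec_mxK; congr mxvec; apply/matrixP => k c; rewrite mxE mxE.
by rewrite base_of_coordsK// valK.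
Qed.

Lemma of_real_vec_linear n a (u v : 'rV[R]_(n * d)) :
  of_real_vec (a *: u + v) = real_scale a (of_real_vec u) + of_real_vec v.
Proof.
apply/colP => k; rewrite !mxE -base_of_coordsD; apply: base_of_coords_ext => c cd.
by rewrite insubT linearP !mxE.
Qed.

Lemma to_real_vec_linear n a (x y : 'cV[KR]_n) :
  to_real_vec (real_scale a x + y) = a *: to_real_vec x + to_real_vec y.
Proof.
apply: (can_inj (@of_real_vecK n)).
by rewrite of_real_vec_linear !to_real_vecK.
Qed.

Definition real_action n (A : 'M[KR]_n) (u : 'rV[R]_(n * d)) : 'rV[R]_(n * d) :=
  to_real_vec (A *m of_real_vec u).

Lemma real_action_linear n (A : 'M[KR]_n) : linear (real_action A).
Proof.
move=> a u v.
by rewrite /real_action of_real_vec_linear mulmxDr mulmx_real_scale to_real_vec_linear.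
Qed.

HB.instance Definition _ n (A : 'M[KR]_n) := GRing.isLinear.Build R _ _ _
  (real_action A) (@real_action_linear n A).

Definition re_dot n (x y : 'cV[KR]_n) : R := base_re ((adjoint_mx x *m y) 0 0).

Lemma re_dotDr n (x y z : 'cV[KR]_n) : re_dot x (y + z) = re_dot x y + re_dot x z.
Proof. by rewrite /re_dot mulmxDr mxE base_reD. Qed.

Lemma re_dotZr n a (x y : 'cV[KR]_n) : re_dot x (real_scale a y) = a * re_dot x y.
Proof. by rewrite /re_dot mulmx_real_scale mxE base_re_realM. Qed.

Lemma re_dotC n (x y : 'cV[KR]_n) : re_dot x y = re_dot y x.
Proof. by rewrite /re_dot -base_re_conj -adjoint_mxE adjoint_mxM adjoint_mxK. Qed.

Lemma re_dot_herm n (A : 'M[KR]_n) (x y : 'cV[KR]_n) : adjoint_mx A = A ->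
  re_dot x (A *m y) = re_dot (A *m x) y.
Proof. by move=> hA; rewrite /re_dot adjoint_mxM hA mulmxA. Qed.

Lemma re_dotxx n (x : 'cV[KR]_n) : re_dot x x = vec_nsq x.
Proof. by rewrite /re_dot vec_nsqE base_re_real. Qed.

(* A complex eigenvector u + i v of the underlying real operator, with         *)
(* eigenvalue a + i b, satisfies b (|u|^2 + |v|^2) = 0 because the operator is *)
(* symmetric.                                                                   *)
Lemma hermitian_eigenpair n (A : 'M[KR]_n) : (0 < n)%N -> adjoint_mx A = A ->
  exists a, exists2 x : 'cV[KR]_n, x != 0 & A *m x = real_scale a x.
Proof.
move=> n0 hA; pose S := lin1_mx (real_action A).
have N0 : (0 < n * d)%N by rewrite muln_gt0 n0 base_dim_gt0.
have [[a b] /eigenvalueP[w wS w0]] :=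
  @eigenvalue_closed (R[i])%C _ (map_mx (real_complex R) S) N0.
pose u := map_mx (@complex.Re R) w; pose v := map_mx (@complex.Im R) w.
have ReD (I : Type) (s : seq I) (F : I -> R[i]) :
    complex.Re (\sum_(i <- s) F i) = \sum_(i <- s) complex.Re (F i).
  by apply: (big_morph (@complex.Re R) (id1 := 0) (op1 := +%R)) => // -[? ?] [? ?].
have ImD (I : Type) (s : seq I) (F : I -> R[i]) :
    complex.Im (\sum_(i <- s) F i) = \sum_(i <- s) complex.Im (F i).
  by apply: (big_morph (@complex.Im R) (id1 := 0) (op1 := +%R)) => // -[? ?] [? ?].
have uS : u *m S = a *: u - b *: v.
  apply/rowP => k; move/rowP: wS => /(_ k) /(congr1 (@complex.Re R)).
  rewrite !mxE ReD; under eq_bigr do rewrite !mxE.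
  move=> E; transitivity (complex.Re ((a +i* b)%C * w 0 k)).
    by rewrite -E; apply: eq_bigr => j _; rewrite !mxE; case: (w 0 j) => p q /=; ring.
  by case: (w 0 k) => p q.
have vS : v *m S = b *: u + a *: v.
  apply/rowP => k; move/rowP: wS => /(_ k) /(congr1 (@complex.Im R)).
  rewrite !mxE ImD; under eq_bigr do rewrite !mxE.
  move=> E; transitivity (complex.Im ((a +i* b)%C * w 0 k)).
    by rewrite -E; apply: eq_bigr => j _; rewrite !mxE; case: (w 0 j) => p q /=; ring.
  by case: (w 0 k) => p q /=; ring.
pose x := of_real_vec u; pose y := of_real_vec v.
have actE t : A *m of_real_vec t = of_real_vec (t *m S).
  by rewrite mul_rV_lin1 /= /real_action to_real_vecK.
have rs1 p (t : 'cV[KR]_p) : real_scale 1 t = t.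
  by apply/colP => k; rewrite mxE base_real1 mul1r.
have Z0 : of_real_vec (0 : 'rV[R]_(n * d)) = 0.
  have := of_real_vec_linear 1 (0 : 'rV[R]_(n * d)) 0.
  by rewrite scaler0 addr0 rs1 => /eqP; rewrite -[X in X == _]addr0 (inj_eq (addrI _)) eq_sym => /eqP.
have lin2 a' b' : of_real_vec (a' *: u + b' *: v) = real_scale a' x + real_scale b' y.
  by rewrite of_real_vec_linear -[b' *: v]addr0 of_real_vec_linear Z0 addr0.
have Ax : A *m x = real_scale a x + real_scale (- b) y.
  by rewrite actE uS -scaleNr lin2.
have Ay : A *m y = real_scale b x + real_scale a y.
  by rewrite actE vS lin2.
have b0 : b * (vec_nsq x + vec_nsq y) = 0.
  have := re_dot_herm y x hA; rewrite Ax Ay [in RHS]re_dotC !re_dotDr !re_dotZr.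
  rewrite (re_dotC x y) !re_dotxx => /eqP.
  rewrite [X in X == _]addrC (inj_eq (addIr _)) mulNr => /eqP E.
  by rewrite mulrDr -E addNr.
have xy0 : x != 0 \/ y != 0.
  apply/orP; apply: contraT; rewrite negb_or !negbK => /andP[/eqP x0 /eqP y0].
  have u0 : u = 0 by rewrite -[u]of_real_vecK -/x x0 -Z0 of_real_vecK.
  have v0 : v = 0 by rewrite -[v]of_real_vecK -/y y0 -Z0 of_real_vecK.
  case/eqP: w0; apply/rowP => k.
  move/rowP: u0 => /(_ k); move/rowP: v0 => /(_ k); rewrite !mxE.
  by case: (w 0 k) => p q /= -> ->.
have {}b0 : b = 0.
  move/eqP: b0; rewrite mulf_eq0 => /orP[/eqP//|].
  rewrite paddr_eq0 ?vec_nsq_ge0// => /andP[/eqP/vec_nsq_eq0 x0 /eqP/vec_nsq_eq0 y0].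
  by case: xy0; rewrite ?x0 ?y0 eqxx.
have s0 p (t : 'cV[KR]_p) : real_scale 0 t = 0.
  by apply/colP => k; rewrite !mxE base_real0 mul0r.
exists a; case: xy0 => [x0|y0]; [exists x => //|exists y => //].
  by rewrite Ax b0 oppr0 s0 addr0.
by rewrite Ay b0 s0 add0r.
Qed.

(* Inductive step: an eigenvector of the compression of A to the orthogonal    *)
(* complement of the eigenvectors found so far is an eigenvector of A.         *)
Lemma orthonormal_eigenvectors n (A : 'M[KR]_n) k : adjoint_mx A = A -> (k <= n)%N ->
  exists X : 'M[KR]_(n, k), exists s : k.-tuple R,
  orthonormal_cols X /\ A *m X = X *m real_diag K (tnth s).
Proof.
move=> hA; elim: k => [|k IH] kn.
  exists 0, [tuple]; split; first by apply/matrixP => -[].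
  by apply/matrixP => i [].
have [X [s [oX AX]]] := IH (ltnW kn).
have [Y [oY XY XXYY]] := orthonormal_complement oX.
have XA : adjoint_mx X *m A = real_diag K (tnth s) *m adjoint_mx X.
  by rewrite -[LHS]adjoint_mxK adjoint_mxM adjoint_mxK hA AX adjoint_mxM adjoint_real_diag.
have AY : A *m Y = Y *m (adjoint_mx Y *m A *m Y).
  rewrite !mulmxA -[LHS]mul1mx -XXYY mulmxDl -!mulmxA [adjoint_mx X *m _]mulmxA XA.
  by rewrite -[in X in X + _]mulmxA XY !mulmx0 add0r !mulmxA.
have hA' : adjoint_mx (adjoint_mx Y *m A *m Y) = adjoint_mx Y *m A *m Y.
  by rewrite !adjoint_mxM adjoint_mxK hA mulmxA.
have nk : (0 < n - k)%N by rewrite subn_gt0.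
have [a [u u0 Au]] := hermitian_eigenpair nk hA'.
have [r r0 ou] := normalize u0.
pose z := Y *m real_scale r u.
have oz : orthonormal_cols z.
  by rewrite /orthonormal_cols /z adjoint_mxM -mulmxA (orthonormal_mulmx _ oY).
have Xz : adjoint_mx X *m z = 0 by rewrite /z mulmxA XY mul0mx.
have Az : A *m z = real_scale a z.
  rewrite /z mulmxA AY -mulmxA mulmx_real_scale Au real_scaleA mulrC -real_scaleA.
  by rewrite !mulmx_real_scale.
suff : exists X : 'M[KR]_(n, k + 1), exists s : (k + 1).-tuple R,
  orthonormal_cols X /\ A *m X = X *m real_diag K (tnth s) by rewrite addn1.
exists (row_mx X z), [tuple of s ++ [tuple a]]; split.
  exact: orthonormal_row_mx.
rewrite mul_mx_row AX Az /real_diag.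
rewrite (_ : \row_i _ = row_mx (\row_i base_real K (tnth s i)) (const_mx (base_real K a))).
  rewrite diag_mx_row mul_row_block !mulmx0 addr0 add0r; congr row_mx.
  apply/colP => i; rewrite !mxE big_ord1 !mxE eqxx mulr1n.
  by rewrite base_realC.
apply/rowP => i; rewrite !mxE; case: split_ordP => j ->; rewrite !mxE.
  by rewrite tnth_lshift.
by rewrite tnth_rshift ord1.
Qed.

Theorem spectral n (A : 'M[KR]_n) : adjoint_mx A = A ->
  exists U : 'M[KR]_n, exists s : n.-tuple R,
  [/\ sorted <=%R s, Defs.is_unitary U & adjoint_mx U *m A *m U = real_diag K (tnth s)].
Proof.
move=> hA; have [X [s [oX AX]]] := orthonormal_eigenvectors hA (leqnn n).
have /tuple_permP[p sp] : perm_eq (sort <=%R s) s by exact/permEl/perm_sort.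
pose t := [tuple of sort <=%R s].
have tE i : tnth t i = tnth s (p i).
  rewrite (tnth_nth 0) /= sp -(tnth_nth 0 [tuple tnth s (p i) | i < n]).
  by rewrite tnth_mktuple.
have oU : orthonormal_cols (col_perm p X).
  apply/matrixP => i j; have /matrixP/(_ (p i) (p j)) := oX.
  rewrite !mxE (inj_eq perm_inj) => <-.
  by apply: eq_bigr => k _; rewrite !mxE.
exists (col_perm p X), t; split.
- exact: (sort_sorted le_total).
- by split => //; exact: orthonormal_square.
have AU : A *m col_perm p X = col_perm p X *m real_diag K (tnth t).
  apply/matrixP => i j; have /matrixP/(_ i (p j)) := AX.
  rewrite !mxE => E; transitivity (\sum_k A i k * X k (p j)).
    by apply: eq_bigr => k _; rewrite !mxE.
  rewrite E (bigD1 (p j))//= [in RHS](bigD1 j)//= !big1 ?addr0.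
  - by rewrite !real_diagE !eqxx mxE tE.
  - by move=> k kj; rewrite real_diagE (negbTE kj) mulr0.
  - by move=> k kj; rewrite real_diagE (negbTE kj) mulr0.
by rewrite -mulmxA AU mulmxA oU mul1mx.
Qed.

End spectral_theorem.

(** * Existence and uniqueness of the spectrum *)

Section spectrum.

Lemma char_poly_conj (F : comNzRingType) n (A U V : 'M[F]_n) : V *m U = 1%:M ->
  char_poly (V *m A *m U) = char_poly A.
Proof.
move=> VU; rewrite /char_poly.
have -> : char_poly_mx (V *m A *m U) =
    map_mx polyC V *m char_poly_mx A *m map_mx polyC U.
  rewrite /char_poly_mx mulmxBr mulmxBl !map_mxM; congr (_ - _).
  by rewrite scalar_mxC -mulmxA -map_mxM VU map_mx1 mulmx1.
rewrite !det_mulmx mulrAC -det_mulmx -map_mxM VU map_mx1 det1 mul1r//.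
Qed.

Lemma char_poly_diag (F : comNzRingType) n (v : 'rV[F]_n) :
  char_poly (diag_mx v) = \prod_i ('X - (v 0 i)%:P).
Proof.
rewrite char_poly_trig ?diag_mx_is_trig//.
by apply: eq_bigr => i _; rewrite mxE eqxx mulr1n.
Qed.

Context (R : realType).

Lemma is_spectrum_diag (K : base_algebra) n (A U : 'M[base_ring R K]_n) (s : n.-tuple R) :
  Defs.is_unitary U -> adjoint_mx U *m A *m U = real_diag K (tnth s) ->
  is_spectrum A s.
Proof.
case: K A U => /= A U [UU UU'] E.
- rewrite -(char_poly_conj A UU) E /real_diag char_poly_diag (big_tuple _ _ s).
  by apply: eq_bigr => i _; rewrite mxE.
- rewrite -(char_poly_conj A UU) E /real_diag char_poly_diag (big_tuple _ _ s).
  by apply: eq_bigr => i _; rewrite mxE.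
- by exists U.
Qed.

(** Comparing entries, V_ij = 0 unless s_j = t_i. The matrix of |V_ij|^2 has row and column sums 1,
    so summing it over the pairs (i, j) for which s_j satisfies a predicate counts the entries of s
    by columns and those of t by rows. *)
Lemma unitary_diag_count (K : base_algebra) n (V : 'M[base_ring R K]_n) (s t : n.-tuple R) :
  Defs.is_unitary V -> V *m real_diag K (tnth s) = real_diag K (tnth t) *m V ->
  perm_eq s t.
Proof.
move=> [VV VV'] E.
have Vst i j : tnth s j != tnth t i -> base_nsq (V i j) = 0.
  move=> st; have /matrixP/(_ i j) := E; rewrite !mxE (bigD1 j)//= [in RHS](bigD1 i)//=.
  rewrite !big1 ?addr0; first last.
  - by move=> k kj; rewrite real_diagE (negbTE kj) mulr0.
  - by move=> k ki; rewrite real_diagE eq_sym (negbTE ki) mul0r.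
  rewrite !real_diagE !eqxx base_realC => /eqP; rewrite -subr_eq0 -mulrBr -base_realN -base_realD.
  move=> /eqP /(congr1 (@base_nsq R K)); rewrite base_nsqM base_nsq_real base_nsq0.
  by move/eqP; rewrite mulf_eq0 expf_eq0 subr_eq0 (negbTE st) orbF => /eqP.
have row1 i : \sum_j base_nsq (V i j) = 1.
  have /matrixP/(_ i i) := VV'; rewrite !mxE eqxx => Vi.
  apply: (@base_real_inj R K); rewrite base_real_sum base_real1 -[RHS]Vi.
  by apply: eq_bigr => j _; rewrite adjoint_mxE base_mul_conj.
have col1 j : \sum_i base_nsq (V i j) = 1.
  have /matrixP/(_ j j) := VV; rewrite !mxE eqxx => Vi.
  apply: (@base_real_inj R K); rewrite base_real_sum base_real1 -[RHS]Vi.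
  by apply: eq_bigr => i _; rewrite adjoint_mxE base_conj_mul.
apply/seq.permP => a; apply/eqP; rewrite -(eqr_nat R).
have cE (u : n.-tuple R) : (count a u)%:R = \sum_i (a (tnth u i))%:R :> R.
  by rewrite -sum1_count big_mkcond big_tuple natr_sum; apply: eq_bigr => i _; case: (a _).
rewrite !cE; apply/eqP.
transitivity (\sum_j \sum_i (a (tnth s j))%:R * base_nsq (V i j)).
  by apply: eq_bigr => j _; rewrite -mulr_sumr col1 mulr1.
rewrite exchange_big; apply: eq_bigr => i _ /=.
transitivity (\sum_j (a (tnth t i))%:R * base_nsq (V i j)).
  apply: eq_bigr => j _; have [->//|/Vst ->] := eqVneq (tnth s j) (tnth t i).
  by rewrite !mulr0.
by rewrite -mulr_sumr row1 mulr1.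
Qed.

(** [eigenvalues] picks some sorted spectrum; uniqueness identifies the pick. The multiset is
    determined by the characteristic polynomial over the real and complex numbers, and by
    [unitary_diag_count] over the quaternions. *)
Lemma is_spectrum_unique (K : base_algebra) n (A : 'M[base_ring R K]_n) (s t : n.-tuple R) :
  sorted <=%R s -> sorted <=%R t -> is_spectrum A s -> is_spectrum A t -> s = t.
Proof.
move=> ss st As At; apply/val_inj/(sorted_eq le_trans le_anti ss st).
case: K A As At => A.
- by rewrite /is_spectrum => -> /prod_XsubC_eq.
- rewrite /is_spectrum => -> E; apply: (perm_map_inj (@complexI R)); apply: prod_XsubC_eq.
  by rewrite !big_map.
- move=> [U [UU UU'] EU] [W [WW WW'] EW].
  have uV : Defs.is_unitary (adjoint_mx W *m U : 'M[base_ring R QuaternionAlg]_n).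
    split; rewrite adjoint_mxM adjoint_mxK mulmxA.
      by rewrite -(mulmxA (adjoint_mx U)) WW' mulmx1.
    by rewrite -(mulmxA (adjoint_mx W)) UU' mulmx1.
  have := @unitary_diag_count QuaternionAlg n _ s t uV; apply.
  rewrite /real_diag -EU -EW !mulmxA -(mulmxA (adjoint_mx W) U) UU' mulmx1.
  by rewrite -(mulmxA _ W) WW' mulmx1.
Qed.

Lemma eigenvalues_eq (K : base_algebra) n (A U : 'M[base_ring R K]_n) (s : n.-tuple R) :
  sorted <=%R s -> Defs.is_unitary U ->
  adjoint_mx U *m A *m U = real_diag K (tnth s) -> eigenvalues A = s.
Proof.
move=> ss uU E; have As := is_spectrum_diag uU E.
have [ss' As'] := @xgetPex _ [tuple of nseq n 0] [set s : n.-tuple R | sorted <=%R s /\ is_spectrum A s]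
  (ex_intro _ s (conj ss As)).
exact: is_spectrum_unique ss' ss As' As.
Qed.

Lemma eigenvaluesP (K : base_algebra) n (A : 'M[base_ring R K]_n) : adjoint_mx A = A ->
  sorted <=%R (eigenvalues A) /\
  exists2 U, Defs.is_unitary U & adjoint_mx U *m A *m U = real_diag K (tnth (eigenvalues A)).
Proof.
move=> hA; have [U [s [ss uU E]]] := spectral hA.
by rewrite (eigenvalues_eq ss uU E); split => //; exists U.
Qed.

End spectrum.

(** * Cauchy interlacing *)

Section interlacing_inequalities.
Context (R : realType) (K : base_algebra).
Local Notation KR := (base_ring R K).

Lemma real_diag_mulE n m (s : 'I_n -> R) (x : 'M[KR]_(n, m)) i j :
  (real_diag K s *m x) i j = base_real K (s i) * x i j.
Proof.
rewrite mxE (bigD1 i)//= big1 ?addr0 ?real_diagE ?eqxx// => k ki.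
by rewrite real_diagE eq_sym (negbTE ki) mul0r.
Qed.

Lemma re_dot_diag n (s : 'I_n -> R) (x : 'cV[KR]_n) :
  re_dot x (real_diag K s *m x) = \sum_i s i * base_nsq (x i 0).
Proof.
rewrite /re_dot mxE base_re_sum; apply: eq_bigr => i _.
by rewrite real_diag_mulE adjoint_mxE mulrA -base_realC -mulrA base_re_realM base_nsq_re.
Qed.

Lemma re_dot_conj n m (B : 'M[KR]_n) (X : 'M[KR]_(n, m)) (a : 'cV[KR]_m) :
  re_dot a (adjoint_mx X *m B *m X *m a) = re_dot (X *m a) (B *m (X *m a)).
Proof. by rewrite /re_dot adjoint_mxM !mulmxA. Qed.

Lemma vec_nsq_isometry n m (X : 'M[KR]_(n, m)) (a : 'cV[KR]_m) :
  orthonormal_cols X -> vec_nsq (X *m a) = vec_nsq a.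
Proof.
move=> oX; rewrite -!re_dotxx /re_dot adjoint_mxM -mulmxA.
by rewrite orthonormal_mulmx.
Qed.

(* Courant-Fischer without minima: a nonzero vector in the intersection of two *)
(* spans of eigenvectors whose dimensions add up to more than N.               *)
Lemma compare_forms N M (B V : 'M[KR]_N) (X : 'M[KR]_(N, M))
    (lam : 'I_M -> R) (mu : 'I_N -> R) (I : {set 'I_M}) (J : {set 'I_N}) (s : R) :
  orthonormal_cols X -> adjoint_mx X *m B *m X = real_diag K lam ->
  Defs.is_unitary V -> adjoint_mx V *m B *m V = real_diag K mu ->
  (#|~: I| + #|~: J| < M)%N ->
  exists i, exists j, [/\ i \in I, j \in J & s * (mu j - lam i) <= 0].
Proof.
move=> oX BX [VV VV'] BV cIJ.
(* The entries of [a] outside [I] and those of V^* X a outside [J] are required to vanish: fewer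
   equations than unknowns. *)
have [a a0] := underdetermined (col_mx
  (rowsub (fun i : 'I_#|~: I| => enum_val i) (1%:M : 'M[KR]_M))
  (rowsub (fun j : 'I_#|~: J| => enum_val j) (adjoint_mx V *m X))) cIJ.
rewrite mul_col_mx => /eqP; rewrite col_mx_eq0 !mul_rowsub_mx mul1mx.
move=> /andP[/eqP aI /eqP aJ]; set y := adjoint_mx V *m X *m a in aJ.
have aI0 i : a i 0 != 0 -> i \in I.
  apply: contraNT => iI; have iI' : i \in ~: I by rewrite inE.
  move/colP/(_ (enum_rank_in iI' i)): aI.
  by rewrite !mxE enum_rankK_in// => ->.
have yJ0 j : y j 0 != 0 -> j \in J.
  apply: contraNT => jJ; have jJ' : j \in ~: J by rewrite inE.
  move/colP/(_ (enum_rank_in jJ' j)): aJ.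
  by rewrite !mxE enum_rankK_in// => ->.
have Vy : V *m y = X *m a by rewrite /y !mulmxA VV' mul1mx.
have ya : vec_nsq y = vec_nsq a.
  by rewrite -(vec_nsq_isometry y VV) Vy vec_nsq_isometry.
have a_gt0 : 0 < vec_nsq a.
  rewrite lt_neqAle vec_nsq_ge0 andbT eq_sym.
  by apply: contraNneq a0 => /vec_nsq_eq0 ->.
have q : \sum_i lam i * base_nsq (a i 0) = \sum_j mu j * base_nsq (y j 0).
  by rewrite -!re_dot_diag -BX -BV !re_dot_conj Vy.
apply: contrapT => nex.
have pos i j : a i 0 != 0 -> y j 0 != 0 -> 0 < s * (mu j - lam i).
  move=> /aI0 iI /yJ0 jJ; rewrite ltNge; apply/negP => le0.
  by apply: nex; exists i, j.
(* [a] and [y] have the same norm and the same value of the quadratic form, so this double sum is 0;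
   if the required pair did not exist, all its terms would be nonnegative and one positive. *)
have z : \sum_i \sum_j s * (mu j - lam i) * (base_nsq (a i 0) * base_nsq (y j 0)) = 0.
  transitivity (s * (vec_nsq a * (\sum_j mu j * base_nsq (y j 0)) -
    (\sum_i lam i * base_nsq (a i 0)) * vec_nsq y)).
    rewrite /vec_nsq 2!mulr_suml -sumrB mulr_sumr; apply: eq_bigr => i _.
    rewrite mulr_sumr [X in _ - X]mulr_sumr -sumrB [RHS]mulr_sumr; apply: eq_bigr => j _; ring.
  by rewrite q ya mulrC mulrC [X in _ - X]mulrC subrr mulr0.
have term0 i j : 0 <= s * (mu j - lam i) * (base_nsq (a i 0) * base_nsq (y j 0)).
  have [->|ai] := eqVneq (a i 0) 0; first by rewrite base_nsq0 mul0r mulr0.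
  have [->|yj] := eqVneq (y j 0) 0; first by rewrite base_nsq0 !mulr0.
  by apply: mulr_ge0; [exact/ltW/pos|rewrite mulr_ge0 ?base_nsq_ge0].
have [i ai] : exists i, a i 0 != 0.
  apply: contrapT => /forallNP h; case/eqP: a0; apply/colP => i; rewrite mxE.
  by apply/eqP; have := h i => /negP; rewrite negbK.
have [j yj] : exists j, y j 0 != 0.
  apply: contrapT => /forallNP h.
  have y0 : y = 0 by apply/colP => j; rewrite [RHS]mxE; apply/eqP; have := h j => /negP; rewrite negbK.
  by move: a_gt0; rewrite -ya y0 /vec_nsq big1 ?ltxx// => k _; rewrite mxE base_nsq0.
move/eqP: z; rewrite psumr_eq0; last by move=> k _; exact: sumr_ge0.
move=> /allP/(_ i (mem_index_enum _)); rewrite psumr_eq0//.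
move=> /allP/(_ j (mem_index_enum _)).
by rewrite !mulf_eq0 (gt_eqF (base_nsq_gt0 ai)) (gt_eqF (base_nsq_gt0 yj)) orbF
  -mulf_eq0 (gt_eqF (pos _ _ ai yj)).
Qed.

Lemma card_ord_lt n k : (k <= n)%N -> #|[set i : 'I_n | (i < k)%N]%SET| = k.
Proof.
move=> kn; rewrite -sum1_card.
under eq_bigl do rewrite inE.
by rewrite (big_ord_narrow kn) sum1_card card_ord.
Qed.

Lemma card_ord_geq n k : (k <= n)%N -> #|~: [set i : 'I_n | (i < k)%N]%SET| = (n - k)%N.
Proof. by move=> kn; rewrite cardsCs card_ord finset.setCK card_ord_lt. Qed.

Lemma nth_eigenvalues_le n (A : 'M[KR]_n) i j : adjoint_mx A = A ->
  (i <= j)%N -> (j < n)%N -> nth 0 (eigenvalues A) i <= nth 0 (eigenvalues A) j.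
Proof.
move=> hA ij jn; have [sA _] := eigenvaluesP hA.
apply: (sorted_leq_nth le_trans le_refl 0 sA) => //; rewrite inE size_tuple//.
exact: leq_ltn_trans jn.
Qed.

Lemma cauchy_interlacing n (A : 'M[KR]_n) v w c k :
  adjoint_mx (block_mx A v w c) = block_mx A v w c :> 'M[KR]_(n + 1) -> (k < n)%N ->
  nth 0 (eigenvalues (block_mx A v w c)) k <= nth 0 (eigenvalues A) k
    <= nth 0 (eigenvalues (block_mx A v w c)) k.+1.
Proof.
set B := block_mx A v w c => hB kn.
have adjB : adjoint_mx B = block_mx (adjoint_mx A) (adjoint_mx w) (adjoint_mx v) (adjoint_mx c).
  by rewrite /adjoint_mx tr_block_mx map_block_mx.
have hA : adjoint_mx A = A by move: hB; rewrite adjB => /eq_block_mx[].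
have [sA [U uU EU]] := eigenvaluesP hA; have [sB [V uV EV]] := eigenvaluesP hB.
pose X : 'M[KR]_(n + 1, n) := col_mx U 0.
have adjX : adjoint_mx X = row_mx (adjoint_mx U) 0.
  rewrite /adjoint_mx tr_col_mx map_row_mx; congr row_mx.
  by apply/matrixP => i j; rewrite !mxE base_conj0.
have oX : orthonormal_cols X.
  by rewrite /orthonormal_cols adjX mul_row_col mul0mx addr0; case: uU.
have BX : adjoint_mx X *m B *m X = real_diag K (tnth (eigenvalues A)).
  by rewrite adjX mul_row_block mul_row_col !mul0mx !mulmx0 !addr0.
have le1 := nth_eigenvalues_le hA; have le2 := nth_eigenvalues_le hB.
have k1 : (k < n + 1)%N by rewrite addn1 ltnW.
(* Each inequality imposes n - 1 conditions on n unknowns: (n - k - 1) + k for the first, k + (n + 1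
   - (k + 2)) for the second. The sign [s] selects the direction. *)
apply/andP; split.
- have [|i [j []]] := @compare_forms _ _ B V X _ _ [set i : 'I_n | (i < k.+1)%N]%SET (~: [set j : 'I_(n + 1) | (j < k)%N]%SET) 1 oX BX uV EV.
    rewrite finset.setCK (card_ord_lt (ltnW k1)) (card_ord_geq kn); lia.
  rewrite ?inE -?leqNgt ?ltnS mul1r subr_le0 !(tnth_nth 0) => ik kj h.
  exact: le_trans (le2 _ _ kj (ltn_ord j)) (le_trans h (le1 _ _ ik kn)).
- have [|i [j []]] := @compare_forms _ _ B V X _ _ (~: [set i : 'I_n | (i < k)%N]%SET) [set j : 'I_(n + 1) | (j < k.+2)%N]%SET (-1) oX BX uV EV.
    rewrite finset.setCK (card_ord_lt (ltnW kn)) (@card_ord_geq (n + 1)); lia.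
  rewrite ?inE -?leqNgt ?ltnS mulN1r opprB subr_le0 !(tnth_nth 0) => ki jk h.
  apply: (le_trans (le1 _ _ ki (ltn_ord i))); apply: (le_trans h).
  by apply: le2; [rewrite -ltnS|rewrite addn1].
Qed.

End interlacing_inequalities.

(** * Bordered diagonal matrices *)

Section bordered_matrices.
Context (R : realType) (K : base_algebra).
Local Notation KR := (base_ring R K).

Lemma unitary_adjoint n (U : 'M[KR]_n) : Defs.is_unitary U -> Defs.is_unitary (adjoint_mx U).
Proof. by case=> UU UU'; split; rewrite adjoint_mxK. Qed.

Lemma unitary_mul n (U V : 'M[KR]_n) :
  Defs.is_unitary U -> Defs.is_unitary V -> Defs.is_unitary (U *m V).
Proof.
move=> [UU UU'] [VV VV']; split; rewrite adjoint_mxM mulmxA.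
  by rewrite -(mulmxA (adjoint_mx V)) UU mulmx1.
by rewrite -(mulmxA U) VV' mulmx1.
Qed.

Lemma unitary_square n (U : 'M[KR]_n) : orthonormal_cols U -> Defs.is_unitary U.
Proof. by move=> oU; split; rewrite ?orthonormal_square. Qed.

Lemma eigenvalues_conj n (A W : 'M[KR]_n) : adjoint_mx A = A -> Defs.is_unitary W ->
  eigenvalues (adjoint_mx W *m A *m W) = eigenvalues A.
Proof.
move=> hA uW; have [sA [U uU EU]] := eigenvaluesP hA.
apply: (@eigenvalues_eq _ _ _ _ (adjoint_mx W *m U)) => //.
  exact: unitary_mul (unitary_adjoint uW) uU.
have [WW WW'] := uW.
rewrite -EU adjoint_mxM adjoint_mxK !mulmxA.
rewrite -(mulmxA _ W (adjoint_mx W)) WW' mulmx1.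
by rewrite -(mulmxA _ W (adjoint_mx W)) WW' mulmx1.
Qed.

Definition bordered n (A : 'M[KR]_n) (v : 'cV[KR]_n) (c : R) : 'M[KR]_(n + 1) :=
  block_mx A v (adjoint_mx v) (base_real K c)%:M.

Lemma adjoint_block m n p q (A : 'M[KR]_(m, p)) (B : 'M[KR]_(m, q))
    (C : 'M[KR]_(n, p)) (D : 'M[KR]_(n, q)) :
  adjoint_mx (block_mx A B C D) =
  block_mx (adjoint_mx A) (adjoint_mx C) (adjoint_mx B) (adjoint_mx D).
Proof. by rewrite /adjoint_mx tr_block_mx map_block_mx. Qed.

Lemma adjoint_scalar n c : adjoint_mx (base_real K c)%:M = (base_real K c)%:M :> 'M[KR]_n.
Proof.
by apply/matrixP => i j; rewrite adjoint_mxE !mxE eq_sym; case: eqP => _;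
  rewrite ?mulr1n ?mulr0n ?base_conj_real ?base_conj0.
Qed.

Lemma adjoint_mx0 m n : adjoint_mx 0 = 0 :> 'M[KR]_(m, n).
Proof. by apply/matrixP => i j; rewrite adjoint_mxE !mxE base_conj0. Qed.

Lemma bordered_hermitian n (A : 'M[KR]_n) v c : adjoint_mx A = A ->
  adjoint_mx (bordered A v c) = bordered A v c.
Proof. by move=> hA; rewrite /bordered adjoint_block hA adjoint_mxK adjoint_scalar. Qed.

Lemma eigenvalues_bordered n (A U : 'M[KR]_n) v c : adjoint_mx A = A ->
  Defs.is_unitary U ->
  eigenvalues (bordered (adjoint_mx U *m A *m U) (adjoint_mx U *m v) c) =
  eigenvalues (bordered A v c).
Proof.
move=> hA [UU UU']; pose W : 'M[KR]_(n + 1) := block_mx U 0 0 1%:M.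
have adjW : adjoint_mx W = block_mx (adjoint_mx U) 0 0 1%:M.
  by rewrite adjoint_block !adjoint_mx0 adjoint_mx1.
have uW : Defs.is_unitary W.
  split; rewrite adjW mulmx_block !mulmx0 !mul0mx !addr0 !add0r mulmx1 ?UU ?UU';
  by rewrite -scalar_mx_block.
rewrite -(eigenvalues_conj (bordered_hermitian v c hA) uW); congr eigenvalues.
rewrite adjW /bordered !mulmx_block !mulmx0 !mul0mx !addr0 !add0r !mul1mx !mulmx1.
by rewrite adjoint_mxM adjoint_mxK.
Qed.

Lemma base_phase (x : KR) : exists2 p, base_nsq p = 1 &
  base_conj p * x = base_real K (Num.sqrt (base_nsq x)).
Proof.
have [->|x0] := eqVneq x 0.
  exists 1; first by rewrite -base_real1 base_nsq_real expr1n.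
  by rewrite base_nsq0 sqrtr0 mulr0 base_real0.
have s0 : Num.sqrt (base_nsq x) != 0 by rewrite gt_eqF// sqrtr_gt0 base_nsq_gt0.
exists (base_real K (Num.sqrt (base_nsq x))^-1 * x).
  rewrite base_nsqM base_nsq_real exprVn sqr_sqrtr ?base_nsq_ge0//.
  by rewrite mulVf// gt_eqF// base_nsq_gt0.
rewrite base_conjM base_conj_real -base_realC -mulrA base_conj_mul -base_realM.
congr (base_real K _).
by rewrite -[X in _ * X]sqr_sqrtr ?base_nsq_ge0// expr2 mulrA mulVf// mul1r.
Qed.

(** Conjugation by the diagonal matrix of the phases of v fixes the diagonal block, whose real
    entries are central, and makes the border real and nonnegative. *)
Lemma eigenvalues_bordered_phase n (lam : 'I_n -> R) v c :
  eigenvalues (bordered (real_diag K lam) v c) =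
  eigenvalues (bordered (real_diag K lam)
    (\col_i base_real K (Num.sqrt (base_nsq (v i 0)))) c).
Proof.
have /choice[p pP] : forall i, exists p, base_nsq p = 1 /\
  base_conj p * v i 0 = base_real K (Num.sqrt (base_nsq (v i 0))).
  by move=> i; have [p] := base_phase (v i 0); exists p.
pose U : 'M[KR]_n := diag_mx (\row_i p i).
have UE i m (x : 'M[KR]_(n, m)) j : (adjoint_mx U *m x) i j = base_conj (p i) * x i j.
  rewrite mxE (bigD1 i)//= big1 ?addr0; last first.
    by move=> k ki; rewrite adjoint_mxE !mxE (negbTE ki) mulr0n base_conj0 mul0r.
  by rewrite adjoint_mxE !mxE eqxx mulr1n.
have uU : Defs.is_unitary U.
  apply: unitary_square; apply/matrixP => i j; rewrite UE !mxE.
  case: eqP => [_|_]; last by rewrite !mulr0n mulr0.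
  by rewrite !mulr1n base_conj_mul (pP i).1 base_real1.
rewrite -(@eigenvalues_bordered n _ U v c (adjoint_real_diag K lam) uU); congr (eigenvalues (bordered _ _ _)).
  apply/matrixP => i j; rewrite -mulmxA UE mul_diag_mx !mxE.
  case: eqP => [_|_]; last by rewrite !mulr0n !mulr0.
  by rewrite !mulr1n base_realC mulrA base_conj_mul (pP i).1 base_real1 mul1r.
by apply/colP => i; rewrite UE !mxE (pP i).2.
Qed.

(** The zero m has the eigenvector with entries sqrt r_i / (m - lam_i) and last entry 1, whose
    squared norm is the derivative [dsecular]. For zeros p != q one has (p - q) / ((p - a) (q - a))
    = 1 / (q - a) - 1 / (p - a), so orthogonality is the difference of two secular equations. The n
    + 1 distinct zeros thus fill a unitary matrix. *)
Lemma eigenvalues_secular n (lam cr mu : seq R) :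
  size lam = n -> size mu = n.+1 -> size cr = n.+1 -> sorted <%R mu ->
  positive_seq (behead cr) ->
  (forall m, m \in mu -> m \notin lam /\ secular lam cr m = 0) ->
  eigenvalues (bordered (real_diag K (fun i : 'I_n => nth 0 lam i))
    (\col_i base_real K (Num.sqrt (nth 0 cr i.+1))) (nth 0 cr 0)) = mu :> seq R.
Proof.
move=> sl sm sc smu rpos root.
have n1 : size mu = (n + 1)%N by rewrite addn1.
pose s := tuple_of_seq (n + 1) mu.
have sE : s = mu :> seq R by rewrite tuple_of_seqE.
rewrite -sE; congr tval.
pose m (p : 'I_(n + 1)) := tnth s p.
have mE p : m p = nth 0 mu p by rewrite /m (tnth_nth 0) sE.
have m_in p : m p \in mu by rewrite mE mem_nth// n1.
have mlam p (i : 'I_n) : m p - nth 0 lam i != 0.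
  rewrite subr_eq0; apply: contraNneq (root _ (m_in p)).1 => ->.
  by rewrite mem_nth// sl.
have rE i : nth 0 (behead cr) i = nth 0 cr i.+1 by rewrite nth_behead.
have r_ge0 (i : 'I_n) : 0 <= nth 0 cr i.+1.
  rewrite -rE; apply/ltW; apply: (allP rpos); apply: mem_nth.
  by rewrite size_behead sc.
pose N p := dsecular lam (behead cr) (m p).
have N0 p : 0 < N p by rewrite dsecular_gt0// size_behead sc sl.
have sqN p : Num.sqrt (N p) != 0 by rewrite gt_eqF// sqrtr_gt0.
have secE p : \sum_(i < n) nth 0 cr i.+1 / (m p - nth 0 lam i) = m p - nth 0 cr 0.
  have := (root _ (m_in p)).2; rewrite /secular sl => /eqP; rewrite subr_eq0.
  by move=> /eqP ->.
pose Xu : 'M[KR]_(n, n + 1) := \matrix_(i, p) base_real K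
  (Num.sqrt (nth 0 cr i.+1) / (m p - nth 0 lam i) / Num.sqrt (N p)).
pose Xd : 'M[KR]_(1, n + 1) := \matrix_(i, p) base_real K (Num.sqrt (N p))^-1.
pose X : 'M[KR]_(n + 1) := col_mx Xu Xd.
have adjX : adjoint_mx X = row_mx (adjoint_mx Xu) (adjoint_mx Xd).
  by rewrite /adjoint_mx tr_col_mx map_row_mx.
have oX : orthonormal_cols X.
  rewrite /orthonormal_cols adjX mul_row_col; apply/matrixP => p q.
  rewrite !mxE big_ord1 adjoint_mxE !mxE base_conj_real -base_realM.
  under eq_bigr do rewrite adjoint_mxE !mxE base_conj_real -base_realM.
  rewrite -base_real_sum -base_realD.
  have -> : \sum_(i < n) Num.sqrt (nth 0 cr i.+1) / (m p - nth 0 lam i) / Num.sqrt (N p) *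
      (Num.sqrt (nth 0 cr i.+1) / (m q - nth 0 lam i) / Num.sqrt (N q)) =
      (\sum_(i < n) nth 0 cr i.+1 / ((m p - nth 0 lam i) * (m q - nth 0 lam i))) *
      ((Num.sqrt (N p))^-1 * (Num.sqrt (N q))^-1).
    rewrite mulr_suml; apply: eq_bigr => i _.
    rewrite -{3}(sqr_sqrtr (r_ge0 i)) expr2 invfM; ring.
  rewrite -[X in _ + X]mul1r -mulrDl.
  have [->|pq] := eqVneq p q.
    rewrite -invfM -expr2 sqr_sqrtr ?ltW//.
    have -> : (\sum_(i < n) nth 0 cr i.+1 / ((m q - nth 0 lam i) * (m q - nth 0 lam i)) + 1) = N q.
      by rewrite /N /dsecular addrC sl; congr (1 + _); apply: eq_bigr => i _; rewrite rE expr2.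
    by rewrite divff ?gt_eqF// base_real1.
  suff -> : \sum_(i < n) nth 0 cr i.+1 / ((m p - nth 0 lam i) * (m q - nth 0 lam i)) = -1.
    by rewrite addNr mul0r base_real0.
  have mpq : m p - m q != 0.
    rewrite subr_eq0 !mE nth_uniq ?n1//; exact: lt_sorted_uniq.
  apply: (mulfI mpq); rewrite mulrN1 opprB.
  have -> : m q - m p = (m q - nth 0 cr 0) - (m p - nth 0 cr 0) by ring.
  rewrite -!secE -sumrB mulr_sumr; apply: eq_bigr => i _.
  by have := mlam p i; have := mlam q i => *; field; apply/andP.
have uX := unitary_square oX.
apply: (@eigenvalues_eq _ _ _ _ X) => //.
  by rewrite sE; apply: sub_sorted smu => x y /ltW.
have BX : bordered (real_diag K (fun i : 'I_n => nth 0 lam i))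
    (\col_i base_real K (Num.sqrt (nth 0 cr i.+1))) (nth 0 cr 0) *m X =
    X *m real_diag K m.
  rewrite /bordered /X mul_block_col mul_col_mx; congr col_mx; apply/matrixP => i p.
    rewrite mxE real_diag_mulE [X in _ + X]mxE big_ord1 mul_mx_diag !mxE -!base_realM -base_realD.
    by congr base_real; have := mlam p i; have := sqN p => *; field; apply/andP.
  rewrite (ord1 i) mul_mx_diag !mxE big_ord1 !mxE eqxx mulr1n -!base_realM.
  under eq_bigr do rewrite adjoint_mxE !mxE base_conj_real -base_realM.
  rewrite -base_real_sum -base_realD; congr base_real.
  have -> : \sum_(i0 < n) Num.sqrt (nth 0 cr i0.+1) * (Num.sqrt (nth 0 cr i0.+1) /
      (m p - nth 0 lam i0) / Num.sqrt (N p)) = (m p - nth 0 cr 0) / Num.sqrt (N p).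
    rewrite -secE mulr_suml; apply: eq_bigr => k _.
    by rewrite -{3}(sqr_sqrtr (r_ge0 k)) expr2; ring.
  by rewrite mulrBl subrK mulrC.
rewrite -mulmxA BX mulmxA; have [-> _] := uX; rewrite mul1mx.
by rewrite /real_diag; congr diag_mx.
Qed.

Lemma interlace_notin (lam mu : seq R) : interlace lam mu -> sorted <%R lam ->
  forall m, m \in mu -> m \notin lam.
Proof.
elim: lam mu => [|l lam IH] [|m mu] //= /and3P[ml lmu imu] pl x.
have al := path_lt_all pl.
rewrite inE => /predU1P[->|xmu].
  rewrite inE negb_or lt_eqF//=; apply/negP => /(allP al).
  by rewrite ltNge (ltW ml).
rewrite inE negb_or (IH _ imu (path_sorted pl) _ xmu) andbT.
have [m' [mu' E]] := interlace_head imu; subst mu.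
move: xmu; rewrite inE => /predU1P[->|xmu]; first by rewrite gt_eqF.
have /allP/(_ _ xmu) := interlace_gt imu.
by move=> /(lt_trans lmu) /gt_eqF ->.
Qed.

(* The eigenvalues of the matrix with diagonal [lam] bordered by a column [v] *)
(* are the roots of [secular lam (c :: |v|^2)]; [border] inverts this map.     *)
Lemma eigenvalues_border n (lam mu : seq R) (v : 'cV[KR]_n) :
  size lam = n -> sorted <%R lam -> interlace lam mu ->
  (forall i : 'I_n, base_nsq (v i 0) = nth 0 (border lam mu) i.+1) ->
  eigenvalues (bordered (real_diag K (fun i : 'I_n => nth 0 lam i)) v
    (nth 0 (border lam mu) 0)) = mu :> seq R.
Proof.
move=> sl slam imu vE; rewrite eigenvalues_bordered_phase.
have sm := size_interlace imu.
have -> : \col_i base_real K (Num.sqrt (base_nsq (v i 0))) =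
    \col_i base_real K (Num.sqrt (nth 0 (border lam mu) i.+1)).
  by apply/colP => i; rewrite !mxE vE.
apply: eigenvalues_secular => //; rewrite ?size_border ?sm ?sl//.
- exact: interlace_sorted imu.
- exact: border_pos.
- move=> m mmu; have ml := interlace_notin imu slam mmu; split=> //.
  rewrite secular_border// (big_rem m)//= subrr mul0r mul0r//.
Qed.

End bordered_matrices.

(** * Measurability of the eigenvalues *)

Section power_sums.
Context (R : realType) d (X : measurableType d).
Local Notation T := (measurableTypeR R).

(* The largest of the numbers is at most [t] iff their m-th power sum is at *)
(* most [n t^m] for all m.                                                  *)
Lemma measurable_power_sums n (f : nat -> X -> T) :
  (forall i j x, (i <= j < n)%N -> f i x <= f j x) ->
  (forall i x, (i < n)%N -> 0 <= f i x) ->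
  (forall m, measurable_fun setT (fun x => \sum_(i < n) f i x ^+ m : T)) ->
  forall i, (i < n)%N -> measurable_fun setT (f i).
Proof.
elim: n => // n IH f_mono f0 mP.
(* Once the largest function is measurable, subtracting its powers leaves the power sums of the
   others. *)
suff mn : measurable_fun setT (f n).
  move=> i; rewrite ltnS leq_eqVlt => /predU1P[->//|]; move: i.
  apply: IH => [i j x /andP[ij jn]|i x i_n|m].
  - by apply: f_mono; rewrite ij ltnW.
  - by apply: f0; rewrite ltnW.
  - have := measurable_funB (mP m) (measurable_funX m mn).
    by apply: eq_measurable_fun => x _ /=; rewrite big_ord_recr/= addrK.
move=> mD; apply: (measurability _ (RGenOInfty.measurableE R)) => //.
move=> _ [_ [t ->] <-]; rewrite setTI {mD}.
have [t0|t0] := ltP t 0.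
  rewrite [X in measurable X](_ : _ = setT)//; apply/seteqP; split=> // x _ /=.
  by rewrite in_itv/= andbT (lt_le_trans t0)// f0.
rewrite [X in measurable X](_ : _ = \bigcup_m
  ((fun x => \sum_(i < n.+1) f i x ^+ m : T) @^-1` `]n.+1%:R * t ^+ m, +oo[%classic)).
  apply: bigcup_measurable => m _; rewrite -[X in measurable X]setTI.
  exact: mP.
apply/seteqP; split=> x /=; last first.
  move=> [m _] /=; rewrite !in_itv/= !andbT; apply: contraTT; rewrite -!leNgt => fnt.
  apply: (@le_trans _ _ (\sum_(i < n.+1) t ^+ m)).
    apply: ler_sum => i _; apply: lerXn2r; rewrite ?nnegrE ?f0//.
    by apply: le_trans fnt; apply: f_mono; rewrite -ltnS ltn_ord /=.
  by rewrite sumr_const card_ord mulr_natl.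
rewrite in_itv/= andbT => tf.
have big m : f n x ^+ m <= \sum_(i < n.+1) f i x ^+ m.
  rewrite big_ord_recr/= lerDr; apply: sumr_ge0 => i _; rewrite exprn_ge0// f0//.
  by rewrite ltnW// ltnS.
have [t00|t_neq0] := eqVneq t 0.
  exists 1%N => //=; rewrite in_itv/= andbT expr1 t00 mulr0 (lt_le_trans _ (big 1%N))//.
  by rewrite expr1 -t00.
have t_gt0 : 0 < t by rewrite lt_neqAle eq_sym t_neq0.
(* Then f n x = (1 + h) t, and by Bernoulli's inequality (1 + h)^m >= 1 + m h exceeds n + 1 for the
   m chosen below. *)
pose h := f n x / t - 1.
have h0 : 0 < h by rewrite subr_gt0 ltr_pdivlMr// mul1r.
pose m := (Num.truncn (n.+1%:R / h)).+1.
have mh : n.+1%:R < m%:R * h.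
  rewrite -ltr_pdivrMr//; exact: truncnS_gt.
exists m => //=; rewrite in_itv/= andbT (lt_le_trans _ (big m))//.
have -> : f n x = (1 + h) * t by rewrite /h addrC subrK divfK.
rewrite exprMn ltr_pM2r ?exprn_gt0// (lt_le_trans mh)//.
have bern k : 1 + k%:R * h <= (1 + h) ^+ k.
  elim: k => [|k IHk]; first by rewrite mul0r addr0 expr0.
  rewrite exprS; apply: (@le_trans _ _ ((1 + h) * (1 + k%:R * h))).
    rewrite -natr1; have : 0 <= k%:R * h * h by rewrite !mulr_ge0// ltW.
    lra.
  by rewrite ler_wpM2l// addr_ge0// ltW.
by apply: le_trans (bern m); rewrite lerDr.
Qed.

End power_sums.

Section measurable_base.
Context (R : realType) (K : base_algebra) d (X : measurableType d).
Local Notation T := (measurableTypeR R).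
Local Notation KR := (base_ring R K).
Implicit Types f g : X -> KR.

Definition measurable_base f :=
  forall c, measurable_fun setT (fun x => nth 0 (base_coords (f x)) c : T).

Lemma measurable_baseD f g : measurable_base f -> measurable_base g ->
  measurable_base (fun x => f x + g x).
Proof.
move=> mf mg c; have := measurable_funD (mf c) (mg c).
apply: eq_measurable_fun => x _ /=; move: (f x) (g x); clear f g mf mg.
rewrite /base_coords /base_ring; case: K => [a b|[a1 a2] [b1 b2]|[a1 a2 a3 a4] [b1 b2 b3 b4]];
by move: c => [|[|[|[|c]]]] //=; rewrite ?nth_nil ?addr0.
Qed.

Lemma measurable_base_cst (k : KR) : measurable_base (fun=> k).
Proof. by move=> c; exact: measurable_cst. Qed.

Lemma measurable_base_sum I (r : seq I) (P : pred I) (F : I -> X -> KR) :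
  (forall i, P i -> measurable_base (F i)) ->
  measurable_base (fun x => \sum_(i <- r | P i) F i x).
Proof.
move=> mF; elim: r => [|i r IHr].
  by under [X in measurable_base X]eq_fun do rewrite big_nil; exact: measurable_base_cst.
have [Pi|/negbTE Pi] := boolP (P i); last first.
  by under [X in measurable_base X]eq_fun do rewrite big_cons Pi.
under [X in measurable_base X]eq_fun do rewrite big_cons Pi.
exact: measurable_baseD (mF _ Pi) IHr.
Qed.

Lemma measurable_base_conj f : measurable_base f -> measurable_base (fun x => base_conj (f x)).
Proof.
move=> mf c; have mfc := mf c.
have mN : measurable_fun setT (fun x => - nth 0 (base_coords (f x)) c : T).
  exact: measurableT_comp mfc.
suff [E|E] : (forall y : KR, nth 0 (base_coords (base_conj y)) c = nth 0 (base_coords y) c) \/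
   (forall y : KR, nth 0 (base_coords (base_conj y)) c = - nth 0 (base_coords y) c).
- by apply: eq_measurable_fun mfc => x _; rewrite E.
- by apply: eq_measurable_fun mN => x _; rewrite E.
clear mf mN mfc; rewrite /base_coords /base_conj /base_ring; case: K; move: c => [|[|[|[|c]]]] /=;
  first [by left; case|by right; case|by left => y; rewrite ?nth_nil].
Qed.

Lemma measurable_baseM f g : measurable_base f -> measurable_base g ->
  measurable_base (fun x => f x * g x).
Proof.
move=> mf mg c.
have mfg i j : measurable_fun setT
  (fun x => nth 0 (base_coords (f x)) i * nth 0 (base_coords (g x)) j : T).
  by apply: measurable_funM; [exact: mf|exact: mg].
(* Each coordinate of a product is a bilinear form in the coordinates; a triple holds a coefficient
   and the two indices, read off the multiplication table. *)
suff [l lE] : exists l : seq (R * nat * nat), forall x y : KR,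
    nth 0 (base_coords (x * y)) c =
    \sum_(p <- l) p.1.1 * (nth 0 (base_coords x) p.1.2 * nth 0 (base_coords y) p.2).
  apply: (@eq_measurable_fun _ _ _ _ _ (fun x => \sum_(p <- l)
    p.1.1 * (nth 0 (base_coords (f x)) p.1.2 * nth 0 (base_coords (g x)) p.2) : T)).
    by move=> x _; rewrite lE.
  apply: measurable_sum => p.
  by apply: measurable_funM => //; exact: mfg.
clear mf mg mfg; rewrite /base_coords /base_ring.
case: K; move: c => [|[|[|[|c]]]].
- by exists [:: (1, 0%N, 0%N)] => x y; rewrite big_seq1 /= mul1r.
1-4: by exists [::] => x y; rewrite big_nil.
- exists [:: (1, 0%N, 0%N); (-1, 1%N, 1%N)] => -[a1 a2] [b1 b2].
  by rewrite !big_cons big_nil /=; ring.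
- exists [:: (1, 0%N, 1%N); (1, 1%N, 0%N)] => -[a1 a2] [b1 b2].
  by rewrite !big_cons big_nil /=; ring.
1-3: by exists [::] => -[a1 a2] [b1 b2]; rewrite big_nil.
- exists [:: (1, 0%N, 0%N); (-1, 1%N, 1%N); (-1, 2%N, 2%N); (-1, 3%N, 3%N)] => -[a1 a2 a3 a4] [b1 b2 b3 b4].
  by rewrite !big_cons big_nil /=; ring.
- exists [:: (1, 0%N, 1%N); (1, 1%N, 0%N); (1, 2%N, 3%N); (-1, 3%N, 2%N)] => -[a1 a2 a3 a4] [b1 b2 b3 b4].
  by rewrite !big_cons big_nil /=; ring.
- exists [:: (1, 0%N, 2%N); (-1, 1%N, 3%N); (1, 2%N, 0%N); (1, 3%N, 1%N)] => -[a1 a2 a3 a4] [b1 b2 b3 b4].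
  by rewrite !big_cons big_nil /=; ring.
- exists [:: (1, 0%N, 3%N); (1, 1%N, 2%N); (-1, 2%N, 1%N); (1, 3%N, 0%N)] => -[a1 a2 a3 a4] [b1 b2 b3 b4].
  by rewrite !big_cons big_nil /=; ring.
- by exists [::] => -[a1 a2 a3 a4] [b1 b2 b3 b4]; rewrite big_nil /= nth_nil.
Qed.

Lemma measurable_base_of_coords (a : X -> nat -> R) :
  (forall i, measurable_fun setT (fun x => a x i : T)) ->
  measurable_base (fun x => base_of_coords K (a x)).
Proof.
move=> ma c; have [cd|cd] := ltnP c (base_dim K).
  by apply: eq_measurable_fun (ma c) => x _; rewrite base_of_coordsK.
apply: (@eq_measurable_fun _ _ _ _ _ (fun=> 0 : T)) => // x _.
rewrite nth_default//; apply: leq_trans cd.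
by rewrite /base_coords /base_of_coords; case: K.
Qed.

End measurable_base.

(** * Traces of powers and power sums of eigenvalues *)

Section trace_powers.
Context (R : realType) (K : base_algebra).
Local Notation KR := (base_ring R K).

Definition mx_pow n (A : 'M[KR]_n) m : 'M[KR]_n := iter m (mulmx A) 1%:M.

Lemma base_re_tr n (A : 'M[KR]_n) : base_re (\tr A) = \sum_i base_re (A i i).
Proof. by rewrite /mxtrace base_re_sum. Qed.

(** Over a noncommutative K it is the real part of the trace that is cyclic, hence invariant under
    unitary conjugation. *)
Lemma base_re_trC m n (A : 'M[KR]_(m, n)) (B : 'M[KR]_(n, m)) :
  base_re (\tr (A *m B)) = base_re (\tr (B *m A)).
Proof.
rewrite !base_re_tr; under eq_bigr do rewrite mxE base_re_sum.
rewrite exchange_big /=; apply: eq_bigr => i _; rewrite mxE base_re_sum.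
by apply: eq_bigr => j _; rewrite base_reC.
Qed.

Lemma mx_pow_conj n (A U : 'M[KR]_n) m : Defs.is_unitary U ->
  mx_pow (adjoint_mx U *m A *m U) m = adjoint_mx U *m mx_pow A m *m U.
Proof.
move=> [UU UU']; elim: m => [|m IH]; first by rewrite /= mulmx1 UU.
by rewrite /= IH !mulmxA -(mulmxA _ U) UU' mulmx1.
Qed.

Lemma mx_pow_real_diag n (s : 'I_n -> R) m :
  mx_pow (real_diag K s) m = real_diag K (fun i => s i ^+ m).
Proof.
elim: m => [|m IH] /=.
  by apply/matrixP => i j; rewrite real_diagE mxE expr0 base_real1; case: eqP.
apply/matrixP => i j; rewrite IH real_diag_mulE !real_diagE exprS base_realM.
by case: eqP; rewrite ?mulr0// => ->.
Qed.

Lemma re_tr_mx_pow n (A : 'M[KR]_n) m : adjoint_mx A = A ->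
  base_re (\tr (mx_pow A m)) = \sum_(i < n) nth 0 (eigenvalues A) i ^+ m.
Proof.
move=> hA; have [_ [U uU EU]] := eigenvaluesP hA.
have -> : base_re (\tr (mx_pow A m)) = base_re (\tr (mx_pow (real_diag K (tnth (eigenvalues A))) m)).
  by rewrite -EU mx_pow_conj// base_re_trC mulmxA; case: uU => _ ->; rewrite mul1mx.
rewrite mx_pow_real_diag base_re_tr; apply: eq_bigr => i _.
by rewrite real_diagE eqxx base_re_real (tnth_nth 0).
Qed.

End trace_powers.

Section coordinate_matrices.
Context (R : realType) (K : base_algebra).
Local Notation KR := (base_ring R K).
Local Notation d := (base_dim K).

Definition hlower (s : seq R) k l : KR :=
  base_of_coords K (fun c => nth 0 s (herm_offset K k + d * l + c)).

(** On plain sequences one s describes all the upper left blocks, since [hmx j s] reads only the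
    first [herm_dim K j] coordinates. *)
Definition hmx n (s : seq R) : 'M[KR]_n :=
  \matrix_(k, l) if (l < k)%N then hlower s k l
                 else if (k < l)%N then base_conj (hlower s l k)
                 else base_real K (nth 0 s (herm_offset K k + d * k)).

Lemma hmx_hermitian n s : adjoint_mx (hmx n s) = hmx n s.
Proof.
apply/matrixP => k l; rewrite adjoint_mxE !mxE.
case: (ltngtP k l) => [//|lk|kl]; first by rewrite base_conjK.
by rewrite kl base_conj_real.
Qed.

Lemma hmx_tuple n (x : (herm_dim K n).-tuple (measurableTypeR R)) :
  herm_mx_of_coords x = hmx n x.
Proof. by []. Qed.

Lemma left_upper_block_hmx n s (j : 'I_n) : left_upper_block (hmx n s) j = hmx j.+1 s.
Proof. by apply/matrixP => k l; rewrite !mxE. Qed.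

Definition eigs n s : seq R := eigenvalues (hmx n s).

Lemma size_eigs n s : size (eigs n s) = n.
Proof. by rewrite size_tuple. Qed.

Lemma eq_hmx n s t : (forall i, (i < herm_dim K n)%N -> nth 0 s i = nth 0 t i) ->
  hmx n s = hmx n t.
Proof.
move=> st; have lowE (k l : nat) : (l < k)%N -> (k < n)%N -> hlower s k l = hlower t k l.
  move=> lk kn; apply: base_of_coords_ext => c cd; apply: st.
  apply: leq_trans (leq_herm_offset K kn); rewrite herm_offsetS -addnA ltnS leq_add2l.
  apply: leq_trans (_ : d * l.+1 <= _)%N; last by rewrite leq_mul2l lk orbT.
  by rewrite mulnS; lia.
apply/matrixP => k l; rewrite !mxE.
case: (ltngtP k l) => [kl|lk|kl]; rewrite ?lowE// st//.
by apply: leq_trans (leq_herm_offset K (ltn_ord k)); rewrite herm_offsetS.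
Qed.

Context dX (X : measurableType dX).
Local Notation T := (measurableTypeR R).

Lemma measurable_hlower m (G : X -> seq R) k l : measurable_seq m G ->
  measurable_base (fun x => hlower (G x) k l).
Proof. by move=> [_ mG]; apply: measurable_base_of_coords => i; exact: mG. Qed.

Lemma measurable_hmx m (G : X -> seq R) n k l : measurable_seq m G ->
  measurable_base (fun x => hmx n (G x) k l).
Proof.
move=> mG; under [X in measurable_base X]eq_fun do rewrite mxE.
have [lk|] := ltnP l k; first exact: measurable_hlower mG.
have [kl _|_ _] := ltnP k l; first exact: measurable_base_conj (measurable_hlower _ _ mG).
apply: measurable_base_of_coords => -[|i]; last exact: measurable_cst.
exact: mG.2.
Qed.

Lemma measurable_mx_pow m (G : X -> seq R) n p k l : measurable_seq m G ->
  measurable_base (fun x => mx_pow (hmx n (G x)) p k l).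
Proof.
move=> mG; elim: p k l => [|p IH] k l; first exact: measurable_base_cst.
under [X in measurable_base X]eq_fun do rewrite /= mxE.
apply: measurable_base_sum => i _; apply: measurable_baseM; last exact: IH.
exact: measurable_hmx mG.
Qed.

Lemma measurable_eigs m (G : X -> seq R) n : measurable_seq m G ->
  measurable_seq n (fun x => eigs n (G x)).
Proof.
move=> mG; split=> [x|i]; first exact: size_eigs.
have [i_n|ni] := ltnP i n; last first.
  apply: (@eq_measurable_fun _ _ _ _ _ (fun=> 0 : T)) => // x _.
  by rewrite nth_default// size_eigs.
pose P p x := \sum_(i < n) nth 0 (eigs n (G x)) i ^+ p.
have mP p : measurable_fun setT (P p : X -> T).
  apply: (@eq_measurable_fun _ _ _ _ _
    (fun x => \sum_i base_re (mx_pow (hmx n (G x)) p i i) : T)).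
    by move=> x _; rewrite -base_re_tr re_tr_mx_pow// hmx_hermitian.
  by apply: measurable_sum => k; exact: (measurable_mx_pow p k k mG 0%N).
(* [measurable_power_sums] asks for nonnegative functions. As a^2 + a + 1 >= 0, adding 1 and the sum
   of all squared eigenvalues suffices, and this shift is itself measurable. *)
pose c x := P 2%N x + 1.
have mc : measurable_fun setT (c : X -> T) by apply: measurable_funD; [exact: mP|exact: measurable_cst].
suff mf : measurable_fun setT (fun x => nth 0 (eigs n (G x)) i + c x : T).
  by have := measurable_funB mf mc; apply: eq_measurable_fun => x _ /=; rewrite addrK.
apply: (measurable_power_sums (f := fun i x => nth 0 (eigs n (G x)) i + c x)) i_n.
- move=> k l x /andP[kl ln]; rewrite lerD2r.
  by apply: nth_eigenvalues_le => //; exact: hmx_hermitian.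
- move=> k x kn; rewrite /c /P (bigD1 (Ordinal kn))//=.
  set a := nth _ _ _; set S := \sum_(_ < _ | _) _.
  have S0 : 0 <= S by apply: sumr_ge0 => l _; exact: sqr_ge0.
  by have := sqr_ge0 (a + 1); have := sqr_ge0 a; nra.
- move=> p; apply: (@eq_measurable_fun _ _ _ _ _
    (fun x => \sum_(k < p.+1) P (p - k)%N x * c x ^+ k * 'C(p, k)%:R : T)).
    move=> x _; transitivity (\sum_(l < n) (nth 0 (eigs n (G x)) l + c x) ^+ p) => //.
    under [RHS]eq_bigr do rewrite exprDn.
    rewrite exchange_big/=; apply: eq_bigr => k _.
    by rewrite /P sumrMnl mulr_natr mulr_suml.
  apply: measurable_sum => k; apply: measurable_funM; last exact: measurable_cst.
  by apply: measurable_funM; [exact: mP|exact: measurable_funX].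
Qed.

End coordinate_matrices.

(** * Integration over the last row *)

Section last_row.
Context (R : realType) (K : base_algebra).
Local Notation KR := (base_ring R K).
Local Notation d := (base_dim K).
Local Notation d0 := (base_dim_gt0 K).

(** The coordinates describe the last row, whereas [bordered] takes the last column, hence the
    conjugate. *)
Definition row_vec n (b : seq R) : 'cV[KR]_n :=
  \col_k base_conj (base_of_coords K (fun c => nth 0 b (d * k + c))).

Definition vec_row n (v : 'cV[KR]_n) : seq R :=
  mkseq (fun i => if insub (i %/ d)%N is Some k
    then nth 0 (base_coords (base_conj (v k 0))) (i %% d)%N else 0) (d * n).

Lemma nth_vec_row n (v : 'cV[KR]_n) (k : 'I_n) c : (c < d)%N ->
  nth 0 (vec_row v) (d * k + c) = nth 0 (base_coords (base_conj (v k 0))) c.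
Proof.
move=> cd; have kcn : (d * k + c < d * n)%N.
  by apply: (@leq_trans (d * k.+1)); rewrite ?leq_mul2l ?ltn_ord ?orbT// mulnS; lia.
rewrite nth_mkseq// mulnC divnMDl ?d0// divn_small// addn0 modnMDl modn_small//.
by rewrite valK.
Qed.

Lemma vec_rowK n : cancel (@vec_row n) (@row_vec n).
Proof.
move=> v; apply/colP => k; rewrite mxE -[RHS]base_conjK; congr base_conj.
rewrite -[RHS]base_coordsK; apply: base_of_coords_ext => c cd.
by rewrite nth_vec_row.
Qed.

Lemma row_vecK n b : size b = (d * n)%N -> vec_row (row_vec n b) = b.
Proof.
move=> sb; apply: (@eq_from_nth _ 0); rewrite size_mkseq// => i id.
have kn : (i %/ d < n)%N by rewrite ltn_divLR ?d0// mulnC.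
rewrite {1}(divn_eq i d) mulnC (@nth_vec_row _ _ (Ordinal kn)) ?ltn_mod ?d0//.
rewrite mxE base_conjK base_of_coordsK ?ltn_mod ?d0//=.
by rewrite mulnC -divn_eq.
Qed.

Lemma row_vecD n s t :
  row_vec n (mkseq (fun i => nth 0 s i + nth 0 t i) (d * n)) = row_vec n s + row_vec n t.
Proof.
apply/colP => k; rewrite !mxE -base_conjD; congr base_conj.
rewrite -[base_of_coords K (fun c => nth 0 s (d * k + c))]mul1r -base_real1 -base_of_coordsD.
apply: base_of_coords_ext => c cd; rewrite mul1r nth_mkseq//.
by apply: (@leq_trans (d * k.+1)); rewrite ?leq_mul2l ?ltn_ord ?orbT// mulnS; lia.
Qed.

Lemma sumsq_vec_row n (v : 'cV[KR]_n) : sumsq (vec_row v) = vec_nsq v.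
Proof.
have size_coords (x : KR) : size (base_coords x) = d.
  by move: x; rewrite /base_coords /base_ring; case: K => //= -[].
have -> : vec_row v = flatten [seq base_coords (base_conj (v k 0)) | k <- enum 'I_n].
  apply: (@eq_from_nth _ 0) => [|i].
    rewrite size_mkseq size_flatten /shape -map_comp sumnE big_map big_enum /=.
    by under eq_bigr do rewrite size_coords; rewrite sum_nat_const card_ord mulnC.
  rewrite size_mkseq => id.
  have kn : (i %/ d < n)%N by rewrite ltn_divLR ?d0// mulnC.
  rewrite {1}(divn_eq i d) mulnC (@nth_vec_row _ _ (Ordinal kn)) ?ltn_mod ?d0//.
  set ss := [seq _ | _ <- _].
  have shE : shape ss = nseq n d.
    rewrite -[in RHS](size_enum_ord n) /shape -map_comp.
    by elim: (enum _) => //= k e ->; rewrite size_coords.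
  have iE : i = flatten_index (shape ss) (i %/ d)%N (i %% d)%N.
    have tk : take (i %/ d)%N (nseq n d) = nseq (i %/ d)%N d.
      by rewrite take_nseq// ltnW.
    by rewrite /flatten_index shE tk sumn_nseq mulnC -divn_eq.
  have jd : (i %% d < nth 0 (shape ss) (i %/ d))%N by rewrite shE nth_nseq kn ltn_mod d0.
  rewrite [in RHS]iE nth_flatten flatten_indexKl// flatten_indexKr//.
  by rewrite (nth_map (Ordinal kn)) ?size_enum_ord// (@nth_ord_enum _ _ (Ordinal kn)).
rewrite /sumsq big_flatten big_map big_enum /=; apply: eq_bigr => k _.
by rewrite -base_nsq_conj.
Qed.

Lemma base_nsq_row_vec n b (k : 'I_n) :
  base_nsq (row_vec n b k 0) = nth 0 (sqnorms d n b) k.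
Proof.
rewrite mxE base_nsq_conj nth_mkseq// /base_nsq (big_nth 0) big_mkord.
have -> : size (base_coords (base_of_coords K (fun c => nth 0 b (d * k + c)))) = d.
  by rewrite /base_coords /base_of_coords; case: K.
by apply: eq_bigr => c _; rewrite base_of_coordsK.
Qed.

Lemma hmx_last_row n s b c : size s = herm_dim K n -> size b = (d * n)%N ->
  hmx K (n + 1) (s ++ rcons b c) = bordered (hmx K n s) (row_vec n b) c.
Proof.
move=> ss sb.
have nth_b i : (i < d * n)%N -> nth 0 (s ++ rcons b c) (herm_offset K n + i) = nth 0 b i.
  by move=> id; rewrite nth_cat ss ltnNge leq_addr/= addKn nth_rcons sb id.
have lowE l : (l < n)%N ->
    hlower K (s ++ rcons b c) n l = base_of_coords K (fun e => nth 0 b (d * l + e)).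
  move=> ln; apply: base_of_coords_ext => e ed; rewrite -addnA nth_b//.
  by apply: (@leq_trans (d * l.+1)); rewrite ?leq_mul2l ?ln ?orbT// mulnS; lia.
rewrite -[LHS]submxK /bordered.
have -> : ulsubmx (hmx K (n + 1) (s ++ rcons b c)) = hmx K n (s ++ rcons b c).
  by apply/matrixP => k l; rewrite !mxE.
congr block_mx.
- by apply: eq_hmx => i iD; rewrite nth_cat ss iD.
- apply/matrixP => k l; rewrite !mxE ord1/= addn0 ltnNge ltnW ?ltn_ord//=.
  by rewrite ?ltn_ord lowE.
- apply/matrixP => k l; rewrite adjoint_mxE !mxE ord1/= addn0 ltn_ord base_conjK.
  by rewrite lowE.
- apply/matrixP => k l; rewrite !mxE !ord1/= addn0 ltnn ?eqxx ?mulr1n; congr base_real.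
  by rewrite nth_cat ss ltnNge leq_addr/= addKn nth_rcons sb ltnn eqxx.
Qed.

End last_row.

Section fiber.
Context (R : realType) (K : base_algebra).
Local Notation KR := (base_ring R K).
Local Notation d := (base_dim K).
Local Notation T := (measurableTypeR R).

Lemma diagonal_coordinates n (lam : 'I_n -> R) :
  exists2 s, size s = herm_dim K n & hmx K n s = real_diag K lam.
Proof.
have hD : is_hermitian (real_diag K lam) by apply/eqP; exact: adjoint_real_diag.
have [x xE] := herm_of_coords_surj (Herm hD).
exists x; first exact: size_tuple.
by rewrite -hmx_tuple; exact: (congr1 (@herm_mx _ _ _) xE).
Qed.

Lemma eigs_last_row n s b c : size s = herm_dim K n -> size b = (d * n)%N ->
  eigs K n.+1 (s ++ rcons b c) = eigenvalues (bordered (hmx K n s) (row_vec K n b) c) :> seq R.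
Proof. by move=> ss sb; rewrite -addn1 /eigs hmx_last_row. Qed.

Lemma vec_rowB n (v w : 'cV[KR]_n) :
  vec_row (v - w) = mkseq (fun i => nth 0 (vec_row v) i - nth 0 (vec_row w) i) (d * n).
Proof.
have coordsB (x y : KR) c : nth 0 (base_coords (base_conj (x - y))) c =
    nth 0 (base_coords (base_conj x)) c - nth 0 (base_coords (base_conj y)) c.
  move: x y; rewrite /base_coords /base_conj /base_ring.
  case: K => [a b|[a1 a2] [b1 b2]|[a1 a2 a3 a4] [b1 b2 b3 b4]];
  by move: c => [|[|[|[|c]]]] //=; rewrite ?nth_nil ?subr0 ?opprD ?opprK.
apply: (@eq_from_nth _ 0); rewrite !size_mkseq// => i id; rewrite !nth_mkseq//.
by case: insubP => [k _ _|_]; rewrite ?subr0// !mxE coordsB.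
Qed.

Lemma measurable_vec_row dX (X : measurableType dX) n (v : X -> 'cV[KR]_n) :
  (forall k, measurable_base (fun x => v x k 0)) ->
  measurable_seq (d * n) (fun x => vec_row (v x)).
Proof.
move=> mv; apply: measurable_seq_mkseq => i.
case: insubP => [k _ _|_]; last exact: measurable_cst.
exact: measurable_base_conj (mv k) _.
Qed.

Lemma measurable_row_vec dX (X : measurableType dX) m (G : X -> seq R) n k :
  measurable_seq m G -> measurable_base (fun x => row_vec K n (G x) k 0).
Proof.
move=> [_ mG]; under [X in measurable_base X]eq_fun do rewrite mxE.
by apply: measurable_base_conj; apply: measurable_base_of_coords => i; exact: mG.
Qed.

Lemma measurable_base_mulmx dX (X : measurableType dX) m n (A : 'M[KR]_(m, n))
    (v : X -> 'cV[KR]_n) : (forall k, measurable_base (fun x => v x k 0)) ->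
  forall k, measurable_base (fun x => (A *m v x) k 0).
Proof.
move=> mv k; under [X in measurable_base X]eq_fun do rewrite mxE.
by apply: measurable_base_sum => i _; apply: measurable_baseM => //; exact: measurable_base_cst.
Qed.

Lemma tmeasurable_tint_cat m n (F : seq R -> \bar R) : tmeasurable (m + n) F ->
  (forall s, 0 <= F s)%E -> tmeasurable m (fun s => tint n (fun t => F (s ++ t))).
Proof.
move=> mF F0.
exact: (@measurable_tint _ n _ _ (fun (s : m.-tuple T) t => F (s ++ t))
  (fun _ _ => F0 _) (tmeasurable_cat mF)).
Qed.

Lemma tmeasurable_eigs_cat n s p (g : seq R -> \bar R) : tmeasurable n.+1 g ->
  tmeasurable p (fun t => g (eigs K n.+1 (s ++ t))).
Proof.
move=> mg; apply: (measurable_comp_seq mg).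
apply: (@measurable_eigs _ _ _ _ (size s + p)).
apply: measurable_seq_cat; first exact: measurable_seq_cst.
exact: measurable_seq_tval.
Qed.

Lemma size1E (u : seq R) : size u = 1%N -> u = [:: nth 0 u 0].
Proof. by case: u => [|x []]. Qed.

(** Diagonalizing the block by U replaces the last column v by U^* v, an isometry in the
    coordinates, to which [tint_isometry] applies. *)
Lemma tint_eigs_diag n s s' (g : seq R -> \bar R) :
  size s = herm_dim K n -> size s' = herm_dim K n ->
  hmx K n s' = real_diag K (fun i : 'I_n => nth 0 (eigs K n s) i) ->
  tmeasurable n.+1 g -> (forall mu, 0 <= g mu)%E ->
  tint (d * n + 1) (fun t => g (eigs K n.+1 (s ++ t))) =
  tint (d * n + 1) (fun t => g (eigs K n.+1 (s' ++ t))).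
Proof.
move=> ss ss' s'E mg g0; have hA := hmx_hermitian K n s.
have [_ [U uU EU]] := eigenvaluesP hA.
rewrite !tint_cat; try by move=> *; exact: g0.
2,3: exact: tmeasurable_eigs_cat.
pose H b := tint 1 (fun u => g (eigs K n.+1 (s' ++ (b ++ u)))).
(* [M] is minus the inverse of [L]: it is the translation that [tint_isometry] asks for. *)
pose L b := vec_row (adjoint_mx U *m row_vec K n b).
pose M b := vec_row (- (U *m row_vec K n b)).
rewrite -[RHS]/(tint (d * n) H) -(@tint_isometry _ _ L M H); first last.
- by move=> b; exact: tint_ge0.
- apply: (tmeasurable_tint_cat (F := fun t => g (eigs K n.+1 (s' ++ t)))) => //.
  exact: tmeasurable_eigs_cat.
- by move=> b sb; rewrite sumsq_vec_row vec_nsq_isometry -?sumsq_vec_row ?row_vecK//; case: (unitary_adjoint uU).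
- move=> b t sb st; rewrite /L row_vecD vec_rowK mulmxDr mulmxN mulmxA.
  have [-> _] := uU; rewrite mul1mx.
  by rewrite vec_rowB row_vecK.
- by move=> b sb; rewrite size_mkseq.
- apply: measurable_vec_row; apply: measurable_base_mulmx => k.
  apply: measurable_row_vec; exact: measurable_seq_tval.
apply: eq_tint => b sb; apply: eq_tint => u /size1E ->.
rewrite !cats1 !eigs_last_row ?size_mkseq// vec_rowK s'E.
congr g; rewrite -(eigenvalues_bordered _ _ hA uU) EU.
have -> : real_diag K (tnth (eigenvalues (hmx K n s))) =
    real_diag K (fun i : 'I_n => nth 0 (eigs K n s) i).
  by apply/matrixP => i j; rewrite !real_diagE (tnth_nth 0).
by [].
Qed.

Lemma powR_prod (r : seq R) (e : R) : positive_seq r ->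
  \prod_(x <- r) x `^ e = (\prod_(x <- r) x) `^ e.
Proof.
elim: r => [|x r IH] /=; first by rewrite !big_nil powR1.
case/andP=> x0 r0; rewrite !big_cons IH// powRM ?(ltW x0)//.
by rewrite big_seq prodr_ge0// => y yr; exact/ltW/(allP r0).
Qed.

(* The absolute value makes the weight nonnegative on all sequences; on sorted *)
(* ones it does nothing.                                                       *)
Definition step_weight (theta : R) (lam mu : seq R) : R :=
  (\prod_(a <- lam) \prod_(p <- mu) `|a - p| `^ (theta - 1)) /
  vand lam `^ (2 * theta - 2) * `|vand mu / vand lam|.

Lemma step_weight_ge0 theta lam mu : 0 <= step_weight theta lam mu.
Proof.
rewrite !mulr_ge0// ?invr_ge0 ?powR_ge0//.
by apply: prodr_ge0 => a _; apply: prodr_ge0 => p _; exact: powR_ge0.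
Qed.

(** The powers theta - 1 of the residues multiply to that of their product, evaluated by
    [prod_border]; the square in it produces the exponent 2 theta - 2. *)
Lemma radial_weight_border lam mu : interlace lam mu -> sorted <%R lam ->
  radial_weight d (behead (border lam mu)) * border_jac lam mu =
  step_weight (base_theta R K) lam mu.
Proof.
move=> imu slam; rewrite /step_weight /radial_weight -/(base_theta R K); congr (_ * _); last first.
  by rewrite ger0_norm//; exact: border_jac_ge0.
rewrite powR_prod ?border_pos// prod_border//.
have V0 := vand_gt0 slam.
have nz : positive_seq [seq `|a - p| | a <- lam, p <- mu].
  apply/allP => _ /allpairsP[[a p] /= [al pm ->]]; rewrite normr_gt0 subr_eq0.
  by apply: contraNneq (interlace_notin imu slam pm) => <-.
have pp : \prod_(a <- lam) \prod_(p <- mu) `|a - p| `^ (base_theta R K - 1) =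
    (\prod_(a <- lam) \prod_(p <- mu) `|a - p|) `^ (base_theta R K - 1).
  have := powR_prod (base_theta R K - 1) nz; rewrite !big_allpairs_dep.
  done.
rewrite pp powRM ?invr_ge0 ?exprn_ge0 ?(ltW V0)//; last first.
  by apply: prodr_ge0 => a _; apply: prodr_ge0 => p _; exact: normr_ge0.
rewrite -powR_invn ?(ltW V0)// -powRrM; congr (_ * _).
by rewrite -powRN; congr (_ `^ _); lra.
Qed.

Let C : R := pi `^ base_theta R K / Gamma (base_theta R K).

Lemma tint_eigs_radial n s (lam : seq R) (g : seq R -> \bar R) :
  size s = herm_dim K n -> size lam = n -> sorted <%R lam ->
  hmx K n s = real_diag K (fun i : 'I_n => nth 0 lam i) ->
  tmeasurable n.+1 g -> (forall mu, 0 <= g mu)%E ->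
  tint (d * n + 1) (fun t => g (eigs K n.+1 (s ++ t))) =
  ((C ^+ n)%:E * tint n.+1 (fun mu => if interlace lam mu
    then g mu * (step_weight (base_theta R K) lam mu)%:E else 0))%E.
Proof.
move=> ss slam sorted_lam sE mg g0.
(* A representative of all rows with squared norms r: real nonnegative entries sqrt r_i. [G] is the
   resulting spectrum as a function of c :: r. *)
pose sqrt_row (r : seq R) := vec_row (\col_(i < n) base_real K (Num.sqrt (nth 0 r i))).
pose G (cr : seq R) := eigs K n.+1 (s ++ rcons (sqrt_row (behead cr)) (nth 0 cr 0)).
have GE c r : G (c :: r) = eigenvalues (bordered (real_diag K (fun i : 'I_n => nth 0 lam i))
    (\col_(i < n) base_real K (Num.sqrt (nth 0 r i))) c) :> seq R.
  by rewrite /G eigs_last_row ?size_mkseq// vec_rowK sE.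
have mG dX (X : measurableType dX) (H : X -> seq R) m : measurable_seq m H ->
    measurable_seq n.+1 (fun x => G (H x)).
  move=> mH; apply: (@measurable_eigs _ _ _ _ (size s + (d * n + 1))).
  apply: measurable_seq_cat; first exact: measurable_seq_cst.
  under [X in measurable_seq _ X]eq_fun do rewrite -cats1.
  apply: measurable_seq_cat.
    apply: measurable_vec_row => k; under [X in measurable_base X]eq_fun do rewrite mxE nth_behead.
    apply: measurable_base_of_coords => -[|i]; last exact: measurable_cst.
    exact: measurableT_comp (continuous_measurable_fun (@sqrt_continuous R)) (mH.2 _).
  apply: measurable_seq_cons (mH.2 0%N) _; exact: measurable_seq_cst [::].
pose h (r : seq R) := tint 1 (fun u => g (G (nth 0 u 0 :: r))).
have mgG dX (X : measurableType dX) (H : X -> seq R) m : measurable_seq m H ->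
    measurable_fun setT (fun x => g (G (H x))).
  by move=> mH; exact: measurable_comp_seq mg (mG _ _ _ _ mH).
have mpair dX (X : measurableType dX) m (f : X -> seq R) : measurable_seq m f ->
    measurable_fun setT (fun q : X * 1.-tuple T => g (G (nth 0 q.2 0 :: f q.1))).
  move=> mf; apply: (mgG _ _ (fun q : X * 1.-tuple T => nth 0 q.2 0 :: f q.1) m.+1).
  have m2 : measurable_seq 1 (fun q : X * 1.-tuple T => q.2 : seq R).
    by apply: measurable_seq_tval; exact: measurable_snd.
  apply: measurable_seq_cons; first exact: m2.2.
  exact: measurable_seq_comp measurable_fst mf.
have mh : tmeasurable n h.
  apply: (measurable_tint (F := fun (r : n.-tuple T) u => g (G (nth 0 u 0 :: r))) (fun _ _ => g0 _)).
  apply: mpair; exact: measurable_seq_tval.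
have h0 r : (0 <= h r)%E by exact: tint_ge0.
transitivity (tint (d * n) (fun b => h (sqnorms d n b))).
  rewrite tint_cat; first last.
  - by move=> t; exact: g0.
  - exact: tmeasurable_eigs_cat.
  apply: eq_tint => b sb; apply: eq_tint => u /size1E ->; congr g.
  rewrite cats1 eigs_last_row// GE sE eigenvalues_bordered_phase.
  have -> : \col_i base_real K (Num.sqrt (base_nsq (row_vec K n b i 0))) =
      \col_i base_real K (Num.sqrt (nth 0 (sqnorms d n b) i)).
    by apply/colP => i; rewrite [LHS]mxE [RHS]mxE base_nsq_row_vec.
  by [].
rewrite (tint_sqnorms (base_dim_gt0 K))//; congr (_ * _)%E.
pose Q cr := (if positive_seq (behead cr) then g (G cr) * (radial_weight d (behead cr))%:E else 0)%E.
have Q0 cr : (0 <= Q cr)%E.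
  by rewrite /Q; case: ifP => // _; rewrite mule_ge0// lee_fin radial_weight_ge0.
have mQ dX (X : measurableType dX) m (H : X -> seq R) : measurable_seq m.+1 H ->
    measurable_fun setT (fun x => Q (H x)).
  move=> mH; have mb := measurable_seq_behead mH; apply: measurable_fun_ifT => //.
    exact: measurable_positive_seq mb.
  apply: emeasurable_funM; first exact: mgG mH.
  exact/measurable_EFinP/(measurable_radial_weight d mb).
(* The corner is the last coordinate of the row but the first entry of [border], hence an exchange
   of the order of integration. *)
transitivity (tint n.+1 Q).
  rewrite -(add1n n) tint_cat//; last by apply: mQ; exact: measurable_seq_tval.
  rewrite tint_tint_exchange//; last first.
    apply: (mQ _ _ n (fun q : 1.-tuple T * n.-tuple T => q.1 ++ q.2)).
    by apply: (@measurable_seq_cat _ _ _ 1 n); apply: measurable_seq_tval; [exact: measurable_fst|exact: measurable_snd].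
  apply: eq_tint => r _; rewrite /Q; case: ifPn => r0.
    rewrite muleC -tintZ//; last first.
    - by rewrite lee_fin radial_weight_ge0.
    - apply: (mgG _ _ (fun u : 1.-tuple T => nth 0 u 0 :: r) (size r).+1).
      apply: measurable_seq_cons; [exact: measurable_nth|exact: measurable_seq_cst].
    by apply: eq_tint => u /size1E ->; rewrite /= r0 muleC.
  rewrite [LHS](_ : _ = tint 1 (fun=> 0)%E); last by rewrite /tint integral0.
  by apply: eq_tint => u /size1E ->; rewrite /= (negbTE r0).
rewrite -slam in mQ *.
rewrite -(@tint_border _ lam (fun cr => g (G cr) * (radial_weight d (behead cr))%:E)%E sorted_lam); last first.
- by move=> cr; rewrite mule_ge0// lee_fin radial_weight_ge0.
- have mt : measurable_seq (size lam).+1 (fun t : (size lam).+1.-tuple T => t : seq R) by exact: measurable_seq_tval.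
  apply: emeasurable_funM; first exact: mgG mt.
  have mb := measurable_seq_behead mt.
  by have /measurable_EFinP := measurable_radial_weight d mb; exact.
apply: eq_tint => mu smu; case: ifPn => // imu.
rewrite -muleA -EFinM radial_weight_border//; suff -> : G (border lam mu) = mu by [].
have sb : size (border lam mu) = n.+1 by rewrite (size_border smu) slam.
have [c [r bE]] : exists c r, border lam mu = c :: r.
  by case: (border lam mu) sb => // c r; exists c, r.
rewrite bE GE.
have := eigenvalues_border (v := \col_(i < n) base_real K (Num.sqrt (nth 0 r i))) slam sorted_lam imu.
rewrite bE /=; apply => i; rewrite mxE base_nsq_real sqr_sqrtr//.
have := border_pos imu sorted_lam; rewrite bE /= => /allP rp.
by apply/ltW/rp/mem_nth; move: sb; rewrite bE /= => -[->].
Qed.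
End fiber.

(** * Integration over all rows *)

Section triangle_measurability.
Context (R : realType).
Local Notation T := (measurableTypeR R).

Lemma interlaceE (lam mu : seq R) : size mu = (size lam).+1 -> interlace lam mu =
  all (fun i => (nth 0 mu i < nth 0 lam i) && (nth 0 lam i < nth 0 mu i.+1)) (iota 0 (size lam)).
Proof.
elim: lam mu => [|l lam IH] [|m mu] //=; first by case: mu.
move=> [smu]; rewrite IH// (iotaDl 1 0) all_map /= -andbA -nth0.
by congr (_ && (_ && _)); apply: eq_all.
Qed.

Lemma sorted_ltE (s : seq R) : sorted <%R s =
  all (fun i => nth 0 s i < nth 0 s i.+1) (iota 0 (size s).-1).
Proof.
apply/(sortedP 0)/allP => h i.
  rewrite mem_iota add0n ltn_predRL => is1; exact: h.
by move=> is1; apply: h; rewrite mem_iota add0n ltn_predRL.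
Qed.

Definition triangle_row j (L : seq R) : seq R := mkseq (fun i => nth 0 L ('C(j, 2) + i)) j.

(** Steps are counted from the empty row 0, which interlaces every one-element row, so that the
    induction over rows can start at n = 0. *)
Definition strict_triangle n (L : seq R) : bool :=
  all (fun j => interlace (triangle_row j L) (triangle_row j.+1 L)) (iota 0 n).

Definition triangle_weight (theta : R) n (L : seq R) : R :=
  \prod_(j < n) step_weight theta (triangle_row j L) (triangle_row j.+1 L).

Lemma size_triangle_row j L : size (triangle_row j L) = j. Proof. exact: size_mkseq. Qed.

Lemma triangle_row_cat n j L mu : size L = 'C(n.+1, 2) -> (j <= n)%N -> triangle_row j (L ++ mu) = triangle_row j L.
Proof.
move=> sL jn; apply: (@eq_from_nth _ 0); rewrite !size_triangle_row// => i ij.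
rewrite !nth_mkseq// nth_cat sL ifT//.
apply: leq_trans (_ : 'C(j.+1, 2) <= _)%N; last exact: leq_bin2l.
by rewrite binS bin1 ltn_add2l.
Qed.

Lemma triangle_row_last n L mu : size L = 'C(n, 2) -> size mu = n -> triangle_row n (L ++ mu) = mu.
Proof.
move=> sL sm; apply: (@eq_from_nth _ 0); rewrite size_triangle_row ?sm// => i i_n.
by rewrite nth_mkseq// nth_cat sL ltnNge leq_addr/= addKn.
Qed.

Lemma triangle_weight_ge0 theta n L : 0 <= triangle_weight theta n L.
Proof. by apply: prodr_ge0 => j _; exact: step_weight_ge0. Qed.

Lemma strict_triangle_cat n L mu : size L = 'C(n.+1, 2) -> size mu = n.+1 ->
  strict_triangle n.+1 (L ++ mu) = strict_triangle n L && interlace (triangle_row n L) mu.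
Proof.
move=> sL sm; rewrite /strict_triangle -addn1 iotaD all_cat /= andbT add0n.
rewrite (triangle_row_last sL sm) (triangle_row_cat _ sL)//; congr (_ && _).
apply: eq_in_all => j; rewrite mem_iota /= => jn.
by rewrite !(triangle_row_cat _ sL)// ltnW.
Qed.

Lemma triangle_weight_cat theta n L mu : size L = 'C(n.+1, 2) -> size mu = n.+1 ->
  triangle_weight theta n.+1 (L ++ mu) =
  triangle_weight theta n L * step_weight theta (triangle_row n L) mu.
Proof.
move=> sL sm; rewrite /triangle_weight big_ord_recr/= (triangle_row_last sL sm) (triangle_row_cat _ sL)//.
by congr (_ * _); apply: eq_bigr => j _; rewrite !(triangle_row_cat _ sL)// ltnW.
Qed.

Lemma strict_triangle_sorted n L : strict_triangle n L -> sorted <%R (triangle_row n L).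
Proof.
case: n => // n; rewrite /strict_triangle -addn1 iotaD all_cat /= andbT add0n addn1.
by case/andP=> _; exact: interlace_sorted.
Qed.

Context dX (X : measurableType dX).

Lemma measurable_all_seq I (r : seq I) (b : I -> X -> bool) :
  (forall i, measurable_fun setT (b i)) ->
  measurable_fun setT (fun x => all (fun i => b i x) r).
Proof.
move=> mb; elim: r => [|i r IH] /=; first exact: measurable_cst.
exact: measurable_and.
Qed.

Lemma measurable_interlace_pair n (G H : X -> seq R) :
  measurable_seq n G -> measurable_seq n.+1 H ->
  measurable_fun setT (fun x => interlace (G x) (H x)).
Proof.
move=> mG mH; under [X in measurable_fun _ X]eq_fun do
  rewrite interlaceE ?mG.1 ?mH.1//.
apply: measurable_all_seq => i; apply: measurable_and;
  apply: measurable_fun_ltr; by [exact: mG.2|exact: mH.2].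
Qed.

Lemma measurable_sorted_lt n (G : X -> seq R) : measurable_seq n G ->
  measurable_fun setT (fun x => sorted <%R (G x)).
Proof.
move=> mG; under [X in measurable_fun _ X]eq_fun do rewrite sorted_ltE mG.1.
by apply: measurable_all_seq => i; apply: measurable_fun_ltr; exact: mG.2.
Qed.

Lemma measurable_step_weight theta m n (G H : X -> seq R) :
  measurable_seq m G -> measurable_seq n H ->
  measurable_fun setT (fun x => step_weight theta (G x) (H x) : T).
Proof.
move=> mG mH; have mV := measurable_vand mG; have mV' := measurable_vand mH.
apply: measurable_funM; last first.
  apply: measurableT_comp (@normr_measurable _ setT) _.
  by apply: measurable_funM => //; exact: measurable_inv.
apply: measurable_funM; last first.
  apply: measurable_inv; exact: measurableT_comp (measurable_powR _) mV.
apply: (@eq_measurable_fun _ _ _ _ _ (fun x => \prod_(i < m) \prod_(j < n)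
  `|nth 0 (G x) i - nth 0 (H x) j| `^ (theta - 1) : T)).
  move=> x _; rewrite (big_nth 0) big_mkord mG.1; apply: eq_bigr => i _.
  by rewrite [RHS](big_nth 0) big_mkord mH.1.
apply: measurable_prod => i _; apply: measurable_prod => j _.
apply: measurableT_comp (measurable_powR _) _.
apply: measurableT_comp (@normr_measurable _ setT) _.
by apply: measurable_funB; [exact: mG.2|exact: mH.2].
Qed.

Lemma measurable_triangle_row m (G : X -> seq R) j : measurable_seq m G ->
  measurable_seq j (fun x => triangle_row j (G x)).
Proof. by move=> mG; apply: measurable_seq_mkseq => i; exact: mG.2. Qed.

Lemma measurable_strict_triangle m (G : X -> seq R) n : measurable_seq m G ->
  measurable_fun setT (fun x => strict_triangle n (G x)).
Proof.
move=> mG; apply: measurable_all_seq => j.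
exact: measurable_interlace_pair (measurable_triangle_row j mG) (measurable_triangle_row j.+1 mG).
Qed.

Lemma measurable_triangle_weight theta m (G : X -> seq R) n : measurable_seq m G ->
  measurable_fun setT (fun x => triangle_weight theta n (G x) : T).
Proof.
move=> mG; apply: measurable_prod => j _.
exact: measurable_step_weight (measurable_triangle_row j mG) (measurable_triangle_row j.+1 mG).
Qed.

End triangle_measurability.

Section rayleigh_integral.
Context (R : realType) (K : base_algebra).
Local Notation d := (base_dim K).
Local Notation T := (measurableTypeR R).
Local Notation theta := (base_theta R K).
Local Open Scope ereal_scope.

(** Nullity of the complement is expressed by a vanishing integral of +oo, which dominates every
    [F]. *)
Lemma tint_restrict n (b : seq R -> bool) (F : seq R -> \bar R) :
  measurable_fun setT (fun t : n.-tuple T => b t) -> tmeasurable n F ->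
  (forall s, 0 <= F s) -> tint n (fun s => if b s then 0 else +oo) = 0 ->
  tint n F = tint n (fun s => if b s then F s else 0).
Proof.
move=> mb mF F0 null.
have -> : tint n F = tint n (fun s => (if b s then F s else 0) + (if b s then 0 else F s)).
  by apply: eq_tint => s _; case: ifP => _; rewrite ?adde0 ?add0e.
have mcst : tmeasurable n (fun=> 0 : \bar R) by exact: measurable_cst.
have m1 : tmeasurable n (fun s => if b s then F s else 0) by exact: measurable_fun_ifT.
have m2 : tmeasurable n (fun s => if b s then 0 else F s) by exact: measurable_fun_ifT.
have m3 : tmeasurable n (fun s => if b s then 0 else +oo : \bar R).
  by apply: measurable_fun_ifT; [exact: mb|exact: measurable_cst|exact: measurable_cst].
rewrite {1}/tint ge0_integralD//; try by move=> t _; case: ifP.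
rewrite [X in _ + X](_ : _ = 0) ?adde0//.
apply/eqP; rewrite eq_le integral_ge0 ?andbT; last by move=> t _; case: ifP.
rewrite -[X in _ <= X]null; apply: ge0_le_integral => //; try by move=> t _; case: ifP.
by move=> t _; case: ifP => // _; rewrite leey.
Qed.

Definition rseq n (s : seq R) : seq R := flatten [seq eigs K j.+1 s | j <- iota 0 n].

Lemma rseqS n s : rseq n.+1 s = rseq n s ++ eigs K n.+1 s.
Proof. by rewrite /rseq -[iota 0 n.+1]/(iota 0 (n.+1)) -(addn1 n) iotaD map_cat flatten_cat /= cats0 add0n !addn1. Qed.

Lemma size_rseq n s : size (rseq n s) = 'C(n.+1, 2).
Proof. by elim: n => // n IH; rewrite rseqS size_cat IH size_eigs [in RHS]binS bin1. Qed.

Lemma triangle_row_rseq n s : triangle_row n (rseq n s) = eigs K n s.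
Proof.
case: n => [|n]; last by rewrite rseqS triangle_row_last ?size_rseq ?size_eigs.
by have /size0nil -> := size_eigs K 0 s.
Qed.

Lemma rseq_cat n s t : size s = herm_dim K n -> rseq n (s ++ t) = rseq n s.
Proof.
move=> ss; congr flatten; apply/eq_in_map => j; rewrite mem_iota /= => jn.
congr (tval (eigenvalues _)); apply: eq_hmx => i ij.
by rewrite nth_cat ss (leq_trans ij)//; exact: leq_herm_offset.
Qed.

Lemma measurable_rseq dX (X : measurableType dX) m (G : X -> seq R) n :
  measurable_seq m G -> measurable_seq 'C(n.+1, 2) (fun x => rseq n (G x)).
Proof.
move=> mG; elim: n => [|n IH]; first exact: measurable_seq_cst.
under [X in measurable_seq _ X]eq_fun do rewrite rseqS.
rewrite binS bin1; apply: measurable_seq_cat => //.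
exact: measurable_eigs mG.
Qed.

Let C : R := (pi `^ theta / Gamma theta)%R.
Let C0 : (0 <= C)%R. Proof. by rewrite divr_ge0 ?powR_ge0 ?Gamma_ge0. Qed.

Lemma tint_fiber n s (g : seq R -> \bar R) :
  size s = herm_dim K n -> sorted <%R (eigs K n s) ->
  tmeasurable n.+1 g -> (forall mu, 0 <= g mu) ->
  tint (d * n + 1) (fun t => g (eigs K n.+1 (s ++ t))) =
  (C ^+ n)%:E * tint n.+1 (fun mu => if interlace (eigs K n s) mu
    then g mu * (step_weight theta (eigs K n s) mu)%:E else 0).
Proof.
move=> ss sorted_s mg g0.
have [s' ss' s'E] := diagonal_coordinates K (fun i : 'I_n => nth 0%R (eigs K n s) i).
rewrite (tint_eigs_diag ss ss' s'E)//.
by rewrite (@tint_eigs_radial _ _ _ _ (eigs K n s)) ?size_eigs.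
Qed.

(* Blocks with a multiple eigenvalue are null: apply the induction hypothesis  *)
(* to the function equal to +oo there, which vanishes on strict triangles.     *)
Lemma tint_rseq n (f : seq R -> \bar R) :
  tmeasurable 'C(n.+1, 2) f -> (forall L, 0 <= f L) ->
  tint (herm_dim K n) (fun s => f (rseq n s)) =
  (C ^+ 'C(n, 2))%:E * tint 'C(n.+1, 2) (fun L =>
    if strict_triangle n L then f L * (triangle_weight theta n L)%:E else 0).
Proof.
elim: n f => [|n IH] f mf f0.
  have -> : herm_dim K 0 = 0%N by rewrite /herm_dim /herm_offset muln0.
  by rewrite !tint0 /= /triangle_weight big_ord0 mule1 mul1e.
have dimE : herm_dim K n.+1 = (herm_dim K n + (d * n + 1))%N.
  by rewrite /herm_dim herm_offsetS -addn1 addnA.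
have binE : 'C(n.+2, 2) = ('C(n.+1, 2) + n.+1)%N by rewrite binS bin1.
have mt m : measurable_seq m (fun t : m.-tuple T => t : seq R) by exact: measurable_seq_tval.
pose F L := if interlace (triangle_row n L) (triangle_row n.+1 L)
  then f L * (step_weight theta (triangle_row n L) (triangle_row n.+1 L))%:E else 0.
have F0 L : 0 <= F L.
  by rewrite /F; case: ifP => // _; rewrite mule_ge0// lee_fin step_weight_ge0.
have mF : tmeasurable 'C(n.+2, 2) F.
  apply: measurable_fun_ifT => //.
    exact: measurable_interlace_pair (measurable_triangle_row _ (mt _)) (measurable_triangle_row _ (mt _)).
  apply: emeasurable_funM => //.
  have := measurable_step_weight theta (measurable_triangle_row n (mt 'C(n.+2, 2))) (measurable_triangle_row n.+1 (mt 'C(n.+2, 2))).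
  by move=> /measurable_EFinP.
pose Phi L := tint n.+1 (fun mu => F (L ++ mu)).
have Phi0 L : 0 <= Phi L by exact: tint_ge0.
have mPhi : tmeasurable 'C(n.+1, 2) Phi.
  by apply: tmeasurable_tint_cat => //; rewrite -binE.
have FE L mu : size L = 'C(n.+1, 2) -> size mu = n.+1 -> F (L ++ mu) =
    if interlace (triangle_row n L) mu then f (L ++ mu) * (step_weight theta (triangle_row n L) mu)%:E else 0.
  by move=> sL sm; rewrite /F (triangle_row_last sL sm) (triangle_row_cat _ sL).
pose W s := tint (d * n + 1) (fun t => f (rseq n.+1 (s ++ t))).
have mfr : tmeasurable (herm_dim K n.+1) (fun s => f (rseq n.+1 s)).
  by apply: (measurable_comp_seq mf); exact: measurable_rseq (mt _).
have W0 s : 0 <= W s by exact: tint_ge0.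
have mW : tmeasurable (herm_dim K n) W.
  by apply: (tmeasurable_tint_cat (F := fun s => f (rseq n.+1 s))) => //; rewrite -dimE.
have WE s : size s = herm_dim K n -> sorted <%R (eigs K n s) ->
    W s = (C ^+ n)%:E * Phi (rseq n s).
  move=> ss sorted_s; transitivity (tint (d * n + 1)
      (fun t => (fun mu => f (rseq n s ++ mu)) (eigs K n.+1 (s ++ t)))).
    by apply: eq_tint => t _; rewrite rseqS rseq_cat.
  have mg : tmeasurable n.+1 (fun mu => f (rseq n s ++ mu)).
    apply: (measurable_comp_seq mf); rewrite binE -(size_rseq n s).
    by apply: measurable_seq_cat => //; exact: measurable_seq_cst.
  apply: (etrans (tint_fiber ss sorted_s mg (fun _ => f0 _))).
  congr (_ * _); apply: eq_tint => mu smu.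
  by rewrite FE ?size_rseq// triangle_row_rseq.
rewrite dimE tint_cat//; last by rewrite -dimE.
rewrite -/W; rewrite (@tint_restrict _ (fun s => sorted <%R (eigs K n s)))//; first last.
- transitivity (tint (herm_dim K n) (fun s => (fun L => if sorted <%R (triangle_row n L) then 0 else +oo) (rseq n s))).
    by apply: eq_tint => s _; rewrite triangle_row_rseq.
  apply: (etrans (IH (fun L => if sorted <%R (triangle_row n L) then 0 else +oo) _ _)).
  + apply: measurable_fun_ifT; [|exact: measurable_cst|exact: measurable_cst].
    exact: measurable_sorted_lt (measurable_triangle_row _ (mt _)).
  + by move=> L; case: ifP.
  rewrite [X in _ * X](_ : _ = tint 'C(n.+1, 2) (fun=> 0)); last first.
    by apply: eq_tint => L _; case: ifPn => // /strict_triangle_sorted ->; rewrite mul0e.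
  by rewrite /tint integral0 mule0.
- exact: measurable_sorted_lt (measurable_eigs _ _ (mt _)).
transitivity (tint (herm_dim K n) (fun s =>
    (fun L => if sorted <%R (triangle_row n L) then (C ^+ n)%:E * Phi L else 0) (rseq n s))).
  by apply: eq_tint => s ss; rewrite triangle_row_rseq; case: ifPn => // /(WE _ ss).
have mw : measurable_fun setT (fun L : 'C(n.+1, 2).-tuple T => (triangle_weight theta n L)%:E).
  by have /measurable_EFinP := measurable_triangle_weight theta n (mt 'C(n.+1, 2)).
have Cn0 : 0 <= (C ^+ n)%:E by rewrite lee_fin exprn_ge0.
apply: (etrans (IH (fun L => if sorted <%R (triangle_row n L) then (C ^+ n)%:E * Phi L else 0) _ _)).
- apply: measurable_fun_ifT; [|exact: measurable_funeM|exact: measurable_cst].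
  exact: measurable_sorted_lt (measurable_triangle_row _ (mt _)).
- by move=> L; case: ifP => // _; rewrite mule_ge0.
have -> : (C ^+ 'C(n.+1, 2))%:E = (C ^+ 'C(n, 2))%:E * (C ^+ n)%:E :> \bar R.
  by rewrite -EFinM -exprD binS bin1.
rewrite -muleA; congr (_ * _).
pose V L := if strict_triangle n L then Phi L * (triangle_weight theta n L)%:E else 0.
transitivity (tint 'C(n.+1, 2) (fun L => (C ^+ n)%:E * V L)).
  apply: eq_tint => L _; rewrite /V; case: ifPn => [h|_]; last by rewrite mule0.
  by rewrite strict_triangle_sorted// muleA.
rewrite tintZ//; first last.
- by move=> L; rewrite /V; case: ifP => // _; rewrite mule_ge0// lee_fin triangle_weight_ge0.
- apply: measurable_fun_ifT => //; last exact: emeasurable_funM.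
  exact: measurable_strict_triangle (mt _).
congr (_ * _); rewrite binE tint_cat; first last.
- by move=> L; case: ifP => // _; rewrite mule_ge0// lee_fin triangle_weight_ge0.
- rewrite -binE; apply: measurable_fun_ifT => //.
    exact: measurable_strict_triangle (mt _).
  apply: emeasurable_funM => //.
  by have /measurable_EFinP := measurable_triangle_weight theta n.+1 (mt 'C(n.+2, 2)).
apply: eq_tint => L sL; rewrite /V; case: ifPn => h; last first.
  rewrite [RHS](_ : _ = tint n.+1 (fun=> 0)); first by rewrite /tint integral0.
  by apply: eq_tint => mu sm; rewrite strict_triangle_cat// (negbTE h).
rewrite muleC -tintZ//; last 2 first.
- apply: (measurable_comp_seq mF); rewrite binE -sL.
  by apply: measurable_seq_cat => //; exact: measurable_seq_cst.
- by rewrite lee_fin triangle_weight_ge0.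
apply: eq_tint => mu sm; rewrite strict_triangle_cat// h FE//=.
case: ifP => _; last by rewrite mule0.
by rewrite triangle_weight_cat// EFinM muleCA; congr (_ * _); rewrite muleC.
Qed.

End rayleigh_integral.

(** * The density *)

Section density.
Context (R : realType).
Implicit Types L : seq R.

Lemma vand_rcons (s : seq R) y : vand (rcons s y) = vand s * \prod_(x <- s) (y - x).
Proof.
elim: s => [|x s IH] /=; first by rewrite !big_nil.
by rewrite IH big_rcons/= big_cons; ring.
Qed.

Lemma vand_mkseq (f : nat -> R) n :
  vand (mkseq f n) = \prod_(0 <= q < n) \prod_(0 <= p < q) (f q - f p).
Proof.
elim: n => [|n IH]; first by rewrite big_nil.
by rewrite seq.mkseqS vand_rcons IH big_nat_recr//= big_map /index_iota subn0.
Qed.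

Definition tri L j k : R := nth 0 L ('C(j, 2) + k.-1).

Definition tri_density (theta : R) n L : R :=
  (\prod_(2 <= j < n.+1) \prod_(1 <= a < j) \prod_(1 <= p < j.+1)
     `|tri L j.-1 a - tri L j p| `^ (theta - 1)) /
  (\prod_(2 <= j < n) \prod_(1 <= b < j.+1) \prod_(1 <= a < b)
     (tri L j b - tri L j a) `^ (2 * theta - 2)) *
  \prod_(1 <= q < n.+1) \prod_(1 <= p < q) (tri L n q - tri L n p).

Lemma prod_tri_vand n L :
  \prod_(1 <= q < n.+1) \prod_(1 <= p < q) (tri L n q - tri L n p) = vand (triangle_row n L).
Proof.
rewrite vand_mkseq big_add1; apply: eq_bigr => q _.
by rewrite big_add1.
Qed.

Lemma strict_triangle_le m n L : (m <= n)%N -> strict_triangle n L -> strict_triangle m L.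
Proof. by move=> /subnKC <-; rewrite /strict_triangle iotaD all_cat => /andP[]. Qed.

Lemma prod_from2 (f : nat -> R) n : f 0%N = 1 -> f 1%N = 1 ->
  \prod_(2 <= j < n) f j = \prod_(0 <= j < n) f j.
Proof.
move=> f0 f1; case: n => [|[|n]]; first by rewrite !big_geq.
  by rewrite big_geq// big_nat1.
by rewrite [RHS]big_ltn// [X in _ * X]big_ltn// f0 f1 !mul1r.
Qed.

(** In the product of step weights the quotients vand (row j + 1) / vand (row j) telescope to the
    last Vandermonde product. The powers of [vand] in the denominator run over rows 0 to n - 1, and
    rows 0 and 1 contribute 1, whence the products starting at 2. *)
Lemma tri_density_strict theta n L : (0 < n)%N -> strict_triangle n L ->
  tri_density theta n L = triangle_weight theta n L.
Proof.
move=> n0 sL; pose V j := vand (triangle_row j L).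
have V0 j : (j <= n)%N -> 0 < V j.
  by move=> jn; apply/vand_gt0/strict_triangle_sorted/(strict_triangle_le jn).
pose A j := \prod_(a <- triangle_row j L) \prod_(p <- triangle_row j.+1 L) `|a - p| `^ (theta - 1).
rewrite /tri_density prod_tri_vand -/(V n).
have -> : \prod_(2 <= j < n.+1) \prod_(1 <= a < j) \prod_(1 <= p < j.+1)
     `|tri L j.-1 a - tri L j p| `^ (theta - 1) = \prod_(0 <= j < n) A j.
  have A0 : A 0%N = 1 by rewrite /A /triangle_row /mkseq /= big_nil.
  rewrite big_add1 [RHS]big_ltn// A0 mul1r.
  apply: eq_bigr => j _; rewrite /A big_map big_add1 /index_iota subn0.
  apply: eq_bigr => a _; rewrite big_map -/(index_iota 1 _) big_add1 /index_iota subn0.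
  by apply: eq_bigr => p _.
have -> : \prod_(2 <= j < n) \prod_(1 <= b < j.+1) \prod_(1 <= a < b)
     (tri L j b - tri L j a) `^ (2 * theta - 2) =
     \prod_(0 <= j < n) V j `^ (2 * theta - 2).
  rewrite -prod_from2; last 2 first.
  - by rewrite /V /= powR1.
  - by rewrite /V /= big_nil mul1r powR1.
  apply: eq_big_nat => j /andP[_ jn].
  have srt := strict_triangle_sorted (strict_triangle_le (ltnW jn) sL).
  have pos q p : (p < q < j)%N -> 0 < tri L j q.+1 - tri L j p.+1.
    move=> /andP[pq qj]; rewrite subr_gt0 /tri.
    have := sorted_ltn_nth lt_trans 0 srt; rewrite size_triangle_row => /(_ p q).
    by rewrite !inE (ltn_trans pq qj) qj !nth_mkseq ?(ltn_trans pq qj)//; apply.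
  rewrite /V /triangle_row vand_mkseq big_add1.
  have prodP (I : eqType) (r : seq I) (F : I -> R) e : {in r, forall i, 0 < F i} ->
      \prod_(i <- r) F i `^ e = (\prod_(i <- r) F i) `^ e.
    move=> Fp; have := @powR_prod R [seq F i | i <- r] e; rewrite !big_map; apply.
    by apply/allP => _ /mapP[i ir ->]; exact: Fp.
  have inner q : (q < j)%N -> \prod_(1 <= a < q.+1) (tri L j q.+1 - tri L j a) `^ (2 * theta - 2) =
      (\prod_(0 <= p < q) (tri L j q.+1 - tri L j p.+1)) `^ (2 * theta - 2).
    move=> qj; rewrite big_add1 prodP// => p; rewrite mem_index_iota => /andP[_ pq].
    by apply: pos; rewrite pq.
  rewrite (eq_big_nat _ _ (F2 := fun q => (\prod_(0 <= p < q) (tri L j q.+1 - tri L j p.+1)) `^ (2 * theta - 2))); last first.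
    by move=> q /andP[_ qj]; exact: inner.
  rewrite prodP// => q; rewrite mem_index_iota => /andP[_ qj].
  rewrite big_seq prodr_gt0// => p; rewrite mem_index_iota => /andP[_ pq].
  by apply: pos; rewrite pq.
have tel m : (m <= n)%N -> \prod_(0 <= j < m) `|V j.+1 / V j| = V m.
  elim: m => [|m IH] mn; first by rewrite big_geq.
  rewrite big_nat_recr//= IH 1?ltnW// ger0_norm ?divr_ge0 ?(ltW (V0 _ _))//; last exact: ltnW.
  by rewrite mulrC divfK// gt_eqF// V0// ltnW.
rewrite -[X in _ * X]tel// /triangle_weight -(big_mkord predT (fun j => step_weight theta (triangle_row j L) (triangle_row j.+1 L))).
by rewrite /step_weight -prodf_div -!big_split/=.
Qed.

Definition weak_triangle n L : bool :=
  all (fun j => all (fun i => (tri L j.+1 i.+1 <= tri L j i.+1) && (tri L j i.+1 <= tri L j.+1 i.+2))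
    (iota 0 j)) (iota 0 n).

Lemma strict_triangleE n L : strict_triangle n L =
  all (fun j => all (fun i => (tri L j.+1 i.+1 < tri L j i.+1) && (tri L j i.+1 < tri L j.+1 i.+2))
    (iota 0 j)) (iota 0 n).
Proof.
apply: eq_all => j; rewrite interlaceE ?size_triangle_row//; apply: eq_in_all => i.
rewrite mem_iota add0n => /andP[_ ij].
by rewrite !nth_mkseq// (leq_trans ij).
Qed.

Lemma rayleigh_trianglesE n (L : 'C(n.+1, 2).-tuple (measurableTypeR R)) : (0 < n)%N ->
  rayleigh_triangles R n L <-> weak_triangle n L.
Proof.
move=> n0; split.
  move=> h; apply/allP => j; rewrite mem_iota /= => jn; apply/allP => i.
  by rewrite mem_iota /= => ij; apply: h; lia.
move=> /allP h j [//|k] /andP[_ kj] jn.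
have /h/allP/(_ k) : j \in iota 0 n by rewrite mem_iota; lia.
by rewrite mem_iota; apply.
Qed.

(** Only the factor of the last row carries a sign; consecutive entries of that row are ordered
    through the entry of row n - 1 between them. *)
Lemma tri_density_ge0 theta n L : (0 < n)%N -> weak_triangle n L -> 0 <= tri_density theta n L.
Proof.
move=> n0 wL; apply: mulr_ge0.
  apply: divr_ge0; rewrite prodr_ge0// => j _; rewrite prodr_ge0// => a _;
  by rewrite prodr_ge0// => p _; exact: powR_ge0.
have step k : (k.+1 < n)%N -> tri L n k.+1 <= tri L n k.+2.
  move=> kn; have /allP/(_ n.-1) := wL; rewrite mem_iota prednK//.
  rewrite add0n leqnn => /(_ isT)/allP/(_ k); rewrite mem_iota add0n.
  by rewrite ltn_predRL kn => /(_ isT)/andP[]; exact: le_trans.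
have mono p q : (p <= q)%N -> (q < n)%N -> tri L n p.+1 <= tri L n q.+1.
  move=> /subnKC <-; elim: (q - p)%N => [|k IH]; first by rewrite addn0.
  rewrite addnS => h; apply: (le_trans (IH _)); first exact: ltnW.
  exact: step.
rewrite big_add1 big_seq prodr_ge0// => q; rewrite mem_index_iota => /andP[_ qn].
rewrite big_add1 big_seq prodr_ge0// => p; rewrite mem_index_iota => /andP[_ pq].
by rewrite subr_ge0 mono// ltnW.
Qed.

Lemma rayleigh_constE n theta : rayleigh_const n theta =
  (pi `^ theta / Gamma theta) ^+ 'C(n, 2) :> R.
Proof.
have half : (n * n.-1)%:R / 2 = 'C(n, 2)%:R :> R.
  have -> : (n * n.-1)%N = ('C(n, 2) * 2)%N by rewrite bin2 muln2 halfK; case: n => [|m]; rewrite ?oddM /= ?andbN ?andNb subn0.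
  by rewrite natrM mulfK.
rewrite /rayleigh_const half mulrAC half [(_ * theta)%R]mulrC powRrM !powR_mulrn ?powR_ge0 ?Gamma_ge0//.
by rewrite exprMn exprVn.
Qed.

End density.

(** * Triangles with coinciding entries are negligible *)

Section coincidences.
Context (R : realType).
Local Notation T := (measurableTypeR R).
Local Open Scope ereal_scope.

Definition distinct_at (l : seq (nat * nat)) (s : seq R) : bool :=
  all (fun p => nth 0%R s p.1 != nth 0%R s p.2) l.

Lemma measurable_neq_coord n i j :
  measurable_fun setT (fun t : n.-tuple T => nth 0%R t i != nth 0%R t j).
Proof. by apply: measurable_neg; apply: measurable_fun_eqr; exact: measurable_nth. Qed.

(** Coincidences are removed one pair at a time, each being confined to a hyperplane. *)
Lemma tint_distinct n (l : seq (nat * nat)) (F : seq R -> \bar R) :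
  all (fun p => (p.1 < n)%N && (p.1 != p.2)) l ->
  tmeasurable n F -> (forall s, 0 <= F s) ->
  tint n F = tint n (fun s => if distinct_at l s then F s else 0).
Proof.
elim: l F => [|p l IH] F //= /andP[/andP[pn p12] hl] mF F0.
have mb := @measurable_neq_coord n p.1 p.2.
rewrite (tint_restrict (b := fun s => nth 0%R s p.1 != nth 0%R s p.2) mb mF F0); last first.
  rewrite -[RHS](@tint_null_coord _ n p.1 (fun s => nth 0%R s p.2) (fun=> +oo))//.
  - by apply: eq_tint => s _; case: eqP.
  - exact: measurable_nth.
  - by move=> s x _; rewrite nth_set_nth /= eq_sym (negbTE p12).
  - exact: measurable_cst.
rewrite IH//; first last.
- by move=> s; case: ifP.
- by apply: measurable_fun_ifT => //; exact: measurable_cst.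
by apply: eq_tint => s _; rewrite /distinct_at /=; case: (nth _ _ _ != _) => //=; case: ifP.
Qed.

Definition off_diagonal N : seq (nat * nat) :=
  [seq p <- [seq (i, j) | i <- iota 0 N, j <- iota 0 N] | p.1 != p.2].

Lemma off_diagonal_bounded N : all (fun p => (p.1 < N)%N && (p.1 != p.2)) (off_diagonal N).
Proof.
apply/allP => -[i j]; rewrite mem_filter /= => /andP[ij].
case/allpairsP=> -[i' j'] /= [iN _ [ii' _]]; rewrite ij andbT ii'.
by move: iN; rewrite mem_iota.
Qed.

Lemma distinct_at_neq N (s : seq R) i j : distinct_at (off_diagonal N) s ->
  (i < N)%N -> (j < N)%N -> i != j -> nth 0%R s i != nth 0%R s j.
Proof.
move=> /allP h iN jN ij; apply: (h (i, j)); rewrite mem_filter /= ij /=.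
by apply/allpairsP; exists (i, j); rewrite !mem_iota.
Qed.

Lemma weak_triangle_strict n (L : seq R) : distinct_at (off_diagonal 'C(n.+1, 2)) L ->
  weak_triangle n L = strict_triangle n L.
Proof.
move=> dL; rewrite strict_triangleE; apply: eq_in_all => j; rewrite mem_iota add0n => /andP[_ jn].
apply: eq_in_all => i; rewrite mem_iota add0n => /andP[_ ij].
have jS : ('C(j.+2, 2) <= 'C(n.+1, 2))%N by exact: leq_bin2l.
have j1 : 'C(j.+2, 2) = ('C(j.+1, 2) + j.+1)%N by rewrite binS bin1.
have j2 : 'C(j.+1, 2) = ('C(j, 2) + j)%N by rewrite binS bin1.
rewrite /tri /= !lt_neqAle.
rewrite (distinct_at_neq dL) ?(distinct_at_neq dL)//; lia.
Qed.

Lemma measurable_weak_triangle n N :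
  measurable_fun setT (fun t : N.-tuple T => weak_triangle n t).
Proof.
apply: measurable_all_seq => j; apply: measurable_all_seq => i.
by apply: measurable_and; apply: measurable_fun_ler; exact: measurable_nth.
Qed.

Lemma measurable_tri_density theta n N :
  measurable_fun setT (fun t : N.-tuple T => tri_density theta n t : T).
Proof.
have mt j k : measurable_fun setT (fun t : N.-tuple T => tri t j k : T) by exact: measurable_nth.
apply: measurable_funM.
  apply: measurable_funM.
    do 3 (apply: measurable_prod => ? _).
    apply: measurableT_comp (measurable_powR _) _.
    apply: measurableT_comp (@normr_measurable _ setT) _.
    by apply: measurable_funB; exact: mt.
  apply: measurable_inv; do 3 (apply: measurable_prod => ? _).
  apply: measurableT_comp (measurable_powR _) _; by apply: measurable_funB; exact: mt.
by do 2 (apply: measurable_prod => ? _); apply: measurable_funB; exact: mt.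
Qed.

End coincidences.

(** * The Rayleigh map in coordinates *)

Section rayleigh_map.
Context (R : realType) (K : base_algebra).
Local Notation T := (measurableTypeR R).

Lemma rayleigh_map_hmx n (x : (herm_dim K n).-tuple T) :
  rayleigh_map (herm_of_coords x) = rseq K n x :> seq R.
Proof.
rewrite /= /rayleigh_seq /rseq -val_enum_ord -map_comp; congr flatten.
by apply: eq_map => j /=; rewrite hmx_tuple left_upper_block_hmx.
Qed.

Lemma triangle_row_rseq_le n j (s : seq R) : (j <= n)%N -> triangle_row j (rseq K n s) = eigs K j s.
Proof.
elim: n => [|n IH]; first by rewrite leqn0 => /eqP ->; rewrite triangle_row_rseq.
rewrite leq_eqVlt => /predU1P[->|jn]; first by rewrite triangle_row_rseq.
by rewrite rseqS (triangle_row_cat _ (size_rseq K n s))// IH.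
Qed.

Lemma eigs_interlacing j (s : seq R) i : (i < j)%N ->
  nth 0 (eigs K j.+1 s) i <= nth 0 (eigs K j s) i <= nth 0 (eigs K j.+1 s) i.+1.
Proof.
move=> ij; rewrite -addn1 /eigs.
have hh := hmx_hermitian K (j + 1) s.
have ul : ulsubmx (hmx K (j + 1) s) = hmx K j s.
  by apply/matrixP => k l; rewrite !mxE.
rewrite -(submxK (hmx K (j + 1) s)) in hh *; rewrite ul in hh *.
exact: cauchy_interlacing hh ij.
Qed.

Lemma weak_triangle_rseq n (s : seq R) : weak_triangle n (rseq K n s).
Proof.
apply/allP => j; rewrite mem_iota add0n => /andP[_ jn].
apply/allP => i; rewrite mem_iota add0n => /andP[_ ij].
have triE k l : (k <= n)%N -> (l < k)%N -> tri (rseq K n s) k l.+1 = nth 0 (eigs K k s) l.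
  by move=> kn lk; rewrite -(triangle_row_rseq_le s kn) nth_mkseq.
have := eigs_interlacing s ij.
by rewrite !triE// ?ltnS// ltnW.
Qed.

Lemma rayleigh_trianglesP n (A : herm R K n) : (0 < n)%N ->
  rayleigh_triangles R n (rayleigh_map A).
Proof.
move=> n0; have [x <-] := herm_of_coords_surj A.
by apply/rayleigh_trianglesE => //; rewrite rayleigh_map_hmx weak_triangle_rseq.
Qed.

Lemma rayleigh_mapE n (x : (herm_dim K n).-tuple T) :
  rayleigh_map (herm_of_coords x) = tuple_of_seq 'C(n.+1, 2) (rseq K n x).
Proof.
apply/val_inj/(etrans (rayleigh_map_hmx x))/esym/tuple_of_seqE.
exact: size_rseq.
Qed.

Lemma measurable_rayleigh_map n :
  measurable_fun setT (@rayleigh_map R K n).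
Proof.
move=> _ A mA; rewrite setTI.
have := measurable_tuple_of_seq (measurable_rseq K n (measurable_seq_tval
  (@measurable_id _ ((herm_dim K n).-tuple T) setT))).
move=> /(_ measurableT A mA); rewrite setTI => h.
(* A set of Hermitian matrices is measurable when its preimage under [herm_of_coords] is, so only
   the map in coordinates matters. *)
rewrite /measurable /= /herm_measurable /image_set_system /= setTI.
by congr (measurable _): h; apply/funext => x /=; rewrite rayleigh_mapE.
Qed.

End rayleigh_map.

Theorem proposition1p1 (R : realType) (K : base_algebra) (n : nat)
    (hn : (1 <= n)%N) :
  [/\ (forall T : herm R K n, rayleigh_triangles R n (rayleigh_map T)),
      measurable_fun [set: herm R K n] (@rayleigh_map R K n)
    & forall B : set ('C(n.+1, 2).-tuple (measurableTypeR R)), measurable B ->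
        pushforward (lebesgue_herm R K n) (@rayleigh_map R K n) B =
        (\int[lebesgue_tuple R 'C(n.+1, 2)]_(L in B `&` rayleigh_triangles R n)
          (rayleigh_const n (base_theta R K) *
           rayleigh_density (base_theta R K) L)%:E)%E ].
Proof.
split=> [A||B mB]; first exact: rayleigh_trianglesP.
  exact: measurable_rayleigh_map.
set N := 'C(n.+1, 2); set theta := base_theta R K; set C := rayleigh_const n theta.
pose T := measurableTypeR R.
have mid : measurable_seq N (fun t : N.-tuple T => t : seq R).
  exact: measurable_seq_tval.
pose b (L : seq R) : bool := tuple_of_seq N L \in B.
have tE (t : N.-tuple T) : tuple_of_seq N (t : seq R) = t.
  by apply/val_inj/tuple_of_seqE; rewrite size_tuple.
have mb : measurable_fun setT (fun t : N.-tuple T => b t).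
  apply: (measurable_fun_bool true); rewrite [X in measurable X](_ : _ = B)//.
  apply/seteqP; split=> t /=; rewrite /b tE; first by case=> _ /set_mem.
  by move=> Bt; split=> //; exact: mem_set.
pose f (L : seq R) : \bar R := if b L then 1%E else 0%E.
have mf : tmeasurable N f.
  by apply: measurable_fun_ifT; [exact: mb|exact: measurable_cst|exact: measurable_cst].
have C0 : 0 <= C by rewrite divr_ge0// powR_ge0.
transitivity (tint (herm_dim K n) (fun s => f (rseq K n s))).
  rewrite /pushforward /lebesgue_herm /pushforward /=.
  set S := _ @^-1` _.
  have mS : measurable S.
    have := measurable_rayleigh_map (K := K) (n := n) measurableT mB.
    rewrite setTI => h; have := @measurable_herm_of_coords R K n measurableT _ h.
    by rewrite setTI.
  rewrite -[LHS]/(lebesgue_tuple R (herm_dim K n) S).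
  rewrite -[S in LHS]setIT -integral_indic//; apply: eq_integral => t _.
  rewrite indicE /f /b -rayleigh_mapE.
  have -> : (t \in S) = (rayleigh_map (herm_of_coords t) \in B).
    by apply/idP/idP; rewrite !inE.
  by case: ifP.
rewrite tint_rseq//; last by move=> L; rewrite /f; case: ifP.
rewrite -rayleigh_constE -/theta -/C integral_mkcond.
pose F (L : seq R) : \bar R := (if b L && weak_triangle n L
  then (C * tri_density theta n L)%:E else 0)%E.
transitivity (tint N F); last first.
  apply: eq_integral => L _; rewrite patchE /F /b.
  rewrite tE in_setI; congr (if _ && _ then _ else _).
  by apply/idP/idP; rewrite inE => /rayleigh_trianglesE; apply.
have mF : tmeasurable N F.
  apply: measurable_fun_ifT => //.
    by apply: measurable_and => //; exact: measurable_weak_triangle.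
  apply/measurable_EFinP; apply: measurable_funM; first exact: measurable_cst.
  exact: measurable_tri_density.
have F0 L : (0 <= F L)%E.
  by rewrite /F; case: ifP => // /andP[_ w]; rewrite lee_fin mulr_ge0// tri_density_ge0.
pose G L := (if strict_triangle n L then f L * (triangle_weight theta n L)%:E else 0)%E.
have mG : tmeasurable N G.
  apply: measurable_fun_ifT; last exact: measurable_cst.
    exact: measurable_strict_triangle mid.
  apply: emeasurable_funM; first exact: mf.
  by have /measurable_EFinP := measurable_triangle_weight theta n mid.
have G0 L : (0 <= G L)%E.
  rewrite /G; case: ifP => // _.
  by rewrite mule_ge0 ?lee_fin ?triangle_weight_ge0// /f; case: ifP.
have CE0 : (0 <= C%:E)%E by rewrite lee_fin.
(* Both sides are restricted to triangles with pairwise distinct entries. There weak and strict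
   interlacing agree and the density is the product of the step weights, so the conventional values
   of powers and quotients at coincidences do not enter. *)
rewrite -/G -/N -(tintZ mG G0 CE0) (tint_distinct (off_diagonal_bounded N)); first last.
- by move=> L; rewrite mule_ge0.
- exact: measurable_funeM.
rewrite [RHS](tint_distinct (off_diagonal_bounded N))//.
apply: eq_tint => L _; case: ifP => // dL.
rewrite /F /G /f (weak_triangle_strict dL).
case: (b L); last by rewrite mul0e if_same mule0.
case: ifPn => [sL|_]; last by rewrite mule0.
by rewrite mul1e -EFinM tri_density_strict.
Qed.
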